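(* Let $n>1$, let $t_1,\dots,t_n\in\mathbb{C}\setminus\{0,1\}$ be pairwise distinct, put $t_{-1}=0$, $t_0=1$, and let $s,k_1,\dots,k_{n+2}$ be generic parameters. Let $$D_x=\frac{\partial}{\partial x}\cdot x(x-1)(x-t_1)\cdots(x-t_n)\frac{\partial}{\partial x}-s(s+n+1)x^n-\sum_{i=-1}^{n}\frac{k_{i+2}^2\prod_{j\ne i}(t_i-t_j)}{x-t_i},$$ $$L_{x_1,\dots,x_{n+1}}=\sum_{i=1}^{n+1}\frac{1}{\prod_{j\neq i}(x_i-x_j)}\,D_{x_i},$$ $$M_{x_1,\dots,x_{n+2}}=\sum_{i=1}^{n+2}\frac{x_i(x_i-1)(x_i-t_1)\cdots(x_i-t_n)}{\prod_{j\ne i}(x_i-x_j)}\cdot\frac{\partial}{\partial x_i}-s.$$ Define $$K_n(x_1,\dots,x_{2n+1})=\int K(x_1,\dots,x_{2n+1},q_1,\dots,q_{n+1})\,dq_1\cdots dq_{n+1},$$ where $$K(x_1,\dots,x_{2n+1},q_1,\dots,q_{n+1})=(x_1\cdots x_{2n+1})^s\prod_{j=1}^{n+1}u_j^{-k_{j+1}}q_j^{2k_{j+1}-1}\cdot\Big(1+\sum_{j=1}^{n+1}q_j\Big)^{s-k_1-\dots-k_{n+2}}\Big(1+\sum_{j=1}^{n+1}\frac{u_j}{q_j}\Big)^{s+k_1+\dots+k_{n+2}},$$ $$u_1=\frac{(x_1-1)\cdots(x_{2n+1}-1)\,t_1^2\cdots t_n^2}{x_1\cdots x_{2n+1}\,(t_1-1)^2\cdots(t_n-1)^2},\qquad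 u_{i+1}=\frac{(x_1-t_i)\cdots(x_{2n+1}-t_i)\prod_{j\ne i}t_j^2}{x_1\cdots x_{2n+1}\,(t_i-1)^2\prod_{j\neq i}(t_j-t_i)^2},\quad i=1,\dots,n,$$ the products over $j\neq i$ in the formula for $u_{i+1}$ being over $1\le j\le n$. Then $K_n$ satisfies the following system of holonomic differential equations: $$L_{x_{i_1},\dots,x_{i_{n+1}}}K_n=0\quad\text{for all }1\le i_1<\dots<i_{n+1}\le 2n+1,$$ $$M_{x_{i_1},\dots,x_{i_{n+2}}}K_n=0\quad\text{for all }1\le i_1<\dots<i_{n+2}\le 2n+1.$$
   Context: $D_{x_i}$ is $D_x$ in the variable $x=x_i$; the product $\prod_{j\neq i}(t_i-t_j)$ in $D_x$ is over $-1\le j\le n$. The integral is over an $(n+1)$-dimensional (twisted) cycle in the $q$-variables for the multivalued integrand, so that integrals of total derivatives in the $q_j$ vanish and differentiation in the $x_i$ commutes with integration. $L_{x_{i_1},\dots}$ and $M_{x_{i_1},\dots}$ are obtained by substituting the indicated variables. *)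

(* Defs.v *)
(* MathComp-Analysis; complex numbers are R[i] over an arbitrary R : realType. *)
From HB Require Import structures.
From mathcomp Require Import all_boot all_order all_algebra.
From mathcomp Require Import all_classical all_reals all_analysis.
From mathcomp Require Import complex.

Set Implicit Arguments.
Unset Strict Implicit.
Unset Printing Implicit Defensive.
Import Order.TTheory GRing.Theory Num.Theory.
Import numFieldNormedType.Exports.
Local Open Scope classical_set_scope.
Local Open Scope ring_scope.

(* R[i] bundled as a numClosedFieldType: this is what gives it its norm
   topology, so that ['D_v f x] below is differentiation over the complex
   scalars. *)
Definition CC (R : realType) : numClosedFieldType := R[i].

Definition Cexp (R : realType) (z : CC R) : CC R :=
  (expR (complex.Re z) * cos (complex.Im z)
   +i* (expR (complex.Re z) * sin (complex.Im z)))%C.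

(* The power f ^ a along the branch l of log f. *)
Definition cpow (R : realType) (l a : CC R) : CC R := Cexp (a * l).

Definition log_branch (R : realType) (T : topologicalType) (A : set T)
    (f l : T -> CC R) : Prop :=
  {within A, continuous l} /\ (forall z, A z -> Cexp (l z) = f z).

Definition coordinates_product (R : realType) (m : nat) (x : 'rV[CC R]_m) : CC R :=
  \prod_(i < m) x 0 i.

(* (t_{-1}, t_0, t_1, ..., t_n) = (0, 1, t_1, ..., t_n), so t_i sits at index
   i + 1; the parameters are stored as k : 'I_n.+2 -> CC R with k_i at index
   i - 1, so the k_{i+2} attached to t_i has the same index as t_i. *)
Definition poles (R : realType) (n : nat) (t : n.-tuple (CC R)) : 'I_n.+2 -> CC R :=
  tnth [tuple of 0 :: 1 :: t].

Definition polyQ (R : realType) (n : nat) (t : n.-tuple (CC R)) (z : CC R) : CC R :=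
  \prod_(j < n.+2) (z - poles t j).

Definition pd (R : realType) (m : nat) (i : 'I_m) (F : 'rV[CC R]_m -> CC R)
    (x : 'rV[CC R]_m) : CC R :=
  'D_(delta_mx 0 i) F x.

Definition opD (R : realType) (n m : nat) (t : n.-tuple (CC R)) (s : CC R)
    (k : 'I_n.+2 -> CC R) (i : 'I_m) (F : 'rV[CC R]_m -> CC R)
    (x : 'rV[CC R]_m) : CC R :=
  pd i (fun y => polyQ t (y 0 i) * pd i F y) x
  - s * (s + n%:R + 1) * x 0 i ^+ n * F x
  - (\sum_(j < n.+2) k j ^+ 2
       * (\prod_(l < n.+2 | l != j) (poles t j - poles t l))
       / (x 0 i - poles t j)) * F x.

(* I lists the variables x_{i_1}, ..., x_{i_{n+1}} that are substituted. *)
Definition opL (R : realType) (n m : nat) (t : n.-tuple (CC R)) (s : CC R)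
    (k : 'I_n.+2 -> CC R) (I : 'I_n.+1 -> 'I_m) (F : 'rV[CC R]_m -> CC R)
    (x : 'rV[CC R]_m) : CC R :=
  \sum_(a < n.+1)
    (\prod_(b < n.+1 | b != a) (x 0 (I a) - x 0 (I b)))^-1
    * opD t s k (I a) F x.

Definition opM (R : realType) (n m : nat) (t : n.-tuple (CC R)) (s : CC R)
    (I : 'I_n.+2 -> 'I_m) (F : 'rV[CC R]_m -> CC R) (x : 'rV[CC R]_m) : CC R :=
  \sum_(a < n.+2)
    polyQ t (x 0 (I a)) / (\prod_(b < n.+2 | b != a) (x 0 (I a) - x 0 (I b)))
    * pd (I a) F x
  - s * F x.

(* Index 0 is u_1 and index i (1 <= i <= n) is u_{i+1}. *)
Definition uvar (R : realType) (n m : nat) (t : n.-tuple (CC R)) (j : 'I_n.+1)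
    (x : 'rV[CC R]_m) : CC R :=
  if unlift ord0 j is Some i then
    (\prod_(l < m) (x 0 l - tnth t i)) * (\prod_(h < n | h != i) tnth t h ^+ 2)
    / (coordinates_product x * (tnth t i - 1) ^+ 2
       * \prod_(h < n | h != i) (tnth t h - tnth t i) ^+ 2)
  else
    (\prod_(l < m) (x 0 l - 1)) * (\prod_(h < n) tnth t h ^+ 2)
    / (coordinates_product x * \prod_(h < n) (tnth t h - 1) ^+ 2).

Definition qsum (R : realType) (n : nat) (q : 'rV[CC R]_n.+1) : CC R :=
  1 + \sum_(j < n.+1) q 0 j.

Definition uqsum (R : realType) (n m : nat) (t : n.-tuple (CC R))
    (x : 'rV[CC R]_m) (q : 'rV[CC R]_n.+1) : CC R :=
  1 + \sum_(j < n.+1) uvar t j x / q 0 j.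

(* The integrand K, written through values of the logarithms of its bases:
   lX of x_1 ... x_{2n+1}, lU j of u_{j+1}, lQ j of q_{j+1}, lA of 1 + sum q_j,
   lB of 1 + sum u_j / q_j. *)
Definition integrand (R : realType) (n : nat) (s : CC R) (k : 'I_n.+2 -> CC R)
    (lX : CC R) (lU lQ : 'I_n.+1 -> CC R) (lA lB : CC R) : CC R :=
  cpow lX s
  * (\prod_(j < n.+1)
       (cpow (lU j) (- k (lift ord0 j)) * cpow (lQ j) (2 * k (lift ord0 j) - 1)))
  * cpow lA (s - \sum_(i < n.+2) k i)
  * cpow lB (s + \sum_(i < n.+2) k i).

Definition unit_cube (R : realType) (d : nat) : set 'rV[R]_d :=
  [set tau | forall i, 0 <= tau 0 i <= 1].

(* Insert the coordinate e at position i. *)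
Definition insert_coord (R : realType) (d : nat) (i : 'I_d.+1) (e : R)
    (tau : 'rV[R]_d) : 'rV[R]_d.+1 :=
  \row_j (if unlift i j is Some j' then tau 0 j' else e).

Definition unit_int (R : realType) (f : R -> CC R) : CC R :=
  ((\int[lebesgue_measure]_(e in `[0%R, 1%R]) complex.Re (f e))
   +i* (\int[lebesgue_measure]_(e in `[0%R, 1%R]) complex.Im (f e)))%C.

(* Integral over the unit cube of R^d, as an iterated integral. *)
Fixpoint cube_int (R : realType) (d : nat) : ('rV[R]_d -> CC R) -> CC R :=
  match d with
  | 0 => fun f => f 0
  | d'.+1 => fun f =>
      unit_int (fun e => cube_int (fun tau => f (insert_coord ord0 e tau)))
  end.

Definition C1 (R : realType) (d : nat) (f : 'rV[R]_d -> R) : Prop :=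
  forall i : 'I_d,
    (forall tau, derivable f tau (delta_mx 0 i)) /\ continuous ('D_(delta_mx 0 i) f).

Definition C2 (R : realType) (d : nat) (f : 'rV[R]_d -> R) : Prop :=
  C1 f /\ forall i : 'I_d, C1 ('D_(delta_mx 0 i) f).

(* A singular (n+1)-cube in the q-space together with a coefficient and a
   branch along it of the logarithms of the q-dependent bases of the integrand.
   Only the restrictions to the unit cube matter. *)
Record twisted_cube (R : realType) (n m : nat) := TwistedCube {
  tc_coef : CC R;
  tc_map : 'rV[R]_n.+1 -> 'rV[CC R]_n.+1;
  tc_logq : 'I_n.+1 -> 'rV[R]_n.+1 -> CC R;
  tc_logA : 'rV[R]_n.+1 -> CC R;
  tc_logB : 'rV[CC R]_m * 'rV[R]_n.+1 -> CC R
}.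

Definition tc_valid (R : realType) (n m : nat) (t : n.-tuple (CC R))
    (U : set 'rV[CC R]_m) (c : twisted_cube R n m) : Prop :=
  [/\ forall j, C2 (fun tau => complex.Re (tc_map c tau 0 j)) /\
                C2 (fun tau => complex.Im (tc_map c tau 0 j)),
      forall j, log_branch (@unit_cube R n.+1) (fun tau => tc_map c tau 0 j)
                  (tc_logq c j),
      log_branch (@unit_cube R n.+1) (fun tau => qsum (tc_map c tau)) (tc_logA c)
    & log_branch (U `*` @unit_cube R n.+1)
        (fun z => uqsum t z.1 (tc_map c z.2)) (tc_logB c)].

Definition tc_jacobian (R : realType) (n m : nat) (c : twisted_cube R n m)
    (tau : 'rV[R]_n.+1) : CC R :=
  \det (\matrix_(a < n.+1, b < n.+1)
    ('D_(delta_mx 0 a) (fun v => complex.Re (tc_map c v 0 b)) tau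
     +i* 'D_(delta_mx 0 a) (fun v => complex.Im (tc_map c v 0 b)) tau)%C : 'M[CC R]_n.+1).

(* lX, lU : branches over U of the logarithms of x_1 ... x_m and of the u_j. *)
Definition tc_integrand (R : realType) (n m : nat) (s : CC R)
    (k : 'I_n.+2 -> CC R) (lX : 'rV[CC R]_m -> CC R)
    (lU : 'I_n.+1 -> 'rV[CC R]_m -> CC R) (c : twisted_cube R n m)
    (x : 'rV[CC R]_m) (tau : 'rV[R]_n.+1) : CC R :=
  integrand s k (lX x) (fun j => lU j x) (fun j => tc_logq c j tau)
    (tc_logA c tau) (tc_logB c (x, tau)).

Definition degenerate_cube (R : realType) (d : nat) (T : Type)
    (phi : 'rV[R]_d -> T) : Prop :=
  exists i : 'I_d, forall tau tau', unit_cube tau -> unit_cube tau' ->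
    (forall j, j != i -> tau 0 j = tau' 0 j) -> phi tau = phi tau'.

(* The boundary of the cubical chain Z, with coefficients in the local system
   of branches of the integrand, vanishes modulo degenerate cubes: the faces of
   Z carried by a given singular n-cube phi cancel, each one counted with its
   sign, its coefficient and the branch of the integrand that it carries. *)
Definition tc_closed (R : realType) (n m : nat) (s : CC R)
    (k : 'I_n.+2 -> CC R) (U : set 'rV[CC R]_m) (lX : 'rV[CC R]_m -> CC R)
    (lU : 'I_n.+1 -> 'rV[CC R]_m -> CC R) (Z : seq (twisted_cube R n m)) : Prop :=
  forall (phi : 'rV[R]_n -> 'rV[CC R]_n.+1) (x : 'rV[CC R]_m) (tau : 'rV[R]_n),
    ~ degenerate_cube phi -> U x -> unit_cube tau ->
    \sum_(c <- Z) \sum_(i < n.+1)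
      \sum_(e : bool | `[< forall v, unit_cube v ->
                           tc_map c (insert_coord i (e%:R : R) v) = phi v >])
        (-1) ^+ (i + e) * tc_coef c
        * tc_integrand s k lX lU c x (insert_coord i (e%:R : R) tau) = 0.

Definition twisted_cycle (R : realType) (n m : nat) (t : n.-tuple (CC R))
    (s : CC R) (k : 'I_n.+2 -> CC R) (U : set 'rV[CC R]_m)
    (lX : 'rV[CC R]_m -> CC R) (lU : 'I_n.+1 -> 'rV[CC R]_m -> CC R)
    (Z : seq (twisted_cube R n m)) : Prop :=
  (forall l : 'I_(size Z), tc_valid t U (tnth (in_tuple Z) l))
  /\ tc_closed s k U lX lU Z.

(* K_n(x) = \int_Z K(x, q) dq_1 ... dq_{n+1}. *)
Definition Kn (R : realType) (n m : nat) (s : CC R) (k : 'I_n.+2 -> CC R)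
    (lX : 'rV[CC R]_m -> CC R) (lU : 'I_n.+1 -> 'rV[CC R]_m -> CC R)
    (Z : seq (twisted_cube R n m)) (x : 'rV[CC R]_m) : CC R :=
  \sum_(c <- Z) tc_coef c
    * cube_int (fun tau => tc_integrand s k lX lU c x tau * tc_jacobian c tau).

(* Main.v *)
Require Import Defs.
From HB Require Import structures.
From mathcomp Require Import all_boot all_order all_algebra fingroup perm.
From mathcomp Require Import all_classical all_reals all_analysis.
From mathcomp Require Import complex.
From mathcomp Require Import ring lra zify.
Set Implicit Arguments.
Unset Strict Implicit.
Unset Printing Implicit Defensive.
Import Order.TTheory GRing.Theory Num.Theory.
Import numFieldNormedType.Exports.
Local Open Scope classical_set_scope.
Local Open Scope ring_scope.

(** Along a coordinate, d log K / d x_a = sum_j y_j / (x_a - t_j), where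
    y_j = beta z_j - k_j, beta = s + k_1 + ... + k_(n+2), and the
    z_j = u_j / (q_j B), with u_0 = q_0 = 1 and B = 1 + sum_j u_j / q_j, add up to 1.
    Hence M K and L K are divided differences in the variables x_(i_a).  The one in
    M K is s K, pointwise in q.  The one in L K is a combination of residues at the
    poles, - beta sum_j w_j g_j K, with w_j independent of q and
    g_j = (1 - 2 k_j) z_j + (beta - 1) z_j^2.  Stokes' formula for K / B and q_j K / B
    shows that the integral of g_j K is u_j times a factor independent of j, and
    sum_j w_j u_j = 0 is once more a divided difference, of a polynomial of degree n
    at the n + 2 poles. *)

(** In q_j the derivative of K / B is alpha K / (A B) - g_j K / u_j, with A = 1 + sum_j q_j and
    alpha = s - k_1 - ... - k_(n+2). Its first term does not depend on j: its integral is the common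
    factor. The pole 0 has no variable, since q_0 = 1; its relation comes from the sum of the
    derivatives of q_j K / B in q_j, where alpha - beta is minus twice the sum of all the k's and
    leaves only the parameter of the pole 0. The squares in u_j are those of the weights P'(t_j),
    with P(z) = prod_j (z - t_j), so that in w_j u_j the chosen variables cancel and a single weight
    stays in the denominator.

    Two features of the setting shape the rest. Branches of logarithms are merely continuous, and
    only along the cubes: their derivatives are recovered from [Cexp l = f], at points interior in
    the direction of differentiation. Cycles are closed modulo degenerate cubes, branch by branch:
    Stokes' formula is proved on each cube, where the symmetric second derivatives of the map
    cancel, and the boundary terms are then grouped by face, degenerate faces having zero minors. *)

Section RowLimits.
Variables (R : realType).

(** * Limits of row vectors, compactness of the unit cube, limits within a set *)

Lemma cvg_row (K : numFieldType) (T : Type) (F : set_system T) {FF : Filter F}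
    (m : nat) (f : T -> 'rV[K]_m) (l : 'rV[K]_m) :
  (forall j, (fun z => f z 0 j) @ F --> l 0 j) -> f @ F --> l.
Proof.
move=> h A [P lP PA].
have : \forall z \near F, forall j, P 0 j (f z 0 j).
  by apply: filter_forall => j; exact: (h j _ (lP 0 j)).
by apply: filterS => z hz; apply: PA => i j; rewrite (ord1 i).
Qed.

Lemma cvg_coord (K : numFieldType) (T : Type) (F : set_system T) {FF : Filter F}
    (m : nat) (f : T -> 'rV[K]_m) (l : 'rV[K]_m) j :
  f @ F --> l -> (fun z => f z 0 j) @ F --> l 0 j.
Proof.
move=> h; exact: (cvg_comp f (fun M : 'rV[K]_m => M 0 j) h (@coord_continuous K 1 m 0 j l)).
Qed.

Lemma unit_cube_compact (d : nat) : compact (@unit_cube R d).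
Proof.
have := @rV_compact R d (fun=> `[0%R, 1%R]%classic) (fun=> @segment_compact R 0 1).
by congr compact; apply/seteqP; split=> v /= h i; have := h i; rewrite in_itv.
Qed.

(** Compactness of the cube in near-covering form. It is the source of the uniform estimates below,
    both for slices of a continuous function and for derivatives under the integral. *)
Lemma near_cube (T : Type) (F : set_system T) {FF : Filter F} (d : nat)
    (P : T -> 'rV[R]_d -> Prop) :
  (forall tau, unit_cube tau ->
     \forall v \near tau & z \near F, unit_cube v -> P z v) ->
  \forall z \near F, forall v, unit_cube v -> P z v.
Proof.
move=> h; have /compact_near_coveringP/near_covering_withinP := @unit_cube_compact d.
by move=> /(_ T F P FF h).
Qed.

Lemma insert_coordE (d : nat) (i : 'I_d.+1) (e : R) v :
  insert_coord i e v 0 i = e.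
Proof. by rewrite mxE unlift_none. Qed.

Lemma insert_coord_lift (d : nat) (i : 'I_d.+1) (e : R) v j :
  insert_coord i e v 0 (lift i j) = v 0 j.
Proof. by rewrite mxE liftK. Qed.

Lemma insert_coord_cube (d : nat) (i : 'I_d.+1) (e : R) v :
  0 <= e <= 1 -> unit_cube v -> unit_cube (insert_coord i e v).
Proof.
move=> he hv j; have [j' ->|->] := unliftP i j.
  by rewrite insert_coord_lift.
by rewrite insert_coordE.
Qed.

Lemma insert_coord_cvg (T : Type) (F : set_system T) {FF : Filter F} (d : nat)
   (i : 'I_d.+1) (e : T -> R) (v : T -> 'rV[R]_d) e0 v0 :
  e @ F --> e0 -> v @ F --> v0 ->
  (fun z => insert_coord i (e z) (v z)) @ F --> insert_coord i e0 v0.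
Proof.
move=> he hv; apply: cvg_row => j; have [j' ->|->] := unliftP i j.
  rewrite insert_coord_lift.
  have -> : (fun z => insert_coord i (e z) (v z) 0 (lift i j')) = (fun z => v z 0 j').
    by apply/funext => z; rewrite insert_coord_lift.
  exact: cvg_coord hv.
rewrite insert_coordE.
by have -> : (fun z => insert_coord i (e z) (v z) 0 i) = e
  by apply/funext => z; rewrite insert_coordE.
Qed.

Lemma within_continuousP (S T : topologicalType) (A : set S) (f : S -> T) :
  {within A, continuous f} <-> (forall x, A x -> f @ within A (nbhs x) --> f x).
Proof. exact: subspace_continuousP. Qed.

Lemma within_id_cvg (S : topologicalType) (A : set S) (x : S) :
  (fun w => w) @ within A (nbhs x) --> x.
Proof. by move=> P; rewrite /fmap/=/within/=; apply: filterS => w Pw _; exact: Pw. Qed.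

(** Branches of logarithms are continuous only within a set, so passing to the limit through them
    requires the filter to stay in that set eventually. *)
Lemma within_comp_cvg (S T : topologicalType) (W : Type) (A : set S) (f : S -> T)
    (F : set_system W) {FF : Filter F} (g : W -> S) (x : S) :
  {within A, continuous f} -> A x -> g @ F --> x ->
  (\forall w \near F, A (g w)) -> (fun w => f (g w)) @ F --> f x.
Proof.
move=> cf Ax gx Ag; apply: cvg_comp ((within_continuousP _ _).1 cf x Ax) => P.
rewrite /within/= => hP.
by move: (gx _ hP) Ag; apply: filterS2 => w h; exact: h.
Qed.

End RowLimits.

(** * Iterated integrals of continuous real functions over the unit cube *)

Section CubeIntegral.
Variables (R : realType).
Local Notation mu := (@lebesgue_measure R).

(** The real and imaginary parts of [cube_int] are iterated real integrals of this kind, to which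
    the Lebesgue theory applies directly. *)
Fixpoint rcube (d : nat) : ('rV[R]_d -> R) -> R :=
  match d with
  | 0 => fun f => f 0
  | d'.+1 => fun f =>
      (\int[mu]_(e in `[0%R, 1%R]) rcube (fun tau => f (insert_coord ord0 e tau)))
  end.

Lemma itv01P (e : R) : (`[0%R, 1%R]%classic e) = (0 <= e <= 1).
Proof. by rewrite /= in_itv. Qed.

Lemma eq_rcube d (f g : 'rV[R]_d -> R) :
  (forall v, unit_cube v -> f v = g v) -> rcube f = rcube g.
Proof.
elim: d f g => [|d IH] f g h /=; first by apply: h => -[].
apply: eq_Rintegral => e; rewrite inE itv01P => he.
by apply: IH => v hv; apply: h; exact: insert_coord_cube.
Qed.

Lemma cube_int_rcube d (f : 'rV[R]_d -> CC R) :
  cube_int f = (rcube (fun v => complex.Re (f v)) +i*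
                rcube (fun v => complex.Im (f v)))%C.
Proof.
elim: d f => [|d IH] f; first by rewrite /=; case: (f 0).
rewrite /= /unit_int.
by congr (_ +i* _)%C; apply: eq_Rintegral => e _; rewrite IH.
Qed.

Lemma insert_coord_slice (T : topologicalType) d (f : 'rV[R]_d.+1 -> T) (i : 'I_d.+1) e :
  {within (@unit_cube R d.+1), continuous f} -> 0 <= e <= 1 ->
  {within (@unit_cube R d), continuous (fun v => f (insert_coord i e v))}.
Proof.
move=> cf he; apply/within_continuousP => v hv.
apply: (within_comp_cvg (g := insert_coord i e) cf).
- exact: insert_coord_cube.
- by apply: insert_coord_cvg; [exact: cvg_cst|exact: within_id_cvg].
- by apply: filterS (withinT _ _) => w hw; exact: insert_coord_cube.
Qed.

Lemma near_slice d (f : 'rV[R]_d.+1 -> R) (i : 'I_d.+1) (e0 eps : R) :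
  {within (@unit_cube R d.+1), continuous f} -> 0 <= e0 <= 1 -> 0 < eps ->
  \forall e \near within `[0%R, 1%R] (nbhs e0), forall v, unit_cube v ->
    `|f (insert_coord i e0 v) - f (insert_coord i e v)| <= eps.
Proof.
move=> cf he0 eps0; apply: near_cube => v hv.
have fc : (fun z : 'rV[R]_d * R => f (insert_coord i z.2 z.1)) @
   (within (@unit_cube R d) (nbhs v), within `[0%R, 1%R] (nbhs e0)) -->
   f (insert_coord i e0 v).
  apply: (within_comp_cvg (g := fun z => insert_coord i z.2 z.1) cf);
    first exact: insert_coord_cube.
  - apply: insert_coord_cvg.
      exact: (cvg_comp _ _ cvg_snd (@within_id_cvg _ _ _)).
    exact: (cvg_comp _ _ cvg_fst (@within_id_cvg _ _ _)).
  - exists ([set w | unit_cube w], `[0%R, 1%R]%classic) => /=.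
      by split; exact: withinT.
    by move=> [w e] /= [hw]; rewrite in_itv/= => he; exact: insert_coord_cube.
have gc : (fun w => f (insert_coord i e0 w)) @ within (@unit_cube R d) (nbhs v) -->
   f (insert_coord i e0 v).
  by apply: (within_continuousP _ _).1 hv; exact: insert_coord_slice.
have e2 : 0 < eps / 2 by rewrite divr_gt0.
move: fc => /cvgrPdist_lt /(_ _ e2) [[A B] /= [hA hB] AB].
move: gc => /cvgrPdist_lt /(_ _ e2) hC.
exists ([set w | unit_cube w -> A w /\
   `|f (insert_coord i e0 v) - f (insert_coord i e0 w)| < eps / 2], B) => /=.
  have hA' : nbhs v [set w | unit_cube w -> A w] := hA.
  have hC' : nbhs v [set w | unit_cube w ->
    `|f (insert_coord i e0 v) - f (insert_coord i e0 w)| < eps / 2] := hC.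
  split=> //; move: hA' hC'; apply: filterS2 => w h1 h2 hw.
  by split; [exact: h1|exact: h2].
move=> [w e] /= [h Be] hw; have [Aw h1] := h hw.
have h2 := AB (w, e) (conj Aw Be).
apply: le_trans (ler_distD (f (insert_coord i e0 v)) _ _) _.
by rewrite [eps]splitr lerD ?ltW // distrC.
Qed.

(** The sup-norm bound in dimension d is a hypothesis here because it and the continuity of slice
    integrals are proved together by induction: [rcube_lip] in dimension d + 1 needs the inner
    integrals to be integrable, hence continuous, and this continuity follows from [rcube_lip] in
    dimension d and [near_slice]. *)
Lemma rcube_slice_continuous_of d (f : 'rV[R]_d.+1 -> R) (i : 'I_d.+1) :
  (forall (g h : 'rV[R]_d -> R) (M : R),
     {within (@unit_cube R d), continuous g} ->
     {within (@unit_cube R d), continuous h} ->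
     (forall v, unit_cube v -> `|g v - h v| <= M) -> `|rcube g - rcube h| <= M) ->
  {within (@unit_cube R d.+1), continuous f} ->
  {within `[0%R, 1%R], continuous (fun e => rcube (fun v => f (insert_coord i e v)))}.
Proof.
move=> lip cf; apply/within_continuousP => e0; rewrite itv01P => he0.
apply/cvgrPdist_le => eps eps0.
near=> e; apply: lip; try apply: insert_coord_slice => //.
  suff : `[0%R, 1%R]%classic e by rewrite itv01P.
  by near: e; exact: withinT.
by near: e; exact: near_slice.
Unshelve. all: by end_near. Qed.

Lemma cc_integrable (f : R -> R) : {within `[0%R, 1%R], continuous f} ->
  mu.-integrable `[0%R, 1%R] (EFin \o f).
Proof. by apply: continuous_compact_integrable; exact: segment_compact. Qed.

Lemma Rintegral01_cst (M : R) : \int[mu]_(e in `[0%R, 1%R]) M = M.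
Proof.
by rewrite Rintegral_cst //= lebesgue_measure_itv /= lte_fin ltr01 -EFinD /= subr0 mulr1.
Qed.

Lemma rcube_lip d (g h : 'rV[R]_d -> R) (M : R) :
  {within (@unit_cube R d), continuous g} ->
  {within (@unit_cube R d), continuous h} ->
  (forall v, unit_cube v -> `|g v - h v| <= M) -> `|rcube g - rcube h| <= M.
Proof.
elim: d g h M => [|d IH] g h M cg ch H /=; first by apply: H => -[].
have Cg := rcube_slice_continuous_of (i := ord0) IH cg.
have Ch := rcube_slice_continuous_of (i := ord0) IH ch.
have Cgh : {within `[0%R, 1%R], continuous (fun e =>
   rcube (fun v => g (insert_coord ord0 e v)) -
   rcube (fun v => h (insert_coord ord0 e v)))}.
  by move=> e; apply: cvgB; [exact: Cg|exact: Ch].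
rewrite -RintegralB //; try exact: cc_integrable.
apply: le_trans (le_normr_Rintegral _ _) _ => //; first exact: cc_integrable.
rewrite -[leRHS]Rintegral01_cst; apply: le_Rintegral => //.
- by apply: cc_integrable => e; apply: cvg_norm; exact: Cgh.
- by apply: cc_integrable => e; exact: cvg_cst.
- move=> e; rewrite itv01P => he; apply: IH; try exact: insert_coord_slice.
  by move=> v hv; apply: H; exact: insert_coord_cube.
Qed.

Lemma rcube_slice_continuous d (f : 'rV[R]_d.+1 -> R) (i : 'I_d.+1) :
  {within (@unit_cube R d.+1), continuous f} ->
  {within `[0%R, 1%R], continuous (fun e => rcube (fun v => f (insert_coord i e v)))}.
Proof. by apply: rcube_slice_continuous_of; exact: rcube_lip. Qed.

Lemma rcubeD d (f g : 'rV[R]_d -> R) :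
  {within (@unit_cube R d), continuous f} ->
  {within (@unit_cube R d), continuous g} ->
  rcube (fun v => f v + g v) = rcube f + rcube g.
Proof.
elim: d f g => [|d IH] f g cf cg //=.
rewrite -RintegralD //; try exact/cc_integrable/rcube_slice_continuous.
apply: eq_Rintegral => e; rewrite inE itv01P => he.
by apply: IH; exact: insert_coord_slice.
Qed.

Lemma rcubeZ d (c : R) (f : 'rV[R]_d -> R) :
  {within (@unit_cube R d), continuous f} ->
  rcube (fun v => c * f v) = c * rcube f.
Proof.
elim: d f => [|d IH] f cf //=.
rewrite -RintegralZl //; try exact/cc_integrable/rcube_slice_continuous.
apply: eq_Rintegral => e; rewrite inE itv01P => he.
by apply: IH; exact: insert_coord_slice.
Qed.

Lemma rcubeB d (f g : 'rV[R]_d -> R) :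
  {within (@unit_cube R d), continuous f} ->
  {within (@unit_cube R d), continuous g} ->
  rcube (fun v => f v - g v) = rcube f - rcube g.
Proof.
move=> cf cg; rewrite -mulN1r -rcubeZ // -rcubeD //.
  by apply: eq_rcube => v _; rewrite mulN1r.
by move=> v; apply: cvgZr; exact: cg.
Qed.

End CubeIntegral.


(** * The fundamental theorem of calculus on a cube, along any coordinate *)

Section RealFTC.
Variables (R : realType).
Local Notation mu := (@lebesgue_measure R).

Lemma is_derive_cvgP (K : numFieldType) (V : normedModType K) (f : V -> K) x v d :
  is_derive x v f d <-> (fun h : K => (f (x + h *: v) - f x) / h) @ 0^' --> d.
Proof.
have -> : (fun h : K => (f (x + h *: v) - f x) / h) =
          (fun h => h^-1 *: ((f \o shift x) (h *: v) - f x)).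
  by apply/funext => h; rewrite [x + _]addrC mulrC.
split=> [[df <-]|h]; first exact: df.
by apply: DeriveDef; [exact: (cvgP d)|apply: cvg_lim h; exact: norm_hausdorff].
Qed.

(** Difference quotients involve increments of both signs; the bound on the distance from c to x is
    what allows a uniform estimate to be applied at c. *)
Lemma MVT_two_sided (f f' : R -> R) (x y : R) :
  x != y -> (forall c, Num.min x y <= c <= Num.max x y -> is_derive c 1 f (f' c)) ->
  exists c, [/\ Num.min x y <= c <= Num.max x y, `|c - x| <= `|y - x|
    & f y - f x = f' c * (y - x)].
Proof.
suff wlog_lt (u v : R) : u < v -> (forall c, u <= c <= v -> is_derive c 1 f (f' c)) ->
    exists2 c, u <= c <= v & f v - f u = f' c * (v - u).
  move=> neq hd; move: neq; rewrite neq_lt => /orP[] xy.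
    move: hd; rewrite min_l ?max_r ?ltW // => /(wlog_lt _ _ xy) [c hc e].
    exists c; split=> //; case/andP: hc => ? ?.
    by rewrite !ger0_norm ?subr_ge0 ?(ltW xy) //; lra.
  move: hd; rewrite min_r ?max_l ?ltW // => /(wlog_lt _ _ xy) [c hc e].
  exists c; split=> //; first by case/andP: hc => ? ?;
    rewrite !ler0_norm ?subr_le0 ?(ltW xy) //; lra.
  by rewrite -opprB e -mulrN opprB.
move=> uv hd.
have [||c cuv e] := @MVT R f f' u v uv.
- by move=> c; rewrite in_itv => /andP[? ?]; apply: hd; rewrite !ltW.
- apply: (@derivable_within_continuous _ _ f `[u, v]) => c; rewrite in_itv/= => hc.
  by have [] := hd _ hc.
- by exists c => //; move: cuv; rewrite in_itv => /andP[? ?]; rewrite !ltW.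
Qed.

Lemma insert_coord_swap d (a : 'I_d.+1) (e r : R) (w : 'rV[R]_d) :
  insert_coord ord0 e (insert_coord a r w) =
  insert_coord (lift ord0 a) r (insert_coord ord0 e w).
Proof.
apply/rowP => j; have [j' ->|->] := unliftP ord0 j; last first.
  rewrite insert_coordE.
  have -> : ord0 = lift (lift ord0 a) ord0 by apply: val_inj.
  by rewrite insert_coord_lift insert_coordE.
rewrite insert_coord_lift; have [k ->|->] := unliftP a j'; last first.
  by rewrite !insert_coordE.
rewrite insert_coord_lift.
have -> : lift ord0 (lift a k) = lift (lift ord0 a) (lift ord0 k).
  by apply: val_inj; rewrite /= /bump /=; lia.
by rewrite !insert_coord_lift.
Qed.

(** By the mean value theorem each difference quotient is a value of [h'] on a nearby slice, and
    [near_slice] makes these values uniformly close to those at e; the sup-norm bound concludes. *)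
Lemma rcube_slice_derive d (a : 'I_d.+1) (h h' : 'rV[R]_d.+1 -> R) (e : R) :
  {within (@unit_cube R d.+1), continuous h} ->
  {within (@unit_cube R d.+1), continuous h'} ->
  (forall (e : R) v, 0 < e < 1 -> unit_cube v ->
     is_derive e 1 (fun r => h (insert_coord a r v)) (h' (insert_coord a e v))) ->
  0 < e < 1 ->
  is_derive e 1 (fun r => rcube (fun v => h (insert_coord a r v)))
    (rcube (fun v => h' (insert_coord a e v))).
Proof.
move=> ch ch' dh he; apply/is_derive_cvgP.
have he01 : 0 <= e <= 1 by case/andP: he => *; rewrite !ltW.
apply/cvgrPdist_le => eps eps0.
have h1 : \forall c \near e, 0 < c < 1 /\ forall v, unit_cube v ->
    `|h' (insert_coord a e v) - h' (insert_coord a c v)| <= eps.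
  have hI : \forall c \near e, c \in `]0, 1[%R by apply: near_in_itvoo; rewrite in_itv.
  have := near_slice a ch' he01 eps0; rewrite /within/=.
  move: hI; apply: filterS2 => c; rewrite !in_itv/= => hc h2; split=> //.
  by apply: h2; case/andP: hc => *; rewrite !ltW.
have [del del0 hdel] := (nbhs_ballP _ _).1 h1.
have : \forall r \near (0 : R)^', `|r| < del.
  apply: dnbhs0_lt => //.
apply: filter_app; near=> r => hr.
have r0 : r != 0 by near: r; exact: nbhs_dnbhs_neq.
have hcv v c : unit_cube v -> `|c - e| <= `|r| -> 0 < c < 1 /\
    `|h' (insert_coord a e v) - h' (insert_coord a c v)| <= eps.
  move=> hv hc; have [] := hdel c; last by move=> ? /(_ v hv).
  by rewrite /= /ball/= distrC; exact: le_lt_trans hr.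
have her : 0 < e + r < 1.
  have cube0 : unit_cube (0 : 'rV[R]_d) by move=> i; rewrite mxE lexx ler01.
  by have [|//] := hcv 0 (e + r) cube0; rewrite addrAC subrr add0r.
have her01 : 0 <= e + r <= 1 by case/andP: her => *; rewrite !ltW.
have s1 := insert_coord_slice (i := a) ch her01; have s2 := insert_coord_slice (i := a) ch he01.
rewrite [r *: 1]mulr1 -rcubeB // [_ / r]mulrC -rcubeZ; last first.
  by move=> v; apply: cvgB; [exact: s1|exact: s2].
apply: rcube_lip.
- exact: insert_coord_slice.
- move=> v; apply: cvgZr; apply: cvgB; [exact: s1|exact: s2].
move=> v hv.
have [||c [_ hc ->]] := @MVT_two_sided (fun r => h (insert_coord a r v))
   (fun r => h' (insert_coord a r v)) e (e + r).
- by rewrite -subr_eq0 opprD addNKr oppr_eq0.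
- move=> c hc; apply: dh => //.
  by move: hc her he; rewrite ge_min le_max => /andP[/orP[] ? /orP[] ?] /andP[? ?] /andP[? ?];
    apply/andP; split; lra.
have -> : e + r - e = r by rewrite addrAC subrr add0r.
rewrite mulrC mulfK //; apply: (hcv _ _ hv _).2.
by move: hc; rewrite [e + r]addrC addrK.
Unshelve. all: by end_near. Qed.

Lemma rcube_FTC0 d (h h' : 'rV[R]_d.+1 -> R) :
  {within (@unit_cube R d.+1), continuous h} ->
  {within (@unit_cube R d.+1), continuous h'} ->
  (forall (e : R) v, 0 < e < 1 -> unit_cube v ->
     is_derive e 1 (fun r => h (insert_coord ord0 r v)) (h' (insert_coord ord0 e v))) ->
  rcube h' = rcube (fun v => h (insert_coord ord0 1 v))
             - rcube (fun v => h (insert_coord ord0 0 v)).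
Proof.
move=> ch ch' dh.
pose g r := rcube (fun v => h (insert_coord ord0 r v)).
pose g' r := rcube (fun v => h' (insert_coord ord0 r v)).
have dg (r : R) : r \in `]0, 1[%R -> is_derive r 1 g (g' r).
  by rewrite in_itv => hr; exact: rcube_slice_derive.
have cg : {within `[0%R, 1%R], continuous g} by exact: rcube_slice_continuous.
have cg' : {within `[0%R, 1%R], continuous g'} by exact: rcube_slice_continuous.
have [_ g0 g1] := (continuous_within_itvP g ltr01).1 cg.
have F2 := @continuous_FTC2 R g' g 0 1 ltr01 cg'.
rewrite /= /Rintegral F2 //; last first.
  by move=> r hr; rewrite derive1E; have [] := dg r hr.
by split=> // r hr; have [] := dg r hr.
Qed.

(** No exchange of integrals is needed. If a is not the outermost coordinate, the formula for the
    slices, one dimension lower, is integrated over the outermost coordinate; [insert_coord_swap]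
    matches the two orders of insertion. *)
Lemma rcube_FTC d (a : 'I_d.+1) (h h' : 'rV[R]_d.+1 -> R) :
  {within (@unit_cube R d.+1), continuous h} ->
  {within (@unit_cube R d.+1), continuous h'} ->
  (forall (e : R) v, 0 < e < 1 -> unit_cube v ->
     is_derive e 1 (fun r => h (insert_coord a r v)) (h' (insert_coord a e v))) ->
  rcube h' = rcube (fun v => h (insert_coord a 1 v))
             - rcube (fun v => h (insert_coord a 0 v)).
Proof.
elim: d a h h' => [|d IH] a h h' ch ch' dh.
  by move: dh; rewrite (ord1 a) => dh; exact: rcube_FTC0.
have [a' Ea|Ea] := unliftP ord0 a; last first.
  by move: dh; rewrite Ea => dh; exact: rcube_FTC0.
have h01 : 0 <= (0:R) <= 1 by rewrite lexx ler01.
have h11 : 0 <= (1:R) <= 1 by rewrite lexx ler01.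
have s0 := insert_coord_slice (i := a) ch h01; have s1 := insert_coord_slice (i := a) ch h11.
transitivity (\int[mu]_(e in `[0%R, 1%R])
  (rcube (fun v => h (insert_coord a 1 (insert_coord ord0 e v))) -
   rcube (fun v => h (insert_coord a 0 (insert_coord ord0 e v))))); last first.
  by rewrite RintegralB //; apply: cc_integrable;
    [exact: (rcube_slice_continuous (i := ord0) s1)|exact: (rcube_slice_continuous (i := ord0) s0)].
apply: eq_Rintegral => e; rewrite inE itv01P => he.
apply: etrans (IH a' (fun v => h (insert_coord ord0 e v))
  (fun v => h' (insert_coord ord0 e v)) _ _ _) _.
- exact: insert_coord_slice.
- exact: insert_coord_slice.
- move=> r v hr hv; rewrite insert_coord_swap.
  under eq_fun do rewrite insert_coord_swap.
  by rewrite -Ea; apply: dh => //; exact: insert_coord_cube.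
- by rewrite Ea; congr (_ - _); apply: eq_rcube => v _; rewrite insert_coord_swap.
Qed.

End RealFTC.


Section BigLimits.
Variables (K : numFieldType) (T : Type) (F : set_system T).
Context {FF : Filter F}.
Variables (I : Type) (s : seq I) (P : pred I) (f : I -> T -> K) (l : I -> K).
Hypothesis fl : forall i, P i -> f i @ F --> l i.

Lemma cvg_bigsum :
  (fun w => \sum_(i <- s | P i) f i w) @ F --> \sum_(i <- s | P i) l i.
Proof.
elim: s => [|i r IH].
  by under eq_fun do rewrite big_nil; rewrite big_nil; exact: cvg_cst.
under eq_fun do rewrite big_cons; rewrite big_cons.
by case: ifPn => // Pi; apply: cvgD IH; exact: fl.
Qed.

Lemma cvg_bigprod :
  (fun w => \prod_(i <- s | P i) f i w) @ F --> \prod_(i <- s | P i) l i.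
Proof.
elim: s => [|i r IH].
  by under eq_fun do rewrite big_nil; rewrite big_nil; exact: cvg_cst.
under eq_fun do rewrite big_cons; rewrite big_cons.
by case: ifPn => // Pi; apply: cvgM IH; exact: fl.
Qed.

End BigLimits.

(** * Complex limits through real and imaginary parts *)

Section ComplexTopology.
Variables (R : realType).
Implicit Types (z l : CC R) (r : R).

Definition toC (r : R) : CC R := (r%:C)%C.

Lemma toCD r r' : toC (r + r') = toC r + toC r'.
Proof. by rewrite /toC rmorphD. Qed.
Lemma toC_eq0 r : (toC r == 0) = (r == 0).
Proof. by rewrite /toC; rewrite eq_complex /= eqxx andbT. Qed.

Lemma ReD z l : complex.Re (z + l) = complex.Re z + complex.Re l.
Proof. by case: z => a b; case: l. Qed.
Lemma ImD z l : complex.Im (z + l) = complex.Im z + complex.Im l.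
Proof. by case: z => a b; case: l. Qed.
Lemma ReB z l : complex.Re (z - l) = complex.Re z - complex.Re l.
Proof. by case: z => a b; case: l. Qed.
Lemma ImB z l : complex.Im (z - l) = complex.Im z - complex.Im l.
Proof. by case: z => a b; case: l. Qed.
Lemma ReM z l :
  complex.Re (z * l) = complex.Re z * complex.Re l - complex.Im z * complex.Im l.
Proof. by case: z => a b; case: l. Qed.
Lemma ImM z l :
  complex.Im (z * l) = complex.Re z * complex.Im l + complex.Im z * complex.Re l.
Proof. by case: z => a b; case: l => c d /=; rewrite [b * c]mulrC. Qed.
Lemma complexP z l :
  complex.Re z = complex.Re l -> complex.Im z = complex.Im l -> z = l.
Proof. by case: z => a b; case: l => c d /= -> ->. Qed.

Lemma ReIm_toC z : z = toC (complex.Re z) + ('i)%C * toC (complex.Im z).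
Proof. by apply: complexP; rewrite ?(ReD, ReM, ImD, ImM) /=; ring. Qed.

Lemma norm_toC r : `|toC r| = toC `|r|.
Proof. by rewrite normc_def /= expr0n addr0 sqrtr_sqr. Qed.

Lemma norm_i : `|('i)%C : CC R| = 1.
Proof. by rewrite normc_def /= expr0n add0r expr1n sqrtr1. Qed.

Lemma norm_le_ReIm z : `|z| <= toC (`|complex.Re z| + `|complex.Im z|).
Proof.
rewrite {1}(ReIm_toC z) (le_trans (ler_normD _ _)) // normrM norm_i mul1r.
by rewrite !norm_toC toCD.
Qed.

Lemma Re_le_norm z : toC `|complex.Re z| <= `|z|.
Proof. exact: normc_ge_Re. Qed.

Lemma Im_le_norm z : toC `|complex.Im z| <= `|z|.
Proof.
have := Re_le_norm (z * ('i)%C); rewrite normrM norm_i mulr1.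
by rewrite ReM /= mulr0 mulr1 sub0r normrN.
Qed.

Lemma toC_lt r r' : (toC r < toC r') = (r < r').
Proof. exact: ltcR. Qed.
Lemma toC_le r r' : (toC r <= toC r') = (r <= r').
Proof. exact: lecR. Qed.

Lemma pos_toC (e : CC R) : 0 < e -> e = toC (complex.Re e) /\ 0 < complex.Re e.
Proof.
by rewrite ltcE /= => /andP[/eqP h1 h2]; split=> //; apply: complexP.
Qed.

(** The norm of [CC R] takes its values in [CC R], where a positive element is real ([pos_toC]);
    then |Re z|, |Im z| <= |z| <= |Re z| + |Im z|. *)
Lemma cvgCP (T : Type) (F : set_system T) {FF : Filter F} (f : T -> CC R) l :
  f @ F --> l <-> (fun w => complex.Re (f w)) @ F --> complex.Re l /\
                  (fun w => complex.Im (f w)) @ F --> complex.Im l.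
Proof.
split=> [/cvgrPdist_lt h|[/cvgrPdist_lt h1 /cvgrPdist_lt h2]].
  have hC (e : R) : 0 < e -> \forall w \near F, `|l - f w| < toC e.
    by move=> e0; apply: h; rewrite (_ : 0 = toC 0) // toC_lt.
  by split; apply/cvgrPdist_lt => e /hC; apply: filterS => w;
    [rewrite -ReB|rewrite -ImB] => hw; rewrite -toC_lt;
    [exact: le_lt_trans (Re_le_norm _) hw|exact: le_lt_trans (Im_le_norm _) hw].
apply/cvgrPdist_lt => e /pos_toC [-> e0].
have e20 : 0 < complex.Re e / 2 by rewrite divr_gt0.
move: (h1 _ e20) (h2 _ e20); apply: filterS2 => w; rewrite -ReB -ImB => k1 k2.
by apply: le_lt_trans (norm_le_ReIm _) _; rewrite toC_lt [ltRHS]splitr ltrD.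
Qed.

Lemma toC_cvg (T : Type) (F : set_system T) {FF : Filter F} (f : T -> R) r :
  f @ F --> r -> (fun w => toC (f w)) @ F --> toC r.
Proof. by move=> h; apply/cvgCP; split=> //; exact: cvg_cst. Qed.

Lemma within_continuousCP (S : topologicalType) (A : set S) (f : S -> CC R) :
  {within A, continuous f} <->
  {within A, continuous (fun w => complex.Re (f w))} /\
  {within A, continuous (fun w => complex.Im (f w))}.
Proof.
split=> [/within_continuousP h|[/within_continuousP h1 /within_continuousP h2]].
  by split; apply/within_continuousP => x /h /cvgCP [].
by apply/within_continuousP => x Ax; apply/cvgCP; split; [exact: h1|exact: h2].
Qed.

End ComplexTopology.

(** * Complex-valued integrals over the cube *)

Section ComplexCubeIntegral.
Variables (R : realType).
Local Notation ccube f := {within (@unit_cube R _), continuous f}.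

Lemma Re_cube_int d (f : 'rV[R]_d -> CC R) :
  complex.Re (cube_int f) = rcube (fun v => complex.Re (f v)).
Proof. by rewrite cube_int_rcube. Qed.

Lemma Im_cube_int d (f : 'rV[R]_d -> CC R) :
  complex.Im (cube_int f) = rcube (fun v => complex.Im (f v)).
Proof. by rewrite cube_int_rcube. Qed.

Lemma eq_cube_int d (f g : 'rV[R]_d -> CC R) :
  (forall v, unit_cube v -> f v = g v) -> cube_int f = cube_int g.
Proof.
by move=> h; rewrite !cube_int_rcube; congr (_ +i* _)%C; apply: eq_rcube => v /h ->.
Qed.

Lemma cube_intD d (f g : 'rV[R]_d -> CC R) : ccube f -> ccube g ->
  cube_int (fun v => f v + g v) = cube_int f + cube_int g.
Proof.
move=> /within_continuousCP [f1 f2] /within_continuousCP [g1 g2].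
by apply: complexP; rewrite ?(ReD, ImD) ?(Re_cube_int, Im_cube_int) -rcubeD //;
  apply: eq_rcube => v _; rewrite ?(ReD, ImD).
Qed.

Lemma within_cvgZ (S : topologicalType) (A : set S) (c : CC R) (f : S -> CC R) :
  {within A, continuous f} -> {within A, continuous (fun w => c * f w)}.
Proof. by move=> h x; apply: cvgZr; exact: h. Qed.

Lemma cube_intZ d c (f : 'rV[R]_d -> CC R) : ccube f ->
  cube_int (fun v => c * f v) = c * cube_int f.
Proof.
move=> /within_continuousCP [f1 f2].
have cZ (r : R) (g : 'rV[R]_d -> R) : ccube g -> ccube (fun v => r * g v).
  by move=> cg v; apply: cvgZr; exact: cg.
apply: complexP; rewrite ?(ReM, ImM) !(Re_cube_int, Im_cube_int).
  rewrite -!rcubeZ // -rcubeB //; try exact: cZ.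
  by apply: eq_rcube => v _; rewrite ReM.
rewrite -!rcubeZ // -rcubeD //; try exact: cZ.
by apply: eq_rcube => v _; rewrite ImM.
Qed.

Lemma cube_intB d (f g : 'rV[R]_d -> CC R) : ccube f -> ccube g ->
  cube_int (fun v => f v - g v) = cube_int f - cube_int g.
Proof.
move=> cf cg; transitivity (cube_int (fun v => f v + (-1) * g v)).
  by apply: eq_cube_int => v _; rewrite mulN1r.
rewrite cube_intD; [|exact: cf|exact: within_cvgZ].
by rewrite cube_intZ ?mulN1r.
Qed.

Lemma cube_int0 d : cube_int (fun _ : 'rV[R]_d => 0 : CC R) = 0.
Proof.
have c0 : ccube (fun _ : 'rV[R]_d => 0 : CC R) by move=> v; exact: cvg_cst.
rewrite -[RHS](mul0r (cube_int (fun _ : 'rV[R]_d => 0))) -(cube_intZ _ c0).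
by apply: eq_cube_int => v _; rewrite mulr0.
Qed.

Lemma within_sum (S : topologicalType) (A : set S) (I : Type) (s : seq I)
    (P : pred I) (f : I -> S -> CC R) :
  (forall i, P i -> {within A, continuous (f i)}) ->
  {within A, continuous (fun w => \sum_(i <- s | P i) f i w)}.
Proof.
move=> h x; apply: cvg_bigsum => i Pi; exact: h.
Qed.

Lemma cube_int_sum d (I : Type) (s : seq I) (P : pred I) (f : I -> 'rV[R]_d -> CC R) :
  (forall i, P i -> ccube (f i)) ->
  cube_int (fun v => \sum_(i <- s | P i) f i v) = \sum_(i <- s | P i) cube_int (f i).
Proof.
move=> h; elim: s => [|i s IH].
  by rewrite big_nil -[RHS](cube_int0 d); apply: eq_cube_int => v _; rewrite big_nil.
rewrite big_cons -IH; case: ifPn => Pi; last first.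
  by apply: eq_cube_int => v _; rewrite big_cons (negPf Pi).
rewrite -cube_intD; [|exact: h|exact: within_sum].
by apply: eq_cube_int => v _; rewrite big_cons Pi.
Qed.

Lemma Re_div_toC (z : CC R) (p : R) : complex.Re (z / toC p) = complex.Re z / p.
Proof.
have [->|p0] := eqVneq p 0; first by rewrite invr0 /toC invr0 !mulr0.
by rewrite /toC -fmorphV ReM /= mulr0 subr0.
Qed.

Lemma Im_div_toC (z : CC R) (p : R) : complex.Im (z / toC p) = complex.Im z / p.
Proof.
have [->|p0] := eqVneq p 0; first by rewrite invr0 /toC invr0 !mulr0.
by rewrite /toC -fmorphV ImM /= mulr0 add0r.
Qed.

(* The derivative of a complex function of a real variable is taken as a limit of
   difference quotients with complex denominators. *)
Lemma ReIm_is_derive (f : R -> CC R) (r : R) (d : CC R) :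
  (fun p : R => (f (r + p) - f r) / toC p) @ 0^' --> d ->
  is_derive r 1 (fun p => complex.Re (f p)) (complex.Re d) /\
  is_derive r 1 (fun p => complex.Im (f p)) (complex.Im d).
Proof.
move=> /cvgCP [+ +]; under eq_fun do rewrite Re_div_toC ReB.
move=> h1; under eq_fun do rewrite Im_div_toC ImB.
move=> h2; split; apply/is_derive_cvgP.
  by under eq_fun do rewrite [_ *: 1]mulr1.
by under eq_fun do rewrite [_ *: 1]mulr1.
Qed.

Lemma cube_int_FTC d (a : 'I_d.+1) (h h' : 'rV[R]_d.+1 -> CC R) :
  ccube h -> ccube h' ->
  (forall (e : R) v, 0 < e < 1 -> unit_cube v ->
     (fun r : R => (h (insert_coord a (e + r) v) - h (insert_coord a e v)) / toC r)
       @ 0^' --> h' (insert_coord a e v)) ->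
  cube_int h' = cube_int (fun v => h (insert_coord a 1 v))
                - cube_int (fun v => h (insert_coord a 0 v)).
Proof.
move=> /within_continuousCP [h1 h2] /within_continuousCP [k1 k2] dh.
apply: complexP; rewrite ?(ReB, ImB) !(Re_cube_int, Im_cube_int).
  by apply: (rcube_FTC (a := a) h1 k1) => e v he hv;
    have [] := ReIm_is_derive (f := fun r => h (insert_coord a r v)) (dh e v he hv).
by apply: (rcube_FTC (a := a) h2 k2) => e v he hv;
  have [] := ReIm_is_derive (f := fun r => h (insert_coord a r v)) (dh e v he hv).
Qed.

End ComplexCubeIntegral.


(** * The complex exponential and its derivative at 0 *)

Section ComplexExponential.
Variables (R : realType).
Implicit Types (z : CC R).

Lemma CexpD z (w : CC R) : Cexp (z + w) = Cexp z * Cexp w.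
Proof.
apply: complexP; rewrite ?(ReM, ImM) /= ReD ImD expRD ?cosD ?sinD; ring.
Qed.

Lemma Cexp0 : Cexp (0 : CC R) = 1.
Proof. by apply: complexP => /=; rewrite expR0 ?cos0 ?sin0 ?mulr0 ?mulr1. Qed.

Lemma Cexp_neq0 z : Cexp z != 0.
Proof.
apply/eqP => h; have := Cexp0; rewrite -(subrr z) CexpD h mul0r => /eqP.
by rewrite eq_sym oner_eq0.
Qed.

Lemma Cexp_sum (I : Type) (s : seq I) (P : pred I) (f : I -> CC R) :
  Cexp (\sum_(i <- s | P i) f i) = \prod_(i <- s | P i) Cexp (f i).
Proof. by elim/big_rec2: _ => [|i x y _ <-]; [exact: Cexp0|exact: CexpD]. Qed.

Lemma Cexp_cvg (T : Type) (F : set_system T) {FF : Filter F} (f : T -> CC R) (l : CC R) :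
  f @ F --> l -> (fun w => Cexp (f w)) @ F --> Cexp l.
Proof.
move=> /cvgCP [h1 h2]; apply/cvgCP; split=> /=; apply: cvgM.
- exact: (cvg_comp _ _ h1 (@continuous_expR R _)).
- exact: (cvg_comp _ _ h2 (@continuous_cos R _)).
- exact: (cvg_comp _ _ h1 (@continuous_expR R _)).
- exact: (cvg_comp _ _ h2 (@continuous_sin R _)).
Qed.

Lemma derive0_approx (f : R -> R) (d eps : R) : is_derive (0 : R) 1 f d -> 0 < eps ->
  \forall h \near (0 : R), `|f h - f 0 - d * h| <= eps * `|h|.
Proof.
move=> /is_derive_cvgP /cvgrPdist_le hd eps0.
have hd' : \forall h \near (0 : R), h != 0 ->
  `|d - (f (0 + h *: 1) - f 0) / h| <= eps := hd eps eps0.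
move: hd'; apply: filterS => h; have [->|h0] := eqVneq h 0.
  by rewrite subrr mulr0 subr0 normr0 mulr0.
move=> /(_ isT); rewrite [h *: 1]mulr1 add0r => hq.
have -> : f h - f 0 - d * h = - (d - (f h - f 0) / h) * h.
  by rewrite opprB mulrBl divfK.
by rewrite normrM normrN ler_wpM2r.
Qed.

Lemma Cexp_approx (eps : R) : 0 < eps ->
  \forall w \near (0 : CC R), `|Cexp w - 1 - w| <= toC eps * `|w|.
Proof.
(* The errors below add up to at most 10 e |w|, which eps / 20 covers with room to spare. The cap at
   1 gives |Re w| <= 1 and |sin (Im w)| <= 2 |Im w|. *)
move=> eps0; pose e := Num.min (eps / 20) 1.
have e0 : 0 < e by rewrite lt_min ltr01 divr_gt0.
have e1 : e <= 1 by rewrite ge_min lexx orbT.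
have [hr hi] := (cvgCP _ _).1 (@cvg_id _ (nbhs (0 : CC R))).
have d1 := derive0_approx (@is_derive_expR R 0) e0.
have d2 := derive0_approx (@is_derive_sin R 0) e0.
have d3 := derive0_approx (@is_derive_cos R 0) e0.
have d4 : \forall h \near (0 : R), `|h| <= e.
  by have := @nbhs0_le R R e e0.
have k1 := hr _ d1; have k2 := hi _ d2; have k3 := hi _ d3.
have k4 := hr _ d4; have k5 := hi _ d4.
near=> w.
have a1 : `|expR (complex.Re w) - expR 0 - expR 0 * complex.Re w| <= e * `|complex.Re w|.
  by near: w; exact: k1.
have a2 : `|sin (complex.Im w) - sin 0 - cos 0 * complex.Im w| <= e * `|complex.Im w|.
  by near: w; exact: k2.
have a3 : `|cos (complex.Im w) - cos 0 - (- sin 0) * complex.Im w| <= e * `|complex.Im w|.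
  by near: w; exact: k3.
have a4 : `|complex.Re w| <= e by near: w; exact: k4.
have a5 : `|complex.Im w| <= e by near: w; exact: k5.
have n1 := Re_le_norm w; have n2 := Im_le_norm w.
apply: le_trans (norm_le_ReIm _) _.
rewrite normc_def in n1 n2 *; rewrite -/(toC _) !toC_le in n1 n2 *.
rewrite /toC -rmorphM -/(toC _) toC_le.
move: n1 n2; set N := Num.sqrt _; move: N => N n1 n2.
rewrite !(ReB, ImB) /=; move: a1 a2 a3 a4 a5 n1 n2.
rewrite expR0 sin0 cos0; set a := complex.Re w; set b := complex.Im w.
set x := expR a; set c := cos b; set s := sin b.
rewrite !subr0 !mul1r oppr0 mul0r subr0 => a1 a2 a3 a4 a5 n1 n2.
have c1 : `|c| <= 1 by rewrite ler_norml; apply/andP; split; [exact: cos_geN1|exact: cos_le1].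
have pa := normr_ge0 a; have pb := normr_ge0 b.
have -> : x * c - 1 - a = (x - 1 - a) * c + (1 + a) * (c - 1) by ring.
have -> : x * s - b = (x - 1 - a) * s + a * s + (s - b) by ring.
have s1 : `|s| <= 2 * `|b|.
  have -> : s = (s - b) + b by rewrite subrK.
  by apply: le_trans (ler_normD _ _) _; have := ler_wpM2r pb e1; lra.
have t1 : `|(x - 1 - a) * c| <= e * `|a|.
  by rewrite normrM; have := normr_ge0 (x - 1 - a); have := normr_ge0 c; nra.
have t2 : `|(1 + a) * (c - 1)| <= 2 * (e * `|b|).
  rewrite normrM; apply: ler_pM => //.
  by apply: le_trans (ler_normD _ _) _; rewrite normr1; lra.
have t3 : `|(x - 1 - a) * s| <= e * (2 * `|b|).
  rewrite normrM; apply: ler_pM => //.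
  apply: le_trans a1 _; rewrite -[leRHS]mulr1 ler_wpM2l ?(ltW e0) //.
  exact: le_trans a4 e1.
have t4 : `|a * s| <= e * (2 * `|b|) by rewrite normrM; apply: ler_pM.
apply: (@le_trans _ _ (10 * e * N)).
  apply: le_trans (lerD (ler_normD _ _) (ler_normD _ _)) _.
  have := ler_normD ((x - 1 - a) * s) (a * s).
  have : 0 <= e * (N - `|a|) by rewrite mulr_ge0 ?subr_ge0 // ltW.
  have : 0 <= e * (N - `|b|) by rewrite mulr_ge0 ?subr_ge0 // ltW.
  have : 0 <= e * `|a| by rewrite mulr_ge0 // ltW.
  have : 0 <= e * `|b| by rewrite mulr_ge0 // ltW.
  lra.
rewrite ler_wpM2r ?(le_trans pa) //.
have : e <= eps / 20 by rewrite ge_min lexx.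
by lra.
Unshelve. all: by end_near. Qed.

(** The value 1 at 0 makes [expqE] true for every w and the function continuous at 0, so that
    compositions need no separate case for a vanishing inner increment. *)
Definition expq (w : CC R) : CC R := if w == 0 then 1 else (Cexp w - 1) / w.

Lemma expqE (w : CC R) : Cexp w - 1 = w * expq w.
Proof.
rewrite /expq; have [->|w0] := eqVneq w 0; first by rewrite Cexp0 subrr mul0r.
by rewrite mulrC divfK.
Qed.

Lemma expq_cvg (T : Type) (F : set_system T) {FF : Filter F} (f : T -> CC R) :
  f @ F --> (0 : CC R) -> (fun w => expq (f w)) @ F --> (1 : CC R).
Proof.
move=> f0; apply: (cvg_comp f expq f0).
apply/cvgrPdist_le => eps /pos_toC [-> e0].
have := Cexp_approx e0; apply: filterS => w; rewrite /expq.
have [_|w0] := eqVneq w 0.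
  by move=> _; rewrite subrr normr0 -[0]/(toC 0) toC_le ltW.
move=> h; rewrite distrC.
have -> : (Cexp w - 1) / w - 1 = (Cexp w - 1 - w) / w by rewrite [RHS]mulrBl divff.
by rewrite normrM normfV ler_pdivrMr ?normr_gt0.
Qed.

End ComplexExponential.



(** * Difference quotients along a filter, for complex and for real increments *)

Lemma eq_near_cvg (T : Type) (F : set_system T) {FF : Filter F} (S : topologicalType)
    (f g : T -> S) (l : S) :
  (\forall w \near F, f w = g w) -> f @ F --> l -> g @ F --> l.
Proof. by move=> fg; apply: cvg_trans; apply: near_eq_cvg; apply: filterS fg. Qed.

Section DifferenceQuotients.
Variables (R : realType) (T : Type) (F : set_system T).
Context {FF : Filter F}.
Variable eta : T -> CC R.
Hypothesis eta0 : eta @ F --> (0 : CC R).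
Hypothesis eta_neq0 : \forall w \near F, eta w != 0.
Implicit Types (f g l : T -> CC R) (a b d : CC R).

(* [f] has value [a] and derivative [d] at the limit point, [eta] being the
   increment of the variable along the filter: this covers both complex
   derivatives and derivatives of complex functions of a real variable. *)
Definition der f a d := (fun w => (f w - a) / eta w) @ F --> d.

Lemma der_ext f g a d : (\forall w \near F, f w = g w) -> der f a d -> der g a d.
Proof.
by move=> fg; apply: eq_near_cvg; move: fg; apply: filterS => w ->.
Qed.

Lemma der_eq f a d a' d' : der f a d -> a = a' -> d = d' -> der f a' d'.
Proof. by move=> h <- <-. Qed.

Lemma der_cvg f a d : der f a d -> f @ F --> a.
Proof.
move=> h; have : (fun w => a + (f w - a) / eta w * eta w) @ F --> a + d * 0.
  by apply: cvgD; [exact: cvg_cst|exact: (cvgM h eta0)].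
rewrite mulr0 addr0; apply: eq_near_cvg; move: eta_neq0; apply: filterS => w w0.
by rewrite divfK // subrKC.
Qed.

Lemma der_cst a : der (fun=> a) a 0.
Proof.
rewrite /der; under eq_fun do rewrite subrr mul0r; exact: cvg_cst.
Qed.

Lemma derD f g a b d d' : der f a d -> der g b d' ->
  der (fun w => f w + g w) (a + b) (d + d').
Proof.
move=> h h'; apply: eq_near_cvg (cvgD h h').
by near=> w; rewrite /= -mulrDl opprD addrACA.
Unshelve. all: by end_near. Qed.

Lemma derM f g a b d d' : der f a d -> der g b d' ->
  der (fun w => f w * g w) (a * b) (d * b + a * d').
Proof.
move=> h h'.
have : (fun w => (f w - a) / eta w * g w + a * ((g w - b) / eta w)) @ F
    --> d * b + a * d'.
  exact: (cvgD (cvgM h (der_cvg h')) (cvgM (cvg_cst a) h')).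
apply: eq_near_cvg; move: eta_neq0; apply: filterS => w w0.
by field.
Qed.

Lemma derZ c f a d : der f a d -> der (fun w => c * f w) (c * a) (c * d).
Proof. by move=> h; have := derM (der_cst c) h; rewrite mul0r add0r. Qed.

Lemma derB f g a b d d' : der f a d -> der g b d' ->
  der (fun w => f w - g w) (a - b) (d - d').
Proof.
move=> h /(derZ (c := -1)); rewrite !mulN1r => h'; have := derD h h'.
by apply: der_ext; near=> w; rewrite mulN1r.
Unshelve. all: by end_near. Qed.

Lemma derV f a d : a != 0 -> der f a d ->
  der (fun w => (f w)^-1) a^-1 (- d / a ^+ 2).
Proof.
move=> n0 h; have fc := der_cvg h.
have : (fun w => - ((f w - a) / eta w) * ((f w)^-1 * a^-1)) @ F
    --> - d * (a^-1 * a^-1).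
  exact: (cvgM (cvgN h) (cvgM (cvgV n0 fc) (cvg_cst _))).
rewrite expr2 invfM; apply: eq_near_cvg.
have fn0 : \forall w \near F, f w != 0 by exact: (cvgr_neq0 _ fc n0).
near=> w; have w0 : f w != 0 by near: w.
have e0 : eta w != 0 by near: w.
by field; rewrite w0 n0 e0.
Unshelve. all: by end_near. Qed.

Lemma der_sum (I : Type) (s : seq I) (P : pred I) (f : I -> T -> CC R) (a d : I -> CC R) :
  (forall i, P i -> der (f i) (a i) (d i)) ->
  der (fun w => \sum_(i <- s | P i) f i w) (\sum_(i <- s | P i) a i)
      (\sum_(i <- s | P i) d i).
Proof.
move=> h; elim: s => [|i s IH].
  by rewrite !big_nil; under eq_fun do rewrite big_nil; exact: der_cst.
rewrite !big_cons; under eq_fun do rewrite big_cons.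
case: ifPn => [Pi|_]; [exact: (derD (h i Pi) IH)|exact: IH].
Qed.

(** Each derivative is written [a i * d i], so that d is a logarithmic derivative and logarithmic
    derivatives add up, with no factor removed from the product. *)
Lemma der_log_prod (I : Type) (s : seq I) (P : pred I) (f : I -> T -> CC R)
    (a d : I -> CC R) :
  (forall i, P i -> der (f i) (a i) (a i * d i)) ->
  der (fun w => \prod_(i <- s | P i) f i w) (\prod_(i <- s | P i) a i)
      (\prod_(i <- s | P i) a i * \sum_(i <- s | P i) d i).
Proof.
move=> h; elim: s => [|i s IH].
  by rewrite !big_nil mulr0; under eq_fun do rewrite big_nil; exact: der_cst.
rewrite !big_cons; under eq_fun do rewrite big_cons.
case: ifPn => [Pi|_]; last exact: IH.
rewrite (_ : a i * _ * _ = a i * d i * \prod_(j <- s | P j) a j +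
  a i * (\prod_(j <- s | P j) a j * \sum_(j <- s | P j) d j)); last by ring.
exact: (derM (h i Pi) IH).
Qed.

Lemma der_Cexp f a d : der f a d ->
  der (fun w => Cexp (f w)) (Cexp a) (Cexp a * d).
Proof.
move=> h; have fc := der_cvg h.
have : (fun w => Cexp a * ((f w - a) / eta w) * expq (f w - a)) @ F
    --> Cexp a * d * 1.
  apply: (cvgM (cvgM (cvg_cst (Cexp a)) h)); apply: expq_cvg.
  by rewrite -(subrr a); exact: (cvgB fc (cvg_cst _)).
rewrite mulr1; apply: eq_near_cvg; near=> w.
have -> : Cexp (f w) - Cexp a = Cexp a * (Cexp (f w - a) - 1).
  by rewrite mulrBr mulr1 -CexpD [a + _]addrC subrK.
by rewrite expqE; ring.
Unshelve. all: by end_near. Qed.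

(* Logarithms are differentiated through the Caratheodory factor [expq]. *)
Lemma der_log (l : T -> CC R) (lim : CC R) f a d :
  l @ F --> lim -> (\forall w \near F, Cexp (l w) = f w) ->
  Cexp lim = a -> der f a d -> der l lim (d / a).
Proof.
move=> lc lf limf h; have n0 : a != 0 by rewrite -limf Cexp_neq0.
have qc : (fun w => expq (l w - lim)) @ F --> (1 : CC R).
  by apply: expq_cvg; rewrite -(subrr lim); exact: (cvgB lc (cvg_cst _)).
have : (fun w => (f w - a) / eta w * (a * expq (l w - lim))^-1) @ F
    --> d * (a * 1)^-1.
  by apply: (cvgM h (cvgV _ (cvgM (cvg_cst a) qc))); rewrite mulr1.
rewrite mulr1; apply: eq_near_cvg.
have qn0 : \forall w \near F, expq (l w - lim) != 0.
  by apply: (cvgr_neq0 _ qc); exact: oner_neq0.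
near=> w; have w0 : expq (l w - lim) != 0 by near: w.
have -> : f w - a = a * ((l w - lim) * expq (l w - lim)).
  rewrite -expqE -limf mulrBr mulr1 -CexpD [lim + _]addrC subrK.
  by congr (_ - _); apply/esym; near: w.
have e0 : eta w != 0 by near: w.
by field; rewrite n0 w0 e0.
Unshelve. all: by end_near. Qed.

End DifferenceQuotients.

Arguments der_cst {R T F FF} eta a.


(** * Complex differentiation under the integral sign *)

Section DerivationUnderIntegral.
Variables (R : realType).
Local Notation ccube f := {within (@unit_cube R _), continuous f}.

Lemma cube_int_near d (f g : 'rV[R]_d -> CC R) (M : R) : ccube f -> ccube g ->
  (forall v, unit_cube v -> `|f v - g v| <= toC M) ->
  `|cube_int f - cube_int g| <= toC (2 * M).
Proof.
move=> /within_continuousCP [f1 f2] /within_continuousCP [g1 g2] h.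
apply: le_trans (norm_le_ReIm _) _; rewrite toC_le.
rewrite ReB ImB !(Re_cube_int, Im_cube_int) [2 * M](_ : _ = M + M); last by ring.
apply: lerD; apply: rcube_lip => // v hv; rewrite -?ReB -?ImB -toC_le.
  exact: le_trans (Re_le_norm _) (h v hv).
exact: le_trans (Im_le_norm _) (h v hv).
Qed.

(** For h non-zero, p |-> p h carries the punctured neighbourhoods of 0 in R into those of 0 in the
    complex numbers; for h = 0 the function is constant. *)
Lemma der_along_segment (phi : CC R -> CC R) (z h d : CC R) :
  der ((0 : CC R)^') id (fun k => phi (z + k)) (phi z) d ->
  (fun p : R => (phi (z + toC p * h) - phi z) / toC p) @ 0^' --> h * d.
Proof.
have [->|h0] := eqVneq h 0.
  move=> _; under eq_fun do rewrite mulr0 addr0 subrr mul0r.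
  by rewrite mul0r; exact: cvg_cst.
move=> hd; have p0 : \forall p \near (0 : R)^', toC p * h != 0.
  near=> p; rewrite mulf_neq0 // toC_eq0; near: p; exact: nbhs_dnbhs_neq.
have c0 : (fun p : R => toC p * h) @ (0 : R)^' --> (0 : CC R).
  have id0 : (fun p : R => p) @ (0 : R)^' --> (0 : R) by exact: nbhs_dnbhs.
  have z0 : toC (0 : R) * h = 0 by rewrite /toC mul0r.
  rewrite -z0.
  Timeout 10 exact: (cvgM (toC_cvg id0) (cvg_cst h)).
have pc : (fun p : R => toC p * h) @ (0 : R)^' --> (0 : CC R)^'.
  move=> P hP; have hP' : nbhs (0 : CC R) [set k | k != 0 -> P k] := hP.
  have c0' : \forall p \near (0 : R)^', toC p * h != 0 -> P (toC p * h) := c0 _ hP'.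
  by move: c0' p0; apply: filterS2 => p k1 k2; exact: k1.
have hc : (fun p : R => h * ((phi (z + toC p * h) - phi z) / (toC p * h))) @ 0^'
  --> h * d by exact: (cvgM (cvg_cst h) (cvg_comp _ _ pc hd)).
apply: eq_near_cvg hc; near=> p.
have ph : toC p * h != 0 by near: p.
have : toC p != 0 by apply: contraNneq ph => ->; rewrite mul0r.
by move=> pn; field; rewrite pn h0.
Unshelve. all: by end_near. Qed.

(** The mean value theorem is applied to the real and imaginary parts of r |-> phi (r h) - r h phi'
    0 separately. Each part has its own intermediate point, whence the factor 2. *)
Lemma complex_mean_value (phi phi' : CC R -> CC R) (h : CC R) (M : R) :
  (forall r : R, 0 <= r <= 1 ->
    der ((0 : CC R)^') id (fun k => phi (toC r * h + k)) (phi (toC r * h))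
      (phi' (toC r * h))) ->
  (forall r : R, 0 <= r <= 1 -> `|phi' (toC r * h) - phi' 0| <= toC M) ->
  `|phi h - phi 0 - h * phi' 0| <= toC (2 * M) * `|h|.
Proof.
move=> hd hM.
pose f r := phi (toC r * h) - toC r * (h * phi' 0).
have df r : 0 <= r <= 1 ->
    (fun p : R => (f (r + p) - f r) / toC p) @ 0^' --> h * (phi' (toC r * h) - phi' 0).
  move=> hr; have h2 := @der_along_segment phi (toC r * h) h _ (hd r hr).
  have h1 : (fun p : R => (phi (toC r * h + toC p * h) - phi (toC r * h)) / toC p -
     h * phi' 0) @ 0^' --> h * phi' (toC r * h) - h * phi' 0.
    by exact: (cvgB h2 (cvg_cst _)).
  rewrite mulrBr; apply: eq_near_cvg h1; near=> p.
   have p0 : toC p != 0 by rewrite toC_eq0; near: p; exact: nbhs_dnbhs_neq.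
  have rp : toC (r + p) * h = toC r * h + toC p * h by rewrite toCD mulrDl.
  by rewrite /f rp toCD; field.
have fE : phi h - phi 0 - h * phi' 0 = f 1 - f 0.
  by rewrite /f /toC !mul1r !mul0r subr0 [RHS]addrAC.
have bound c : 0 <= c <= 1 ->
    `|h * (phi' (toC c * h) - phi' 0)| <= toC M * `|h|.
  by move=> hc; rewrite normrM mulrC ler_wpM2r // hM.
have hN : `|h| = toC (complex.Re `|h|) by rewrite normc_def.
have dd (c : R) : c \in `]0, 1[%R -> 0 <= c <= 1.
  by rewrite in_itv => /andP[? ?]; rewrite !ltW.
rewrite fE; apply: le_trans (norm_le_ReIm _) _; rewrite ReB ImB.
have [||c1 hc1 e1] := @MVT_segment R (fun r => complex.Re (f r))
  (fun r => complex.Re (h * (phi' (toC r * h) - phi' 0))) 0 1 ler01.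
- by move=> c /dd hc; have [] := ReIm_is_derive (df c hc).
- apply: (@derivable_within_continuous _ _ _ `[0, 1]) => c; rewrite in_itv/= => hc.
  by have [[]] := ReIm_is_derive (df c hc).
have [||c2 hc2 e2] := @MVT_segment R (fun r => complex.Im (f r))
  (fun r => complex.Im (h * (phi' (toC r * h) - phi' 0))) 0 1 ler01.
- by move=> c /dd hc; have [] := ReIm_is_derive (df c hc).
- apply: (@derivable_within_continuous _ _ _ `[0, 1]) => c; rewrite in_itv/= => hc.
  by have [_ []] := ReIm_is_derive (df c hc).
rewrite e1 e2 subr0 !mulr1 toCD.
rewrite (_ : toC (2 * M) * `|h| = toC M * `|h| + toC M * `|h|); last first.
  by rewrite [2 * M](_ : _ = M + M); [rewrite toCD mulrDl|ring].
rewrite in_itv/= in hc1; rewrite in_itv/= in hc2.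
apply: lerD.
  exact: le_trans (Re_le_norm _) (bound _ hc1).
exact: le_trans (Im_le_norm _) (bound _ hc2).
Unshelve. all: by end_near. Qed.

Lemma cube_int_der d (G G' : CC R -> 'rV[R]_d -> CC R) :
  (\forall h \near (0 : CC R), forall v, unit_cube v ->
     der ((0 : CC R)^') id (fun k => G (h + k) v) (G h v) (G' h v)) ->
  (\forall h \near (0 : CC R), ccube (G h)) -> ccube (G' 0) ->
  (forall v, unit_cube v -> (fun z : 'rV[R]_d * CC R => G' z.2 z.1)
     @ (within (@unit_cube R d) (nbhs v), nbhs (0 : CC R)) --> G' 0 v) ->
  der ((0 : CC R)^') id (fun h => cube_int (G h)) (cube_int (G 0)) (cube_int (G' 0)).
Proof.
move=> dG cG cG' jG'; apply/cvgrPdist_le => eps /pos_toC [->].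
move: (complex.Re eps) => e e0.
(* The bound e / 4 is doubled by [complex_mean_value] and again by [cube_int_near]. It splits into e
   / 8 + e / 8 because G' h w and G' 0 w are both compared with the limit G' 0 v. *)
have unif : \forall h \near (0 : CC R), forall v, unit_cube v ->
    `|G' h v - G' 0 v| <= toC (e / 4).
  apply: (near_cube (F := nbhs (0 : CC R))
    (P := fun h v => `|G' h v - G' 0 v| <= toC (e / 4))) => v hv.
  have e8 : toC 0 < toC (e / 8) by rewrite toC_lt divr_gt0.
  move: (jG' v hv) => /cvgrPdist_lt /(_ _ e8) [[A B] /= [hA hB] AB].
  have hA' : nbhs v [set w | unit_cube w -> A w] := hA.
  have hB' : nbhs (0 : CC R) B := hB.
  exists ([set w | unit_cube w -> A w], B) => //= -[w h] /= [hw Bh] cw.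
  have k1 := AB (w, h) (conj (hw cw) Bh).
  have k2 := AB (w, 0) (conj (hw cw) (nbhs_singleton hB')).
  rewrite (_ : e / 4 = e / 8 + e / 8); last by field.
  apply: le_trans (ler_distD (G' 0 v) _ _) _; rewrite toCD lerD ?ltW //.
  by rewrite distrC.
have [del del0 hdel] := (nbhs_ballP _ _).1 (filterI dG (filterI cG unif)).
have hd : \forall h \near (0 : CC R)^', `|h| < del by apply: dnbhs0_lt.
near=> h; have hh : `|h| < del by near: h.
have h0 : h != 0 by near: h; exact: nbhs_dnbhs_neq.
have inb k : `|k| <= `|h| -> ball (0 : CC R) del k.
  by move=> hk; rewrite /ball/= sub0r normrN; exact: le_lt_trans hh.
have [_ [cGh _]] := hdel h (inb h (lexx _)).
have n0 : `|0 : CC R| <= `|h| by rewrite normr0.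
have [_ [cG0 _]] := hdel 0 (inb 0 n0).
rewrite [X in _ <= toC X](_ : e = 2 * (e / 2)); last by field.
have cd : ccube (fun v => G h v - G 0 v).
  by move=> v; apply: cvgB; [exact: cGh|exact: cG0].
rewrite distrC mulrC -(cube_intB cGh cG0) -(cube_intZ _ cd).
refine (cube_int_near (within_cvgZ (c := h^-1) cd) cG' _).
move=> v hv; rewrite (_ : _ - _ = (G h v - G 0 v - h * G' 0 v) / h); last by field.
rewrite normrM normfV ler_pdivrMr ?normr_gt0 //.
rewrite (_ : e / 2 = 2 * (e / 4)); last by field.
have rb r : 0 <= r <= 1 -> `|toC r * h| <= `|h|.
  case/andP=> r0 r1; rewrite normrM norm_toC (ger0_norm r0) ler_piMl //.
  by rewrite -[1]/(toC 1) toC_le.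
apply: (complex_mean_value (phi := fun k => G k v) (phi' := fun k => G' k v)).
  by move=> r /rb /inb /hdel [k1 _]; exact: k1.
by move=> r /rb /inb /hdel [_ [_ k2]]; exact: k2.
Unshelve. all: by end_near. Qed.

Lemma pd_der m (F : 'rV[CC R]_m -> CC R) (a : 'I_m) x d :
  der ((0 : CC R)^') id (fun h => F (x + h *: delta_mx 0 a)) (F x) d <->
  is_derive x (delta_mx 0 a) F d.
Proof. by split=> [h|/is_derive_cvgP //]; apply/is_derive_cvgP. Qed.

End DerivationUnderIntegral.


(** * Symmetry of second partial derivatives *)

Section Schwarz.
Variables (R : realType) (d : nat).
Local Notation e_ i := (delta_mx 0 i : 'rV[R]_d).

Lemma line_derive (g : 'rV[R]_d -> R) (i : 'I_d) (w : 'rV[R]_d) (r : R) :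
  derivable g (w + r *: e_ i) (e_ i) ->
  is_derive r 1 (fun p : R => g (w + p *: e_ i)) ('D_(e_ i) g (w + r *: e_ i)).
Proof.
move=> /derivableP /is_derive_cvgP h; apply/is_derive_cvgP.
rewrite [X in X @ _ --> _](_ : _ =
  (fun h0 : R => (g (w + r *: e_ i + h0 *: e_ i) - g (w + r *: e_ i)) / h0)) //.
by apply/funext => p; rewrite [p *: 1]mulr1 scalerDl addrA.
Qed.

Lemma second_difference (f : 'rV[R]_d -> R) (i j : 'I_d) (w : 'rV[R]_d) (h : R) :
  C2 f -> 0 < h ->
  exists r p, [/\ 0 <= r <= h, 0 <= p <= h &
    f (w + h *: e_ i + h *: e_ j) - f (w + h *: e_ i) - (f (w + h *: e_ j) - f w)
    = 'D_(e_ j) ('D_(e_ i) f) (w + r *: e_ i + p *: e_ j) * h * h].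
Proof.
move=> [f1 f2] h0.
pose g r := f (w + h *: e_ j + r *: e_ i) - f (w + r *: e_ i).
have dg (r : R) : is_derive r 1 g
    ('D_(e_ i) f (w + h *: e_ j + r *: e_ i) - 'D_(e_ i) f (w + r *: e_ i)).
  by apply: is_deriveB; apply: line_derive; have [] := f1 i.
have cg : {within `[0, h], continuous g}.
  by apply: (@derivable_within_continuous _ _ _ `[0, h]) => r _; have [] := dg r.
have [r hr er] := MVT_segment (ltW h0) (fun r _ => dg r) cg.
pose g2 p := 'D_(e_ i) f (w + r *: e_ i + p *: e_ j).
have dg2 (p : R) : is_derive p 1 g2 ('D_(e_ j) ('D_(e_ i) f) (w + r *: e_ i + p *: e_ j)).
  by apply: line_derive; have [] := f2 i j.
have cg2 : {within `[0, h], continuous g2}.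
  by apply: (@derivable_within_continuous _ _ _ `[0, h]) => p _; have [] := dg2 p.
have [p hp ep] := MVT_segment (ltW h0) (fun p _ => dg2 p) cg2.
rewrite in_itv/= in hr; rewrite in_itv/= in hp.
exists r, p; split=> //; move: er ep; rewrite /g /g2 !scale0r !addr0 !subr0 => er ep.
by rewrite -ep -[w + r *: _ + h *: _]addrAC -er; rewrite [w + h *: e_ j + _]addrAC.
Qed.

(** The second difference over a square of side h is symmetric in i and j, and two mean values turn
    it into h^2 times either mixed derivative at some point of the square; continuity lets h tend to
    0. *)
Lemma schwarz (f : 'rV[R]_d -> R) (i j : 'I_d) (w : 'rV[R]_d) : C2 f ->
  'D_(e_ j) ('D_(e_ i) f) w = 'D_(e_ i) ('D_(e_ j) f) w.
Proof.
move=> cf; have [f1 f2] := cf.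
have lim (a b : 'I_d) (eps : R) : 0 < eps -> \forall h \near (0 : R)^'+,
    forall r p, 0 <= r <= h -> 0 <= p <= h ->
    `|'D_(e_ b) ('D_(e_ a) f) w - 'D_(e_ b) ('D_(e_ a) f) (w + r *: e_ a + p *: e_ b)| < eps.
  move=> eps0; have [_ cD] := f2 a b.
  have := cD w => /cvgrPdist_lt /(_ _ eps0) /nbhs_ballP [del del0 hdel].
  near=> h => r p hr hp; apply: hdel.
  (* Half of del, since r and p add up in the same coordinate when a = b. *)
  have hh : h < del / 2 by near: h; apply: nbhs_right_lt; rewrite divr_gt0.
  split=> // x y; rewrite /ball/= !mxE -addrA opprD addNKr normrN.
  rewrite (ord1 x) eqxx /=.
  have [r0 r1] := andP hr; have [p0 p1] := andP hp.
  by case: (y == a); case: (y == b); rewrite ?mulr1 ?mulr0 ger0_norm; lra.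
apply/eqP; rewrite -subr_eq0 -normr_le0; apply/ler_addgt0Pr => eps eps0.
have e2 : 0 < eps / 2 by rewrite divr_gt0.
have h0 : \forall h \near (0:R)^'+, 0 < h by exact: nbhs_right_gt.
have [h [[hp hl1] hl2]] := filter_ex (filterI (filterI h0 (lim i j _ e2)) (lim j i _ e2)).
have [r1 [p1 [hr1 hp1 E1]]] := second_difference i j w cf hp.
have [r2 [p2 [hr2 hp2 E2]]] := second_difference j i w cf hp.
have E : 'D_(e_ j) ('D_(e_ i) f) (w + r1 *: e_ i + p1 *: e_ j) =
         'D_(e_ i) ('D_(e_ j) f) (w + r2 *: e_ j + p2 *: e_ i).
  have swap (x y z u : R) : x - y - (z - u) = x - z - (y - u) by ring.
  have AB := swap (f (w + h *: e_ i + h *: e_ j)) (f (w + h *: e_ i))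
    (f (w + h *: e_ j)) (f w).
  rewrite {2}[w + h *: e_ i + _]addrAC in AB.
  have hn0 := lt0r_neq0 hp.
  exact: (mulIf hn0 (mulIf hn0 (etrans (esym E1) (etrans AB E2)))).
rewrite add0r; apply: le_trans (ler_distD _ _ _) _; last first.
  rewrite [eps]splitr; apply: lerD; apply: ltW; first exact: (hl1 _ _ hr1 hp1).
  by rewrite E distrC; exact: (hl2 _ _ hr2 hp2).
Unshelve. all: by end_near. Qed.

End Schwarz.

(** * The Piola identity: cofactors of a Jacobian matrix have zero divergence *)

Section Piola.
Variables (K : numFieldType) (N : nat).

Lemma sum_antisym (T : 'I_N -> 'I_N -> K) :
  (forall a c, a != c -> T a c = - T c a) -> \sum_a \sum_(c | c != a) T a c = 0.
Proof.
move=> h; set S := LHS.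
have : S = - S.
  rewrite {1}/S (exchange_big_dep predT) //= /S -sumrN; apply: eq_bigr => c _.
  rewrite -sumrN; apply: eq_big => [a|a]; first by rewrite eq_sym.
  by rewrite eq_sym => /h ->.
by move/eqP; rewrite -subr_eq0 opprK -mulr2n mulrn_eq0 /= => /eqP.
Qed.

(* The right-hand sides summed here are the derivatives along [a] of the cofactors
   at (a, j) of a Jacobian matrix [J], with [H] the second derivatives. *)
Lemma piola (J : 'M[K]_N) (H : 'I_N -> 'I_N -> 'I_N -> K) (j : 'I_N) :
  (forall a c b, H a c b = H c a b) ->
  \sum_a \sum_(s : 'S_N | s a == j) (-1) ^+ s *
    (\sum_(c | c != a) H a c (s c) * \prod_(k | (k != a) && (k != c)) J k (s k)) = 0.
Proof.
move=> sym; under eq_bigr do under eq_bigr do rewrite mulr_sumr.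
under eq_bigr do rewrite exchange_big /=.
apply: sum_antisym => a c ac.
(* Composition with the transposition of a and c exchanges s a and s c and flips the sign of s; with
   H symmetric, the summand becomes antisymmetric in a and c. *)
rewrite (reindex_inj (mulgI (tperm a c))) /= -sumrN.
apply: eq_big => [s|s _]; first by rewrite permM tpermL.
rewrite odd_mul_tperm ac permM tpermR signr_addb expr1 mulN1r mulNr sym.
congr (- (_ * (_ * _))); apply: eq_big => [k|k]; first by rewrite andbC.
by case/andP=> ka kc; rewrite permM tpermD // eq_sym.
Qed.

End Piola.

Section DerProduct.
Variables (R : realType) (T : Type) (F : set_system T).
Context {FF : Filter F}.
Variable eta : T -> CC R.
Hypothesis eta0 : eta @ F --> (0 : CC R).
Hypothesis eta_neq0 : \forall w \near F, eta w != 0.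

Lemma der_prod (I : eqType) (s : seq I) (P : pred I) (f : I -> T -> CC R)
    (a d : I -> CC R) : uniq s ->
  (forall i, P i -> der F eta (f i) (a i) (d i)) ->
  der F eta (fun w => \prod_(i <- s | P i) f i w) (\prod_(i <- s | P i) a i)
      (\sum_(c <- s | P c) d c * \prod_(i <- s | P i && (i != c)) a i).
Proof.
move=> + h; elim: s => [|i s IH].
  by move=> _; rewrite !big_nil; under eq_fun do rewrite big_nil; exact: der_cst.
rewrite cons_uniq => /andP[iNs us]; under eq_fun do rewrite big_cons.
rewrite [\prod_(k <- _ :: _ | P k) a k]big_cons [\sum_(c <- i :: s | P c) _]big_cons.
have E1 : \prod_(k <- i :: s | P k && (k != i)) a k = \prod_(k <- s | P k) a k.
  rewrite big_cons eqxx andbF big_seq_cond [RHS]big_seq_cond; apply: eq_bigl => k.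
  by case: eqVneq => [->|]; rewrite ?(negPf iNs) ?andbT.
have E2 : \sum_(c <- s | P c) d c * \prod_(k <- i :: s | P k && (k != c)) a k =
    (if P i then a i else 1) *
    \sum_(c <- s | P c) d c * \prod_(k <- s | P k && (k != c)) a k.
  rewrite mulr_sumr big_seq_cond [RHS]big_seq_cond; apply: eq_bigr => c /andP[cs _].
  rewrite big_cons (_ : i != c); last by apply: contraNneq iNs => ->.
  by rewrite andbT; case: ifP => _; rewrite ?mul1r // mulrCA.
rewrite E1 E2; case Pi: (P i); last first.
  by rewrite mul1r; exact: IH us.
exact: (derM eta0 eta_neq0 (h i Pi) (IH us)).
Qed.

End DerProduct.


(** * Divided differences of polynomials and of functions with poles *)

Section DividedDifferences.
Variable K : fieldType.

Lemma prod_XsubC_monic_size (T : finType) (x : T -> K) (P : pred T) :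
  size (\prod_(b | P b) ('X - (x b)%:P)) = #|P|.+1 /\
  (\prod_(b | P b) ('X - (x b)%:P))`_#|P| = 1.
Proof.
have -> : \prod_(b | P b) ('X - (x b)%:P) = \prod_(b <- enum P) ('X - (x b)%:P).
  by rewrite big_enum.
rewrite cardE; split; first by rewrite size_prod_XsubC.
have := monic_prod_XsubC (enum P) predT x.
by rewrite monicE lead_coefE size_prod_XsubC => /eqP.
Qed.

Lemma horner_prod_XsubC (T : finType) (x : T -> K) (P : pred T) c :
  (\prod_(b | P b) ('X - (x b)%:P)).[c] = \prod_(b | P b) (c - x b).
Proof. by rewrite horner_prod; apply: eq_bigr => b _; rewrite hornerXsubC. Qed.

(** Lagrange interpolation: p and its interpolant l have degree at most N and agree at N + 1 points,
    hence coincide, and their coefficients of degree N are compared. *)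
Lemma divided_difference (T : finType) (N : nat) (x : T -> K) (p : {poly K}) :
  #|T| = N.+1 -> injective x -> (size p <= N.+1)%N ->
  \sum_a p.[x a] / \prod_(b | b != a) (x a - x b) = p`_N.
Proof.
move=> cT xi sp.
pose L a := \prod_(b | b != a) ('X - (x b)%:P).
pose l := \sum_a (p.[x a] / \prod_(b | b != a) (x a - x b)) *: L a.
have cL (a : T) : #|[pred b | b != a]| = N.
  exact: (etrans (cardC1 a) (congr1 predn cT)).
have sL a : size (L a) = N.+1 /\ (L a)`_N = 1.
  by have := prod_XsubC_monic_size x [pred b | b != a]; rewrite cL.
have sl : (size l <= N.+1)%N.
  apply: (leq_trans (size_sum _ _ _)); apply/bigmax_leqP => a _.
  by apply: leq_trans (size_scale_leq _ _) _; rewrite (sL a).1.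
have le (a : T) : l.[x a] = p.[x a].
  rewrite /l horner_sum (bigD1 a) //= [X in _ + X]big1 ?addr0 => [|c ca]; last first.
    by rewrite hornerZ horner_prod_XsubC [X in _ * X](bigD1 a) 1?eq_sym //= subrr mul0r mulr0.
  rewrite hornerZ horner_prod_XsubC divfK //.
  by apply/prodf_neq0 => b ba; rewrite subr_eq0 (inj_eq xi) eq_sym.
have -> : p = l.
  apply/eqP; rewrite -subr_eq0; apply/negPn/negP => n0.
  have := @max_poly_roots _ (p - l) (map x (enum T)) n0.
  rewrite map_inj_uniq // enum_uniq size_map -cardE cT => /(_ _ isT).
  have -> : all (root (p - l)) [seq x i | i <- enum T].
    by apply/allP => _ /mapP[a _ ->]; rewrite /root hornerD hornerN le subrr.
  move=> /(_ isT); rewrite ltnNge; apply/negP/negPn.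
  by apply: leq_trans (size_polyD _ _) _; rewrite geq_max sp size_polyN sl.
rewrite {2}/l coef_sum; apply: eq_bigr => a _.
by rewrite le coefZ (sL a).2 mulr1.
Qed.

(** The pole q is adjoined to the nodes; its own term in the larger divided difference is moved to
    the right-hand side. *)
Lemma divided_difference_pole (N : nat) (x : 'I_N.+1 -> K) (q : K) (p : {poly K}) :
  injective x -> (forall a, x a != q) -> (size p <= N.+2)%N ->
  \sum_a (\prod_(b | b != a) (x a - x b))^-1 * (p.[x a] / (x a - q))
  = p`_N.+1 - p.[q] / \prod_a (q - x a).
Proof.
move=> xi xq sp.
pose y (i : 'I_N.+2) := if unlift ord0 i is Some a then x a else q.
have y0 : y ord0 = q by rewrite /y unlift_none.
have yl a : y (lift ord0 a) = x a by rewrite /y liftK.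
have yi : injective y.
  move=> i j; have [a ->|->] := unliftP ord0 i; have [b ->|->] := unliftP ord0 j;
    rewrite ?yl ?y0 //.
  - by move/xi => ->.
  - by move=> e; have := xq a; rewrite e eqxx.
  - by move=> e; have := xq b; rewrite -e eqxx.
have := divided_difference (card_ord N.+2) yi sp.
rewrite big_ord_recl y0 => <-; rewrite addrAC.
rewrite (_ : \prod_(b | b != ord0) (q - y b) = \prod_a (q - x a)); last first.
  rewrite big_mkcond big_ord_recl eqxx /= mul1r; apply: eq_bigr => a _.
  by rewrite yl.
rewrite subrr add0r; apply: eq_bigr => a _; rewrite yl.
rewrite big_mkcond [in RHS]big_mkcond [in RHS]big_ord_recl /= y0.
rewrite (eq_bigr (fun i => if i != a then x a - x i else 1)) //.
rewrite [in RHS](eq_bigr (fun i => if i != a then x a - x i else 1)); last first.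
  by move=> i _; rewrite yl (inj_eq lift_inj).
by rewrite invfM; ring.
Qed.

Variables (n : nat) (p : 'I_n.+2 -> K) (x : 'I_n.+1 -> K).
Hypotheses (pi : injective p) (xi : injective x) (xp : forall a j, x a != p j).

Definition pole_weight j := \prod_(l | l != j) (p j - p l).
(** With P(z) = prod_l (z - p_l), the numerator is P'(p_j), and the quotient is the residue at p_j
    of P(z) / ((z - p_j)^2 prod_a (z - x_a)). *)
Definition residue_weight j := pole_weight j / \prod_a (p j - x a).

Let P c := \prod_j (c - p j).
Let dd (f : 'I_n.+1 -> K) := \sum_a (\prod_(b | b != a) (x a - x b))^-1 * f a.

Let ddD f g : dd (fun a => f a + g a) = dd f + dd g.
Proof. by rewrite /dd -big_split; apply: eq_bigr => a _; rewrite mulrDr. Qed.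
Let ddZ c f : dd (fun a => c * f a) = c * dd f.
Proof. by rewrite /dd mulr_sumr; apply: eq_bigr => a _; rewrite mulrCA. Qed.
Let dd_sum (I : finType) (f : I -> 'I_n.+1 -> K) :
  dd (fun a => \sum_i f i a) = \sum_i dd (f i).
Proof. by rewrite /dd exchange_big /=; apply: eq_bigr => a _; rewrite mulr_sumr. Qed.

Lemma dd_pow : dd (fun a => x a ^+ n) = 1.
Proof.
have := @divided_difference 'I_n.+1 n x 'X^n (card_ord _) xi; rewrite size_polyXn.
move=> /(_ (leqnn _)); rewrite coefXn eqxx => e.
by apply: etrans _ e; apply: eq_bigr => a _; rewrite hornerXn mulrC.
Qed.

Lemma dd_inv j : dd (fun a => (x a - p j)^-1) = - (\prod_a (p j - x a))^-1.
Proof.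
have := divided_difference_pole (q := p j) (p := 1) xi (fun a => xp a j).
rewrite size_poly1 => /(_ isT); rewrite coef1 /= sub0r hornerC mul1r => <-.
by apply: eq_bigr => a _; rewrite hornerC mul1r.
Qed.

(** For i and j distinct, both poles cancel against P and leave a monic polynomial of degree n,
    whose divided difference at n + 1 nodes is 1. For i = j a simple pole survives below a monic
    polynomial of degree n + 1, and contributes the residue. *)
Lemma dd_quadratic i j : dd (fun a => P (x a) * ((x a - p i)^-1 * (x a - p j)^-1))
  = 1 - (i == j)%:R * residue_weight j.
Proof.
have xp0 a l : x a - p l != 0 by rewrite subr_eq0.
have [->|ij] := eqVneq i j.
  rewrite mul1r; pose q := \prod_(l | l != j) ('X - (p l)%:P).
  have cq : #|[pred l | l != j]| = n.+1.
    exact: (etrans (cardC1 j) (congr1 predn (card_ord _))).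
  have [sq qn] := prod_XsubC_monic_size p [pred l | l != j].
  rewrite cq in sq qn.
  have := divided_difference_pole (q := p j) (p := q) xi (fun a => xp a j).
  rewrite sq => /(_ (leqnn _)); rewrite qn horner_prod_XsubC => <-.
  apply: eq_bigr => a _; rewrite horner_prod_XsubC; congr (_ * _).
  by rewrite /P (bigD1 j) //= -mulrA mulrCA mulVKf // mulrC.
rewrite mul0r subr0; pose q := \prod_(l | (l != i) && (l != j)) ('X - (p l)%:P).
have cq : #|[pred l | (l != i) && (l != j)]| = n.
  have := cardC (pred2 i j); rewrite card2 ij card_ord => /eqP; rewrite add2n !eqSS => /eqP e.
  apply: etrans _ e.
  by apply: eq_card => l; rewrite !inE negb_or.
have [sq qn] := prod_XsubC_monic_size p [pred l | (l != i) && (l != j)].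
rewrite cq in sq qn.
have := @divided_difference 'I_n.+1 n x q (card_ord _) xi.
rewrite sq => /(_ (leqnn _)); rewrite qn => <-.
apply: eq_bigr => a _; rewrite horner_prod_XsubC mulrC; congr (_ / _).
rewrite /P (bigD1 i) //= (bigD1 j) 1?eq_sym //=.
rewrite (eq_bigl (fun l => (l != i) && (l != j))) //.
by field; rewrite !xp0.
Qed.

Lemma dd_operator (C : 'I_n.+2 -> 'I_n.+2 -> K) (A : K) (B : 'I_n.+2 -> K) :
  dd (fun a => P (x a) * (\sum_i \sum_j C i j * ((x a - p i)^-1 * (x a - p j)^-1))
               - A * x a ^+ n - \sum_j B j * pole_weight j / (x a - p j))
  = \sum_i \sum_j C i j * (1 - (i == j)%:R * residue_weight j) - A
    + \sum_j B j * residue_weight j.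
Proof.
under [LHS]eq_bigr do rewrite -mulNr.
rewrite -/(dd (fun a => _)) !ddD; congr (_ + _ + _).
- transitivity (dd (fun a => \sum_i \sum_j
    C i j * (P (x a) * ((x a - p i)^-1 * (x a - p j)^-1)))).
    apply: eq_bigr => a _; congr (_ * _); rewrite mulr_sumr; apply: eq_bigr => i _.
    by rewrite mulr_sumr; apply: eq_bigr => j _; rewrite mulrCA.
  rewrite dd_sum; apply: eq_bigr => i _; rewrite dd_sum; apply: eq_bigr => j _.
  by rewrite ddZ dd_quadratic.
- by rewrite ddZ dd_pow mulr1.
- transitivity (dd (fun a => \sum_j (- (B j * pole_weight j)) * (x a - p j)^-1)).
    by apply: eq_bigr => a _; congr (_ * _); rewrite -sumrN; apply: eq_bigr => j _; rewrite mulNr.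
  rewrite dd_sum; apply: eq_bigr => j _.
  by rewrite ddZ dd_inv mulrNN /residue_weight mulrA.
Qed.

End DividedDifferences.


(** * The algebra behind the operators M and L *)

Section OperatorIdentities.
Variables (K : fieldType) (n : nat) (p : 'I_n.+2 -> K).
Hypothesis pi : injective p.

(** P(x) / (x - p_j) is monic of degree n + 1, so its divided difference at the n + 2 nodes is 1,
    and each y_j is recovered with coefficient 1. *)
Lemma first_order_identity (x : 'I_n.+2 -> K) (y : 'I_n.+2 -> K) :
  injective x -> (forall a j, x a != p j) ->
  \sum_a (\prod_j (x a - p j)) / \prod_(b | b != a) (x a - x b)
     * (\sum_j y j / (x a - p j)) = \sum_j y j.
Proof.
move=> xi xp.
transitivity (\sum_j y j * (\sum_a (\prod_(l | l != j) ('X - (p l)%:P)).[x a]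
   / \prod_(b | b != a) (x a - x b))).
  under eq_bigr do rewrite mulr_sumr.
  rewrite exchange_big /=; apply: eq_bigr => j _; rewrite mulr_sumr.
  apply: eq_bigr => a _; rewrite horner_prod_XsubC [\prod_j (x a - p j)](bigD1 j) //=.
  have n0 : x a - p j != 0 by rewrite subr_eq0.
  have cancel_pole (c u v w : K) : c != 0 -> c * u * v * (w / c) = w * (u * v).
    by move=> c0; field.
  exact: cancel_pole.
apply: eq_bigr => j _; rewrite -[RHS]mulr1; congr (_ * _).
have cq : #|[pred l | l != j]| = n.+1.
  exact: (etrans (cardC1 j) (congr1 predn (card_ord _))).
have [sq qn] := prod_XsubC_monic_size p [pred l | l != j].
rewrite cq in sq qn.
rewrite -[RHS]qn; apply: divided_difference => //; first by rewrite card_ord.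
by rewrite sq.
Qed.

(** [C i j] collects the coefficients of 1 / ((x - p_i) (x - p_j)); its last term y_j comes from the
    derivative of P. The sum of all [C i j] is s^2 - beta + (beta - s) + (n + 2) s = s (s + n + 1),
    which is what the term in x^n removes. On the diagonal, [C j j] = k_j^2 + beta g_j, and k_j^2 is
    removed by the polar part of the operator. *)
Lemma second_order_identity (x : 'I_n.+1 -> K) (y z k : 'I_n.+2 -> K) (s beta : K) :
  injective x -> (forall a j, x a != p j) ->
  \sum_j z j = 1 -> \sum_j y j = s -> (forall j, y j = beta * z j - k j) ->
  \sum_a (\prod_(b | b != a) (x a - x b))^-1 *
    ((\prod_j (x a - p j)) *
       ((\sum_j y j / (x a - p j)) ^+ 2 + (\sum_j k j / (x a - p j) ^+ 2)
        - beta * (\sum_j z j / (x a - p j)) ^+ 2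
        + (\sum_i (x a - p i)^-1) * (\sum_j y j / (x a - p j)))
     - s * (s + n%:R + 1) * x a ^+ n
     - \sum_j k j ^+ 2 * pole_weight p j / (x a - p j))
  = - beta * \sum_j residue_weight p x j *
      ((1 - 2 * k j) * z j + (beta - 1) * z j ^+ 2).
Proof.
move=> xi xp sz sy yE.
pose C i j := y i * y j - beta * (z i * z j) + (i == j)%:R * k j + y j.
have sk : \sum_j k j = beta - s.
  rewrite -sy (eq_bigr _ (fun j _ => yE j)) sumrB -mulr_sumr sz mulr1.
  by rewrite opprB subrKC.
have kron (f : 'I_n.+2 -> 'I_n.+2 -> K) :
    \sum_i \sum_j (i == j)%:R * f i j = \sum_j f j j.
  apply: eq_bigr => i _; rewrite (bigD1 i) //= eqxx mul1r big1 ?addr0 // => j ji.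
  by rewrite eq_sym (negPf ji) mul0r.
transitivity (\sum_i \sum_j C i j * (1 - (i == j)%:R * residue_weight p x j)
   - s * (s + n%:R + 1) + \sum_j k j ^+ 2 * residue_weight p x j).
  rewrite -(dd_operator xi xp); apply: eq_bigr => a _; congr (_ * (_ * _ - _ - _)).
  have quad (u v : 'I_n.+2 -> K) : (\sum_j u j / (x a - p j)) * (\sum_j v j / (x a - p j))
      = \sum_i \sum_j u i * v j * ((x a - p i)^-1 * (x a - p j)^-1).
    rewrite mulr_suml; apply: eq_bigr => i _; rewrite mulr_sumr; apply: eq_bigr => j _.
    by rewrite mulrACA.
  have -> : \sum_i (x a - p i)^-1 = \sum_i 1 / (x a - p i).
    by apply: eq_bigr => i _; rewrite mul1r.
  have -> : \sum_j k j / (x a - p j) ^+ 2 =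
     \sum_i \sum_j (i == j)%:R * (k j * ((x a - p i)^-1 * (x a - p j)^-1)).
    by rewrite kron; apply: eq_bigr => j _; rewrite expr2 invfM.
  rewrite !expr2 !quad mulr_sumr -big_split -sumrB -big_split /=; apply: eq_bigr => i _.
  by rewrite mulr_sumr -big_split -sumrB -big_split /=; apply: eq_bigr => j _; rewrite /C; ring.
have -> : \sum_i \sum_j C i j * (1 - (i == j)%:R * residue_weight p x j) =
   (s * s - beta + (beta - s) + n.+2%:R * s) - \sum_j C j j * residue_weight p x j.
  under eq_bigr => i _ do under eq_bigr => j _ do rewrite mulrBr mulr1 mulrCA.
  under eq_bigr do rewrite sumrB.
  rewrite sumrB kron; congr (_ - _).
  rewrite /C; under eq_bigr do rewrite !big_split /=.
  rewrite !big_split /= kron sk; congr (_ + _ + _ + _).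
  - under eq_bigr do rewrite -mulr_sumr sy.
    by rewrite -mulr_suml sy.
  - under eq_bigr do rewrite sumrN -mulr_sumr -mulr_sumr sz mulr1.
    by rewrite sumrN -mulr_sumr sz mulr1.
  - by rewrite sy sumr_const card_ord mulr_natl.
rewrite (_ : \sum_j C j j * residue_weight p x j =
  \sum_j k j ^+ 2 * residue_weight p x j + beta * \sum_j residue_weight p x j *
      ((1 - 2 * k j) * z j + (beta - 1) * z j ^+ 2)); last first.
  rewrite mulr_sumr -big_split /=; apply: eq_bigr => j _.
  by rewrite /C eqxx /= !yE; ring.
by rewrite (_ : n.+2%:R = n%:R + 2 :> K); [ring|rewrite -addn2 natrD].
Qed.

(* The products over the free variables form a polynomial of degree too small
   for its divided difference at the poles not to vanish. *)
Lemma residue_relation (m : nat) (x : 'I_m -> K) (I : 'I_n.+1 -> 'I_m) :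
  injective I -> (forall l j, x l != p j) -> (m <= n + n.+1)%N ->
  \sum_j residue_weight p (fun a => x (I a)) j *
     ((\prod_l (x l - p j)) / pole_weight p j ^+ 2) = 0.
Proof.
move=> Ii xp mn.
pose f := \prod_(l | l \notin codom I) ('X - (x l)%:P).
have cI : #|[pred l | l \notin codom I]| = (m - n.+1)%N.
  have := cardC (mem (codom I)); rewrite card_codom // !card_ord => e.
  have <- : #|[predC codom I]| = (m - n.+1)%N by rewrite -[in RHS]e addKn.
  by apply: eq_card => l; rewrite !inE.
have [sf _] := prod_XsubC_monic_size x [pred l | l \notin codom I].
rewrite cI in sf.
have sf' : (size f <= n.+1)%N by rewrite [size f]sf; lia.
(* At most m - (n + 1) <= n variables are free, so f has degree at most n, whereas n + 2 nodes
   select the coefficient of degree n + 1. *)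
have := divided_difference (card_ord n.+2) pi (leqW sf').
rewrite nth_default // => f0.
transitivity ((-1) ^+ m * \sum_a f.[p a] / \prod_(b | b != a) (p a - p b)); last first.
  by rewrite f0 mulr0.
rewrite mulr_sumr; apply: eq_bigr => j _.
have W0 : pole_weight p j != 0.
  by apply/prodf_neq0 => l lj; rewrite subr_eq0 (inj_eq pi) eq_sym.
have A0 : \prod_a (p j - x (I a)) != 0.
  by apply/prodf_neq0 => a _; rewrite subr_eq0 eq_sym xp.
have -> : \prod_l (x l - p j) = (-1) ^+ m * ((\prod_a (p j - x (I a))) * f.[p j]).
  transitivity (\prod_l ((-1) * (p j - x l))).
    by apply: eq_bigr => l _; rewrite mulN1r opprB.
  rewrite big_split prodr_const card_ord /=; congr (_ * _).
  rewrite horner_prod_XsubC (bigID (mem (codom I))) /=; congr (_ * _).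
  have uc : uniq (codom I) by rewrite codomE map_inj_uniq ?enum_uniq.
  by rewrite -(big_uniq _ uc) codomE big_map big_enum.
by rewrite /residue_weight -/(pole_weight p j); field; rewrite W0 A0.
Qed.

End OperatorIdentities.


(** * A uniform formula for the u_j, the pole 0 included *)

Section Poles.
Variables (R : realType) (n : nat) (t : n.-tuple (CC R)).
Local Notation p := (poles t).

Lemma poles0 : p ord0 = 0. Proof. by []. Qed.

Lemma poles1 : p (lift ord0 ord0) = 1.
Proof. by rewrite /poles tnthS tnth0. Qed.

Lemma poles_lift i : p (lift ord0 (lift ord0 i)) = tnth t i.
Proof. by rewrite /poles !tnthS. Qed.

Lemma poles_inj : 0 \notin t -> 1 \notin t -> uniq t -> injective p.
Proof.
move=> t0 t1 tu; apply/tuple_uniqP => /=; rewrite t1 tu !andbT.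
by rewrite inE negb_or t0 andbT eq_sym oner_eq0.
Qed.

(* [u_1, ..., u_(n+1)] preceded by [u_0 = 1], to match the indexing of the poles. *)
Definition uhom m (j : 'I_n.+2) (x : 'rV[CC R]_m) : CC R :=
  if unlift ord0 j is Some i then uvar t i x else 1.

Lemma uhom0 m (x : 'rV[CC R]_m) : uhom ord0 x = 1.
Proof. by rewrite /uhom unlift_none. Qed.
Lemma uhom_lift m i (x : 'rV[CC R]_m) : uhom (lift ord0 i) x = uvar t i x.
Proof. by rewrite /uhom liftK. Qed.

Lemma pole_weight0_sqr : pole_weight p ord0 ^+ 2 = \prod_(h < n) tnth t h ^+ 2.
Proof.
rewrite /pole_weight big_mkcond big_ord_recl eqxx /= mul1r big_ord_recl /= poles1 poles0.
rewrite sub0r exprMn sqrrN expr1n mul1r -prodrXl; apply: eq_bigr => h _.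
by rewrite poles_lift sub0r sqrrN.
Qed.

(** The squared products in u_j are the squared weight of the pole 0 over the squared weight of the
    pole t_j, up to a common factor t_j^2. For the pole 0 itself everything cancels to 1, so no pole
    needs separate treatment afterwards. *)
Lemma uhomE m (j : 'I_n.+2) (x : 'rV[CC R]_m) : injective p ->
  coordinates_product x != 0 ->
  uhom j x = pole_weight p ord0 ^+ 2 / coordinates_product x
     * ((\prod_l (x 0 l - p j)) / pole_weight p j ^+ 2).
Proof.
move=> pi x0.
have W0 i : pole_weight p i != 0.
  by apply/prodf_neq0 => l li; rewrite subr_eq0 (inj_eq pi) eq_sym.
have [i ->|->] := unliftP ord0 j; last first.
  rewrite uhom0 poles0 /coordinates_product; under [in RHS]eq_bigr do rewrite subr0.
  by field; rewrite W0.
rewrite uhom_lift /uvar; have [h ->|->] := unliftP ord0 i; last first.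
  rewrite pole_weight0_sqr poles1 /pole_weight.
  have -> : \prod_(l | l != lift ord0 ord0) (p (lift ord0 ord0) - p l)
     = \prod_(h < n) (1 - tnth t h).
    rewrite big_mkcond big_ord_recl /= poles1 poles0 subr0 mul1r.
    rewrite big_ord_recl eqxx /= mul1r; apply: eq_bigr => h _.
    by rewrite poles_lift.
  have -> : (\prod_(h < n) (1 - tnth t h)) ^+ 2 = \prod_(h < n) (tnth t h - 1) ^+ 2.
    by rewrite -prodrXl; apply: eq_bigr => h _; rewrite -sqrrN opprB.
  by rewrite !invfM; ring.
rewrite pole_weight0_sqr /pole_weight poles_lift.
have -> : \prod_(l | l != lift ord0 (lift ord0 h)) (tnth t h - p l)
    = tnth t h * ((tnth t h - 1) * \prod_(l < n | l != h) (tnth t h - tnth t l)).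
  rewrite big_mkcond big_ord_recl /= poles0 subr0; congr (_ * _).
  rewrite big_ord_recl /= poles1; congr (_ * _).
  rewrite [RHS]big_mkcond; apply: eq_bigr => l _.
  by rewrite poles_lift !(inj_eq lift_inj).
rewrite [\prod_(l < n) _ ^+ 2](bigD1 h) //= !exprMn.
have -> : (\prod_(l < n | l != h) (tnth t h - tnth t l)) ^+ 2 =
    \prod_(l < n | l != h) (tnth t l - tnth t h) ^+ 2.
  by rewrite -prodrXl; apply: eq_bigr => l _; rewrite -sqrrN opprB.
have cancel_pole (A T X D1 D2 c : CC R) : c != 0 ->
    A * T / (X * D1 * D2) = c * T / X * (A / (c * (D1 * D2))).
  move=> c0; rewrite !invfM; transitivity (A * T * (X^-1 * D1^-1 * D2^-1) * (c / c)).
    by rewrite divff // mulr1.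
  by ring.
apply: cancel_pole; rewrite expf_neq0 // -poles_lift -poles0.
by rewrite (inj_eq pi).
Qed.

End Poles.


(** * The logarithm of the integrand; continuity with x and tau moving along one filter *)

Section Integrand.
Variables (R : realType) (n m : nat) (t : n.-tuple (CC R)).
Variables (s : CC R) (k : 'I_n.+2 -> CC R).
Local Notation p := (poles t).
Local Notation alpha := (s - \sum_i k i).
Local Notation beta := (s + \sum_i k i).
Implicit Types (x : 'rV[CC R]_m) (q : 'rV[CC R]_n.+1).

Definition qhom q (j : 'I_n.+2) : CC R := if unlift ord0 j is Some i then q 0 i else 1.

Lemma qhom0 q : qhom q ord0 = 1.
Proof. by rewrite /qhom unlift_none. Qed.
Lemma qhom_lift q i : qhom q (lift ord0 i) = q 0 i.
Proof. by rewrite /qhom liftK. Qed.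

Lemma uqsumE x q : uqsum t x q = \sum_j uhom t j x / qhom q j.
Proof.
rewrite big_ord_recl uhom0 qhom0 divr1; congr (_ + _).
by apply: eq_bigr => i _; rewrite uhom_lift qhom_lift.
Qed.

Definition zvar x q (j : 'I_n.+2) : CC R := uhom t j x / (qhom q j * uqsum t x q).

Definition yvar x q (j : 'I_n.+2) : CC R := beta * zvar x q j - k j.

Definition kappa x q (a : 'I_m) : CC R := \sum_j yvar x q j / (x 0 a - p j).

(* [d_b kappa_a + kappa_a kappa_b] *)
Definition kappa2 x q (a b : 'I_m) : CC R := kappa x q a * kappa x q b
  + \sum_j (beta * zvar x q j * ((x 0 b - p j)^-1 - \sum_i zvar x q i / (x 0 b - p i))
              / (x 0 a - p j)
            - (a == b)%:R * (yvar x q j / (x 0 a - p j) ^+ 2)).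

Lemma sum_zvar x q : uqsum t x q != 0 -> \sum_j zvar x q j = 1.
Proof.
move=> B0; rewrite -(divff B0) {1}uqsumE mulr_suml; apply: eq_bigr => j _.
by rewrite /zvar invfM mulrA.
Qed.

Lemma sum_yvar x q : uqsum t x q != 0 -> \sum_j yvar x q j = s.
Proof. by move=> B0; rewrite sumrB -mulr_sumr sum_zvar // mulr1 addrK. Qed.

Definition log_integrand (lX : CC R) (lU lQ : 'I_n.+1 -> CC R) (lA lB : CC R) : CC R :=
  s * lX + \sum_j (- k (lift ord0 j) * lU j + (2 * k (lift ord0 j) - 1) * lQ j)
  + alpha * lA + beta * lB.

Lemma integrandE lX lU lQ lA lB :
  integrand s k lX lU lQ lA lB = Cexp (log_integrand lX lU lQ lA lB).
Proof.
rewrite /integrand /cpow !CexpD Cexp_sum; congr (_ * _ * _ * _).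
by apply: eq_bigr => j _; rewrite CexpD.
Qed.

Variables (U : set 'rV[CC R]_m) (lX : 'rV[CC R]_m -> CC R).
Variables (lU : 'I_n.+1 -> 'rV[CC R]_m -> CC R) (c : twisted_cube R n m).
Hypothesis pi : injective p.
Hypothesis hU : open U.
Hypothesis hlX : log_branch U (@coordinates_product R m) lX.
Hypothesis hlU : forall j, log_branch U (uvar t j) (lU j).
Hypothesis hc : tc_valid t U c.
Local Notation qq := (tc_map c).
Local Notation K := (tc_integrand s k lX lU c).
Local Notation cube := (@unit_cube R n.+1).

Lemma tc_logq_exp j tau : cube tau -> Cexp (tc_logq c j tau) = qq tau 0 j.
Proof. by have [_ h _ _] := hc; exact: (h j).2. Qed.
Lemma tc_logA_exp tau : cube tau -> Cexp (tc_logA c tau) = qsum (qq tau).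
Proof. by have [_ _ [_ h] _] := hc; exact: h. Qed.
Lemma tc_logB_exp x tau : U x -> cube tau ->
  Cexp (tc_logB c (x, tau)) = uqsum t x (qq tau).
Proof. by move=> Ux ht; have [_ _ _ [_ h]] := hc; exact: (h (x, tau)). Qed.

Lemma q_neq0 tau j : cube tau -> qq tau 0 j != 0.
Proof. by move=> ht; rewrite -tc_logq_exp // Cexp_neq0. Qed.
Lemma qhom_neq0 tau j : cube tau -> qhom (qq tau) j != 0.
Proof.
move=> ht; have [i ->|->] := unliftP ord0 j; first by rewrite qhom_lift q_neq0.
by rewrite qhom0 oner_neq0.
Qed.
Lemma qsum_neq0 tau : cube tau -> qsum (qq tau) != 0.
Proof. by move=> ht; rewrite -tc_logA_exp // Cexp_neq0. Qed.
Lemma uqsum_neq0 x tau : U x -> cube tau -> uqsum t x (qq tau) != 0.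
Proof. by move=> Ux ht; rewrite -tc_logB_exp // Cexp_neq0. Qed.

Lemma uhom_neq0 x j : U x -> uhom t j x != 0.
Proof.
move=> Ux; have [i ->|->] := unliftP ord0 j.
  by rewrite uhom_lift -(hlU i).2 // Cexp_neq0.
by rewrite uhom0 oner_neq0.
Qed.
Lemma coordinates_neq0 x : U x -> coordinates_product x != 0.
Proof. by move=> Ux; rewrite -hlX.2 // Cexp_neq0. Qed.
(** A value that has a logarithm is non-zero, and by [uhomE] the factor x_l - p_j divides u_j; so
    the existence of the branches keeps U away from the poles. *)
Lemma coord_neq_pole x l j : U x -> x 0 l != p j.
Proof.
move=> Ux; have := uhom_neq0 j Ux; rewrite uhomE //; last exact: coordinates_neq0.
apply: contraNneq => e; rewrite [\prod_l _](bigD1 l) //= e subrr.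
by rewrite !(mul0r, mulr0).
Qed.

Section Continuity.
Variables (W : Type) (F : set_system W).
Context {FF : Filter F}.
Variables (X : W -> 'rV[CC R]_m) (T : W -> 'rV[R]_n.+1) (x : 'rV[CC R]_m) (tau : 'rV[R]_n.+1).
Hypotheses (Ux : U x) (ht : cube tau) (hX : X @ F --> x) (hT : T @ F --> tau).
Hypothesis hTc : \forall w \near F, cube (T w).

Lemma near_U : \forall w \near F, U (X w).
Proof. by apply: hX; exact: open_nbhs_nbhs. Qed.

(** Continuity is read off the exponential of the continuous branch of the logarithm; [cvg_uhom]
    uses the same device. *)
Lemma cvg_q j : (fun w => qq (T w) 0 j) @ F --> qq tau 0 j.
Proof.
have [_ /(_ j) [cl le] _ _] := hc.
rewrite -le //; apply: eq_near_cvg (Cexp_cvg (within_comp_cvg cl ht hT hTc)).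
by move: hTc; apply: filterS => w hw; rewrite le.
Qed.

Lemma cvg_qhom j : (fun w => qhom (qq (T w)) j) @ F --> qhom (qq tau) j.
Proof.
have [i ->|->] := unliftP ord0 j.
  by rewrite qhom_lift; under eq_fun do rewrite qhom_lift; exact: cvg_q.
by rewrite qhom0; under eq_fun do rewrite qhom0; exact: cvg_cst.
Qed.

Lemma cvg_qsum : (fun w => qsum (qq (T w))) @ F --> qsum (qq tau).
Proof.
rewrite /qsum; apply: cvgD; first exact: cvg_cst.
by apply: cvg_bigsum => j _; exact: cvg_q.
Qed.

Lemma cvg_uhom j : (fun w => uhom t j (X w)) @ F --> uhom t j x.
Proof.
have [i ->|->] := unliftP ord0 j; last first.
  by rewrite uhom0; under eq_fun do rewrite uhom0; exact: cvg_cst.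
have [cl le] := hlU i; rewrite uhom_lift -le //.
apply: eq_near_cvg (Cexp_cvg (within_comp_cvg cl Ux hX near_U)).
by move: near_U; apply: filterS => w hw; rewrite uhom_lift le.
Qed.

Lemma cvg_uqsum : (fun w => uqsum t (X w) (qq (T w))) @ F --> uqsum t x (qq tau).
Proof.
rewrite uqsumE; under eq_fun do rewrite uqsumE.
apply: cvg_bigsum => j _.
exact: (cvgM (@cvg_uhom j) (cvgV (qhom_neq0 j ht) (@cvg_qhom j))).
Qed.

Lemma cvg_zvar j : (fun w => zvar (X w) (qq (T w)) j) @ F --> zvar x (qq tau) j.
Proof.
have n0 : qhom (qq tau) j * uqsum t x (qq tau) != 0.
  by rewrite mulf_neq0 ?qhom_neq0 ?uqsum_neq0.
exact: (cvgM (@cvg_uhom j) (cvgV n0 (cvgM (@cvg_qhom j) cvg_uqsum))).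
Qed.

Lemma cvg_yvar j : (fun w => yvar (X w) (qq (T w)) j) @ F --> yvar x (qq tau) j.
Proof.
exact: (cvgB (cvgM (cvg_cst _) (@cvg_zvar j)) (cvg_cst _)).
Qed.

Lemma cvg_pole a j : (fun w => (X w 0 a - p j)^-1) @ F --> (x 0 a - p j)^-1.
Proof.
have n0 : x 0 a - p j != 0 by rewrite subr_eq0 coord_neq_pole.
exact: (cvgV n0 (cvgB (cvg_coord (j := a) hX) (cvg_cst _))).
Qed.

Lemma cvg_kappa a : (fun w => kappa (X w) (qq (T w)) a) @ F --> kappa x (qq tau) a.
Proof.
apply: cvg_bigsum => j _; exact: (cvgM (@cvg_yvar j) (@cvg_pole a j)).
Qed.

Lemma cvg_kappa2 a b :
  (fun w => kappa2 (X w) (qq (T w)) a b) @ F --> kappa2 x (qq tau) a b.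
Proof.
rewrite /kappa2; under eq_fun do (under eq_bigr do rewrite expr2 invfM).
under eq_bigr do rewrite expr2 invfM.
have k1 : (fun w => \sum_i zvar (X w) (qq (T w)) i / (X w 0 b - p i)) @ F -->
   \sum_i zvar x (qq tau) i / (x 0 b - p i).
  by apply: cvg_bigsum => i _; exact: (cvgM (@cvg_zvar i) (@cvg_pole b i)).
apply: (cvgD (cvgM (@cvg_kappa a) (@cvg_kappa b)) _).
apply: cvg_bigsum => j _.
pose proof (cvgM (cvgM (cvgM (cvg_cst beta) (@cvg_zvar j)) (cvgB (@cvg_pole b j) k1))
  (@cvg_pole a j)) as k2.
pose proof (cvgM (@cvg_yvar j) (cvgM (@cvg_pole a j) (@cvg_pole a j))) as k3.
exact (cvgB k2 (cvgM (cvg_cst _) k3)).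
Qed.

Lemma cvg_integrand : (fun w => K (X w) (T w)) @ F --> K x tau.
Proof.
have [_ hQ [cA _] [cB _]] := hc.
rewrite /tc_integrand integrandE; under eq_fun do rewrite integrandE.
apply: Cexp_cvg; rewrite /log_integrand.
pose proof (within_comp_cvg hlX.1 Ux hX near_U) as k1.
pose proof (within_comp_cvg cA ht hT hTc) as k2.
have k3 : (fun w => tc_logB c (X w, T w)) @ F --> tc_logB c (x, tau).
  apply: (within_comp_cvg (g := fun w => (X w, T w)) (x := (x, tau)) cB) => //.
    exact (cvg_pair hX hT).
  by move: near_U hTc; apply: filterS2.
have k4 j : (fun w => lU j (X w)) @ F --> lU j x.
  exact: (within_comp_cvg (hlU j).1 Ux hX near_U).
have k5 j : (fun w => tc_logq c j (T w)) @ F --> tc_logq c j tau.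
  exact: (within_comp_cvg (hQ j).1 ht hT hTc).
have k6 : (fun w => \sum_j (- k (lift ord0 j) * lU j (X w) +
    (2 * k (lift ord0 j) - 1) * tc_logq c j (T w))) @ F -->
  \sum_j (- k (lift ord0 j) * lU j x + (2 * k (lift ord0 j) - 1) * tc_logq c j tau).
  apply: cvg_bigsum => j _.
  exact (cvgD (cvgM (cvg_cst _) (@k4 j)) (cvgM (cvg_cst _) (@k5 j))).
exact (cvgD (cvgD (cvgD (cvgM (cvg_cst _) k1) k6) (cvgM (cvg_cst _) k2))
   (cvgM (cvg_cst _) k3)).
Qed.

End Continuity.

End Integrand.


(** * Derivatives of the integrand in the coordinates of x *)

Section CoordinateDerivatives.
Variables (R : realType) (n m : nat) (t : n.-tuple (CC R)).
Variables (s : CC R) (k : 'I_n.+2 -> CC R).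
Local Notation p := (poles t).
Local Notation alpha := (s - \sum_i k i).
Local Notation beta := (s + \sum_i k i).
Variables (U : set 'rV[CC R]_m) (lX : 'rV[CC R]_m -> CC R).
Variables (lU : 'I_n.+1 -> 'rV[CC R]_m -> CC R) (c : twisted_cube R n m).
Hypothesis pi : injective p.
Hypothesis hU : open U.
Hypothesis hlX : log_branch U (@coordinates_product R m) lX.
Hypothesis hlU : forall j, log_branch U (uvar t j) (lU j).
Hypothesis hc : tc_valid t U c.
Variables (x : 'rV[CC R]_m) (b : 'I_m) (tau : 'rV[R]_n.+1).
Hypotheses (Ux : U x) (ht : unit_cube tau).
Local Notation q := (tc_map c tau).
Local Notation K := (tc_integrand s k lX lU c).
Local Notation X := (fun h : CC R => x + h *: delta_mx 0 b).
Local Notation D := (der (0 : CC R)^' id).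
Local Notation r_ a j := ((x 0 a - p j)^-1).

Lemma id_dnbhs0 : (id : CC R -> CC R) @ (0 : CC R)^' --> (0 : CC R).
Proof. exact: nbhs_dnbhs. Qed.

Lemma id_neq0_near : \forall h \near (0 : CC R)^', id h != 0.
Proof. exact: nbhs_dnbhs_neq. Qed.

Let e0 := id_dnbhs0.
Let en0 := id_neq0_near.

Let xb0 : x 0 b != 0.
Proof. exact: (coord_neq_pole pi hlX hlU b ord0 Ux). Qed.
Let xbp j : x 0 b - p j != 0.
Proof. by rewrite subr_eq0 (coord_neq_pole pi hlX hlU). Qed.

Lemma coord_lineE h l : X h 0 l = x 0 l + (l == b)%:R * h.
Proof. by rewrite !mxE eqxx /= mulrC. Qed.

Lemma der_coord l z : D (fun h => X h 0 l - z) (x 0 l - z) (l == b)%:R.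
Proof.
have c1 : (fun=> (l == b)%:R : CC R) @ (0 : CC R)^' --> ((l == b)%:R : CC R).
  exact: cvg_cst.
apply: eq_near_cvg c1; move: en0; apply: filterS => h h0.
rewrite (_ : _ - _ = (l == b)%:R * h); first by rewrite mulfK.
by rewrite coord_lineE; ring.
Qed.

Lemma line_cvg : X @ (0 : CC R)^' --> x.
Proof.
apply: cvg_row => l.
have -> : (fun h => X h 0 l) = (fun h => x 0 l + (l == b)%:R * h).
  by apply/funext => h; rewrite coord_lineE.
pose proof (cvgD (cvg_cst (x 0 l)) (cvgM (cvg_cst ((l == b)%:R : CC R)) e0)) as h.
rewrite mulr0 addr0 in h; exact h.
Qed.

Lemma line_near_U : \forall h \near (0 : CC R)^', U (X h).
Proof. exact (near_U hU Ux line_cvg). Qed.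

Lemma der_prod_pole j :
  D (fun h => \prod_l (X h 0 l - p j)) (\prod_l (x 0 l - p j))
    ((\prod_l (x 0 l - p j)) * r_ b j).
Proof.
have -> : r_ b j = \sum_l (l == b)%:R * r_ l j.
  rewrite (bigD1 b) //= eqxx mul1r big1 ?addr0 // => l /negPf ->.
  by rewrite mul0r.
apply: (der_log_prod e0 en0) => l _.
rewrite (_ : _ * _ = (l == b)%:R); first exact: der_coord.
by rewrite mulrCA divff ?mulr1 // subr_eq0 (coord_neq_pole pi hlX hlU).
Qed.

Lemma der_coordinates :
  D (fun h => coordinates_product (X h)) (coordinates_product x)
    (coordinates_product x * r_ b ord0).
Proof.
have := @der_prod_pole ord0; rewrite poles0.
have E (y : 'rV[CC R]_m) : \prod_l (y 0 l - 0) = coordinates_product y :> CC R.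
  by apply: eq_bigr => l _; rewrite subr0.
rewrite E; apply: der_ext; apply: nearW => h; exact: E.
Qed.

Lemma der_uhom j :
  D (fun h => uhom t j (X h)) (uhom t j x) (uhom t j x * (r_ b j - r_ b ord0)).
Proof.
have x0 := coordinates_neq0 hlX Ux.
pose proof (derM e0 en0 (derM e0 en0 (der_cst id (pole_weight p ord0 ^+ 2))
   (derV e0 en0 x0 der_coordinates)) (derM e0 en0 (@der_prod_pole j)
   (der_cst id (pole_weight p j ^+ 2)^-1))) as d1.
have uE := uhomE j pi x0.
refine (der_eq (der_ext _ d1) (esym uE) _).
  by move: line_near_U; apply: filterS => h hh; rewrite (uhomE j pi (coordinates_neq0 hlX hh)).
have W0 : pole_weight p j != 0.
  by apply/prodf_neq0 => l li; rewrite subr_eq0 (inj_eq pi) eq_sym.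
by rewrite uE; field; rewrite x0 W0 xb0 xbp.
Qed.

Lemma der_uqsum : D (fun h => uqsum t (X h) q) (uqsum t x q)
  (uqsum t x q * \sum_j zvar t x q j * (r_ b j - r_ b ord0)).
Proof.
have B0 := uqsum_neq0 hc Ux ht.
have -> : uqsum t x q * (\sum_j zvar t x q j * (r_ b j - r_ b ord0)) =
   \sum_j (uhom t j x * (r_ b j - r_ b ord0) * (qhom q j)^-1 + uhom t j x * 0).
  rewrite mulr_sumr; apply: eq_bigr => j _; rewrite /zvar mulr0 addr0.
  by field; rewrite B0 (qhom_neq0 hc) // xb0 xbp.
rewrite {1}uqsumE.
pose proof (der_sum (s := index_enum 'I_n.+2) (P := xpredT)
  (fun j _ => derM e0 en0 (@der_uhom j) (der_cst id (qhom q j)^-1))) as d1.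
by apply: der_ext d1; apply: nearW => h; rewrite uqsumE.
Qed.

Lemma der_zvar j : D (fun h => zvar t (X h) q j) (zvar t x q j)
  (zvar t x q j * (r_ b j - \sum_i zvar t x q i / (x 0 b - p i))).
Proof.
have B0 := uqsum_neq0 hc Ux ht.
have q0 : qhom q j != 0 by exact: (qhom_neq0 hc).
(* As the z_i add up to 1, the terms in 1 / x_b from B merge into a single one, which cancels the
   one from u_j. *)
have S : \sum_i zvar t x q i * (r_ b i - r_ b ord0) =
   \sum_i zvar t x q i / (x 0 b - p i) - r_ b ord0.
  rewrite -[X in _ = _ - X]mul1r -(sum_zvar B0) mulr_suml -sumrB.
  by apply: eq_bigr => i _; rewrite mulrBr.
have n0 : qhom q j * uqsum t x q != 0 by rewrite mulf_neq0.
pose proof (derM e0 en0 (@der_uhom j)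
  (derV e0 en0 n0 (derM e0 en0 (der_cst id (qhom q j)) der_uqsum))) as d1.
refine (der_eq d1 (erefl _) _).
by rewrite S /zvar; field; rewrite q0 B0 xb0 xbp.
Qed.

Lemma der_pole a j : D (fun h => (X h 0 a - p j)^-1) (r_ a j)
  (- (a == b)%:R / (x 0 a - p j) ^+ 2).
Proof.
apply: (derV e0 en0) (@der_coord a _).
by rewrite subr_eq0 (coord_neq_pole pi hlX hlU).
Qed.

Lemma der_kappa a : D (fun h => kappa t s k (X h) q a) (kappa t s k x q a)
  (\sum_j (beta * zvar t x q j * (r_ b j - \sum_i zvar t x q i / (x 0 b - p i))
              / (x 0 a - p j)
            - (a == b)%:R * (yvar t s k x q j / (x 0 a - p j) ^+ 2))).
Proof.
apply: (der_sum) => j _.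
pose proof (derM e0 en0 (derB e0 en0 (derZ (c := beta) e0 en0 (@der_zvar j))
  (der_cst id (k j))) (@der_pole a j)) as d1.
refine (der_eq d1 (erefl _) _).
by rewrite subr0 /yvar expr2 invfM; ring.
Qed.

(** The powers of x_1 ... x_m, of the u_j and of B contribute s, the sum of the k's and - beta to
    the coefficient of 1 / x_b beyond the term of [kappa] at the pole 0. These add up to 0: the
    exponent beta of B is exactly what this requires. *)
Lemma der_integrand : D (fun h => K (X h) tau) (K x tau) (K x tau * kappa t s k x q b).
Proof.
have x0 := coordinates_neq0 hlX Ux.
have B0 := uqsum_neq0 hc Ux ht.
have u0 j := uhom_neq0 hlU j Ux.
have dX : D (fun h => lX (X h)) (lX x) (r_ b ord0).
  refine (der_eq (der_log en0 (within_comp_cvg hlX.1 Ux line_cvg line_near_U) _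
    (hlX.2 _ Ux) der_coordinates) (erefl _) _).
    by move: line_near_U; apply: filterS => h hh; exact: hlX.2.
  by rewrite mulrAC divff // mul1r.
have dU j : D (fun h => lU j (X h)) (lU j x) (r_ b (lift ord0 j) - r_ b ord0).
  pose proof (@der_uhom (lift ord0 j)) as d1; rewrite uhom_lift in d1.
  refine (der_eq (der_log en0 (within_comp_cvg (hlU j).1 Ux line_cvg line_near_U) _
    ((hlU j).2 _ Ux) d1) (erefl _) _).
    by move: line_near_U; apply: filterS => h hh; rewrite uhom_lift; exact: (hlU j).2.
  by rewrite -uhom_lift mulrAC divff // mul1r.
have dB : D (fun h => tc_logB c (X h, tau)) (tc_logB c (x, tau))
    (\sum_j zvar t x q j * (r_ b j - r_ b ord0)).
  have [_ _ _ [cB _]] := hc.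
  have lc : (fun h => tc_logB c (X h, tau)) @ (0 : CC R)^' --> tc_logB c (x, tau).
    apply: (within_comp_cvg (g := fun h => (X h, tau)) (x := (x, tau)) cB) => //.
      exact (cvg_pair line_cvg (cvg_cst tau)).
    by move: line_near_U; apply: filterS.
  refine (der_eq (der_log en0 lc _ (tc_logB_exp hc Ux ht) der_uqsum) (erefl _) _).
    by move: line_near_U; apply: filterS => h hh; exact: (tc_logB_exp hc).
  by rewrite mulrAC divff // mul1r.
pose proof (der_Cexp e0 en0 (derD (derD (derD
  (derZ (c := s) e0 en0 dX)
  (der_sum (s := index_enum 'I_n.+1) (P := xpredT) (fun j _ => derD
     (derZ (c := - k (lift ord0 j)) e0 en0 (dU j))
     (der_cst id ((2 * k (lift ord0 j) - 1) * tc_logq c j tau)))))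
  (der_cst id (alpha * tc_logA c tau))) (derZ (c := beta) e0 en0 dB))) as d1.
rewrite /tc_integrand integrandE.
rewrite (_ : (fun h => integrand _ _ _ _ _ _ _) = (fun h => Cexp (log_integrand s k (lX (X h))
  (fun j => lU j (X h)) (fun j => tc_logq c j tau) (tc_logA c tau)
  (tc_logB c (X h, tau))))); last by apply/funext => h; rewrite integrandE.
refine (der_eq d1 (erefl _) _); congr (_ * _).
rewrite addr0; under eq_bigr do rewrite addr0.
have -> : \sum_j zvar t x q j * (r_ b j - r_ b ord0) =
   \sum_j zvar t x q j * r_ b j - r_ b ord0.
  rewrite -[X in _ = _ - X]mul1r -(sum_zvar B0) mulr_suml -sumrB.
  by apply: eq_bigr => i _; rewrite mulrBr.
have -> : kappa t s k x q b = beta * (\sum_j zvar t x q j * r_ b j) - \sum_j k j * r_ b j.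
  by rewrite mulr_sumr -sumrB; apply: eq_bigr => j _; rewrite /yvar mulrBl mulrA.
have -> : \sum_(j < n.+1) - k (lift ord0 j) * (r_ b (lift ord0 j) - r_ b ord0) =
    (\sum_j k j) * r_ b ord0 - \sum_j k j * r_ b j.
  rewrite mulr_suml -sumrB [RHS]big_ord_recl /= subrr add0r.
  by apply: eq_bigr => j _; ring.
by ring.
Qed.

Lemma der_integrand_kappa a :
  D (fun h => K (X h) tau * kappa t s k (X h) q a) (K x tau * kappa t s k x q a)
    (K x tau * kappa2 t s k x q a b).
Proof.
pose proof (derM e0 en0 der_integrand (@der_kappa a)) as d1.
refine (der_eq d1 (erefl _) _).
by rewrite /kappa2; ring.
Qed.

End CoordinateDerivatives.


(** * Integration over a chain, as a functional of the integrand *)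

Section Pairing.
Variables (R : realType) (n m : nat) (t : n.-tuple (CC R)).
Variable U : set 'rV[CC R]_m.
Hypothesis hU : open U.
Local Notation cube := (@unit_cube R n.+1).
Local Notation D := (der (0 : CC R)^' id).
Implicit Types (c : twisted_cube R n m) (x : 'rV[CC R]_m).

Definition tc_jmx c (tau : 'rV[R]_n.+1) : 'M[CC R]_n.+1 :=
  \matrix_(a < n.+1, b < n.+1)
    ('D_(delta_mx 0 a) (fun v => complex.Re (tc_map c v 0 b)) tau
     +i* 'D_(delta_mx 0 a) (fun v => complex.Im (tc_map c v 0 b)) tau)%C.

Lemma cvg_jmx (W : Type) (F : set_system W) {FF : Filter F} (T : W -> 'rV[R]_n.+1) tau c
    a b : tc_valid t U c -> T @ F --> tau ->
  (fun w => tc_jmx c (T w) a b) @ F --> tc_jmx c tau a b.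
Proof.
move=> [hC2 _ _ _] hT; have [[c1 _] [c2 _]] := hC2 b.
rewrite mxE; under eq_fun do rewrite mxE.
apply/cvgCP; split=> /=.
  exact (cvg_comp _ _ hT ((c1 a).2 tau)).
exact (cvg_comp _ _ hT ((c2 a).2 tau)).
Qed.

Lemma cvg_jacobian (W : Type) (F : set_system W) {FF : Filter F} (T : W -> 'rV[R]_n.+1)
    tau c : tc_valid t U c -> T @ F --> tau ->
  (fun w => tc_jacobian c (T w)) @ F --> tc_jacobian c tau.
Proof.
move=> hc hT; rewrite /tc_jacobian /determinant.
apply: cvg_bigsum => i _; apply: cvgM; first exact: cvg_cst.
by apply: cvg_bigprod => a _; exact: cvg_jmx.
Qed.

Definition jointly_continuous (g : twisted_cube R n m -> 'rV[CC R]_m -> 'rV[R]_n.+1 -> CC R) :=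
  forall c, tc_valid t U c ->
  {within U `*` cube, continuous (fun z : 'rV[CC R]_m * 'rV[R]_n.+1 => g c z.1 z.2)}.

Lemma jointly_continuousP (g : twisted_cube R n m -> 'rV[CC R]_m -> 'rV[R]_n.+1 -> CC R) :
  (forall c (W : Type) (F : set_system W) (FF : Filter F) (X : W -> 'rV[CC R]_m)
     (T : W -> 'rV[R]_n.+1) (x : 'rV[CC R]_m) (tau : 'rV[R]_n.+1),
     tc_valid t U c -> U x -> cube tau -> X @ F --> x -> T @ F --> tau ->
     (\forall w \near F, cube (T w)) -> (fun w : W => g c (X w) (T w)) @ F --> g c x tau) ->
  jointly_continuous g.
Proof.
move=> h c hc; apply/within_continuousP => -[x tau] [/= Ux ht].
pose proof (@within_id_cvg _ (U `*` cube) (x, tau)) as idc.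
apply: h => //.
- exact (cvg_comp _ _ idc cvg_fst).
- exact (cvg_comp _ _ idc cvg_snd).
- by apply: filterS (withinT _ _) => -[? ?] [].
Qed.

Lemma jointly_continuous_slice
    (g : twisted_cube R n m -> 'rV[CC R]_m -> 'rV[R]_n.+1 -> CC R) c x :
  jointly_continuous g -> tc_valid t U c -> U x ->
  {within cube, continuous (g c x)}.
Proof.
move=> hg hc Ux; apply/within_continuousP => tau ht.
pose proof (@within_id_cvg _ cube tau) as idc.
apply: (within_comp_cvg (g := fun v => (x, v)) (x := (x, tau)) (hg c hc)) => //.
  exact (cvg_pair (cvg_cst x) idc).
by apply: filterS (withinT _ _).
Qed.

(** [Kn] at x is by unfolding the pairing of Z with K. With the integrand as an argument,
    differential operators in x become operations on integrands, and identities may be checked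
    pointwise on each cube. *)
Definition pairing (Z : seq (twisted_cube R n m))
    (g : twisted_cube R n m -> 'rV[R]_n.+1 -> CC R) : CC R :=
  \sum_(c <- Z) tc_coef c * cube_int (fun tau => g c tau * tc_jacobian c tau).

Lemma jacobian_within c : tc_valid t U c -> {within cube, continuous (tc_jacobian c)}.
Proof.
move=> hc; apply/within_continuousP => tau ht.
exact (cvg_jacobian hc (@within_id_cvg _ cube tau)).
Qed.

Variable Z : seq (twisted_cube R n m).
Hypothesis hZ : forall l : 'I_(size Z), tc_valid t U (tnth (in_tuple Z) l).

Lemma eq_pairing (g h : twisted_cube R n m -> 'rV[R]_n.+1 -> CC R) :
  (forall c tau, tc_valid t U c -> cube tau -> g c tau = h c tau) ->
  pairing Z g = pairing Z h.
Proof.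
(* Validity of the cubes is indexed by their position in Z, hence sums over positions. *)
move=> gh; rewrite /pairing [LHS]big_tnth [RHS]big_tnth; apply: eq_bigr => l _; congr (_ * _).
by apply: eq_cube_int => tau ht; rewrite gh.
Qed.

Lemma pairingZ (a : CC R) (g : twisted_cube R n m -> 'rV[R]_n.+1 -> CC R) :
  (forall c, tc_valid t U c -> {within cube, continuous (g c)}) ->
  pairing Z (fun c tau => a * g c tau) = a * pairing Z g.
Proof.
move=> cg; rewrite /pairing mulr_sumr [LHS]big_tnth [RHS]big_tnth; apply: eq_bigr => l _.
rewrite mulrCA; congr (_ * _); rewrite -cube_intZ.
  by apply: eq_cube_int => tau _; rewrite mulrA.
by move=> v; apply: cvgM; [exact: cg|exact: jacobian_within].
Qed.

Lemma pairing_sum (I : Type) (r : seq I) (g : I -> twisted_cube R n m -> 'rV[R]_n.+1 -> CC R) :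
  (forall i c, tc_valid t U c -> {within cube, continuous (g i c)}) ->
  pairing Z (fun c tau => \sum_(i <- r) g i c tau) = \sum_(i <- r) pairing Z (g i).
Proof.
move=> cg; rewrite /pairing [RHS]exchange_big [LHS]big_tnth [RHS]big_tnth; apply: eq_bigr => l _.
rewrite -mulr_sumr; congr (_ * _); set c := tnth _ l.
have hc : tc_valid t U c := hZ l.
transitivity (cube_int (fun v => \sum_(i <- r) g i c v * tc_jacobian c v)).
  by apply: eq_cube_int => tau _; rewrite mulr_suml.
apply: (cube_int_sum r (P := xpredT) (f := fun i v => g i c v * tc_jacobian c v)).
by move=> i _ v; apply: cvgM; [exact: cg|exact: jacobian_within].
Qed.

Lemma cvg_line (W : Type) (F : set_system W) {FF : Filter F} (h : W -> CC R) x (b : 'I_m) :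
  h @ F --> (0 : CC R) -> (fun w => x + h w *: delta_mx 0 b) @ F --> x.
Proof.
move=> h0; apply: cvg_row => l.
have -> : (fun w => (x + h w *: delta_mx 0 b) 0 l) = (fun w => x 0 l + (l == b)%:R * h w).
  by apply/funext => w; rewrite coord_lineE.
pose proof (cvgD (cvg_cst (x 0 l)) (cvgM (cvg_cst ((l == b)%:R : CC R)) h0)) as k1.
by rewrite mulr0 addr0 in k1; exact k1.
Qed.

(** Joint continuity of g' on the product of U and the cube provides the uniformity that
    [cube_int_der] asks for; U being open keeps x + h e_b inside for small h. *)
Lemma pairing_der (g g' : twisted_cube R n m -> 'rV[CC R]_m -> 'rV[R]_n.+1 -> CC R)
    x (b : 'I_m) : U x ->
  jointly_continuous g -> jointly_continuous g' ->
  (forall c x tau, tc_valid t U c -> U x -> cube tau ->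
     D (fun h => g c (x + h *: delta_mx 0 b) tau) (g c x tau) (g' c x tau)) ->
  D (fun h => pairing Z (fun c => g c (x + h *: delta_mx 0 b)))
    (pairing Z (fun c => g c x)) (pairing Z (fun c => g' c x)).
Proof.
move=> Ux cg cg' dg; rewrite /pairing.
rewrite big_tnth [in X in D _ _ X]big_tnth.
rewrite [X in D X _ _](_ : _ = fun h => \sum_(l < size Z) tc_coef (tnth (in_tuple Z) l) *
   cube_int (fun tau => g (tnth (in_tuple Z) l) (x + h *: delta_mx 0 b) tau *
      tc_jacobian (tnth (in_tuple Z) l) tau)); last first.
  by apply/funext => h; rewrite big_tnth.
apply: der_sum => l _; set c := tnth _ l; have hc : tc_valid t U c := hZ l.
refine (derZ (@id_dnbhs0 R) (@id_neq0_near R) _).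
have idc : (fun h : CC R => h) @ nbhs (0 : CC R) --> (0 : CC R) by exact: cvg_id.
have nU : \forall h \near (0 : CC R), U (x + h *: delta_mx 0 b).
  by apply: (cvg_line (x := x) b idc); exact: open_nbhs_nbhs.
have slice (f : twisted_cube R n m -> 'rV[CC R]_m -> 'rV[R]_n.+1 -> CC R) y :
    jointly_continuous f -> U y ->
    {within cube, continuous (fun tau => f c y tau * tc_jacobian c tau)}.
  by move=> cf Uy v; apply: cvgM; [exact: (jointly_continuous_slice cf hc Uy)|
    exact: jacobian_within].
have x0 : x + 0 *: delta_mx 0 b = x by rewrite scale0r addr0.
have main := @cube_int_der R n.+1
  (fun h tau => g c (x + h *: delta_mx 0 b) tau * tc_jacobian c tau)
  (fun h tau => g' c (x + h *: delta_mx 0 b) tau * tc_jacobian c tau).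
rewrite x0 in main; apply: main.
- move: nU; apply: filterS => h hh tau ht.
  have d1 : D (fun k0 => g c (x + (h + k0) *: delta_mx 0 b) tau)
      (g c (x + h *: delta_mx 0 b) tau) (g' c (x + h *: delta_mx 0 b) tau).
    apply: der_ext (dg c _ tau hc hh ht); apply: nearW => k0.
    by rewrite scalerDl addrA.
  refine (der_eq (derM (@id_dnbhs0 R) (@id_neq0_near R) d1
    (der_cst id (tc_jacobian c tau))) (erefl _) _).
  by rewrite mulr0 addr0.
- by move: nU; apply: filterS => h hh; exact: slice.
- exact: slice.
- move=> v hv.
  have p1 : (fun z : 'rV[R]_n.+1 * CC R => x + z.2 *: delta_mx 0 b) @
     (within cube (nbhs v), nbhs (0 : CC R)) --> x.
    by apply: cvg_line; exact: cvg_snd.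
  have p2 : (fun z : 'rV[R]_n.+1 * CC R => z.1) @
     (within cube (nbhs v), nbhs (0 : CC R)) --> v.
    exact (cvg_comp _ _ cvg_fst (@within_id_cvg _ cube v)).
  have k1 : (fun z : 'rV[R]_n.+1 * CC R => g' c (x + z.2 *: delta_mx 0 b) z.1) @
     (within cube (nbhs v), nbhs (0 : CC R)) --> g' c x v.
    apply: (within_comp_cvg (g := fun z => (x + z.2 *: delta_mx 0 b, z.1)) (x := (x, v))
      (cg' c hc)) => //.
      exact (cvg_pair p1 p2).
    exists (cube, [set h | U (x + h *: delta_mx 0 b)]) => /=.
      by split; [exact: withinT|exact: nU].
    by move=> [w h] [].
  have k2 : (fun z : 'rV[R]_n.+1 * CC R => tc_jacobian c z.1) @
     (within cube (nbhs v), nbhs (0 : CC R)) --> tc_jacobian c v.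
    exact (cvg_jacobian hc p2).
  exact (cvgM k1 k2).
Qed.

End Pairing.


(** * The operators M, D and L applied to the integral *)

Section OperatorsOnIntegral.
Variables (R : realType) (n m : nat) (t : n.-tuple (CC R)).
Variables (s : CC R) (k : 'I_n.+2 -> CC R).
Local Notation p := (poles t).
Local Notation beta := (s + \sum_i k i).
Variables (U : set 'rV[CC R]_m) (lX : 'rV[CC R]_m -> CC R).
Variables (lU : 'I_n.+1 -> 'rV[CC R]_m -> CC R).
Hypothesis pi : injective p.
Hypothesis hU : open U.
Hypothesis hlX : log_branch U (@coordinates_product R m) lX.
Hypothesis hlU : forall j, log_branch U (uvar t j) (lU j).
Variable Z : seq (twisted_cube R n m).
Hypothesis hZ : forall l : 'I_(size Z), tc_valid t U (tnth (in_tuple Z) l).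
Local Notation D := (der (0 : CC R)^' id).
Local Notation K := (tc_integrand s k lX lU).
Local Notation cube := (@unit_cube R n.+1).
Implicit Types (x : 'rV[CC R]_m) (c : twisted_cube R n m).

Let e0 := @id_dnbhs0 R.
Let en0 := @id_neq0_near R.

Lemma integrand_jcont : jointly_continuous t U (fun c x tau => K c x tau).
Proof.
apply: jointly_continuousP => c W F FF X T x tau hc Ux ht hX hT hTc.
exact (cvg_integrand hU hlX hlU hc Ux ht hX hT hTc).
Qed.

Lemma integrand_kappa_jcont a :
  jointly_continuous t U (fun c x tau => K c x tau * kappa t s k x (tc_map c tau) a).
Proof.
apply: jointly_continuousP => c W F FF X T x tau hc Ux ht hX hT hTc.
exact (cvgM (cvg_integrand hU hlX hlU hc Ux ht hX hT hTc)
  (cvg_kappa (a := a) pi hU hlX hlU hc Ux ht hX hT hTc)).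
Qed.

Lemma integrand_kappa2_jcont a b :
  jointly_continuous t U (fun c x tau => K c x tau * kappa2 t s k x (tc_map c tau) a b).
Proof.
apply: jointly_continuousP => c W F FF X T x tau hc Ux ht hX hT hTc.
exact (cvgM (cvg_integrand hU hlX hlU hc Ux ht hX hT hTc)
  (cvg_kappa2 (a := a) (b := b) pi hU hlX hlU hc Ux ht hX hT hTc)).
Qed.

Lemma Kn_pairing x : Kn s k lX lU Z x = pairing Z (fun c => K c x).
Proof. by []. Qed.

Lemma Kn_derive x a : U x -> is_derive x (delta_mx 0 a) (Kn s k lX lU Z)
  (pairing Z (fun c tau => K c x tau * kappa t s k x (tc_map c tau) a)).
Proof.
move=> Ux; apply/pd_der.
apply: (pairing_der hU hZ (g := fun c x tau => K c x tau)
  (g' := fun c x tau => K c x tau * kappa t s k x (tc_map c tau) a) Ux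
  integrand_jcont (@integrand_kappa_jcont a)).
by move=> c y tau hc Uy ht; exact (der_integrand pi hU hlX hlU hc Uy ht).
Qed.

Lemma pd_Kn_derive x a b : U x -> is_derive x (delta_mx 0 b) (pd a (Kn s k lX lU Z))
  (pairing Z (fun c tau => K c x tau * kappa2 t s k x (tc_map c tau) a b)).
Proof.
move=> Ux; apply/pd_der.
(* The first derivative is known on the whole open set U, hence along the line near x, and can be
   differentiated under the integral once more. *)
have pdE y : U y -> pairing Z (fun c tau => K c y tau * kappa t s k y (tc_map c tau) a)
    = pd a (Kn s k lX lU Z) y.
  by move=> Uy; have [_ <-] := Kn_derive a Uy.
have dk : forall c y tau, tc_valid t U c -> U y -> cube tau ->
    D (fun h => K c (y + h *: delta_mx 0 b) tau * kappa t s k (y + h *: delta_mx 0 b)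
        (tc_map c tau) a) (K c y tau * kappa t s k y (tc_map c tau) a)
      (K c y tau * kappa2 t s k y (tc_map c tau) a b).
  by move=> c y tau hc Uy ht; exact (der_integrand_kappa (a := a) pi hU hlX hlU hc Uy ht).
pose proof (pairing_der hU hZ (g := fun c x tau => K c x tau * kappa t s k x (tc_map c tau) a)
  (g' := fun c x tau => K c x tau * kappa2 t s k x (tc_map c tau) a b) (b := b) Ux
  (@integrand_kappa_jcont a) (@integrand_kappa2_jcont a b) dk) as h.
refine (der_eq (der_ext _ h) (pdE x Ux) (erefl _)).
by move: (line_near_U hU b Ux); apply: filterS => z hz; exact: pdE.
Qed.

Lemma pairing_sumZ (N : nat) (w : 'I_N -> CC R)
    (g : 'I_N -> twisted_cube R n m -> 'rV[R]_n.+1 -> CC R) :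
  (forall i c, tc_valid t U c -> {within cube, continuous (g i c)}) ->
  \sum_(i < N) w i * pairing Z (g i) =
  pairing Z (fun c tau => \sum_(i < N) w i * g i c tau).
Proof.
move=> cg; rewrite (pairing_sum hZ).
  apply: eq_bigr => i _; exact: (esym (pairingZ hZ (w i) (cg i))).
by move=> i c hc; apply: within_cvgZ; exact: cg.
Qed.

Lemma pairingD (g h : twisted_cube R n m -> 'rV[R]_n.+1 -> CC R) :
  (forall c, tc_valid t U c -> {within cube, continuous (g c)}) ->
  (forall c, tc_valid t U c -> {within cube, continuous (h c)}) ->
  pairing Z (fun c tau => g c tau + h c tau) = pairing Z g + pairing Z h.
Proof.
move=> cg ch; rewrite /pairing -big_split [LHS]big_tnth [RHS]big_tnth.
apply: eq_bigr => l _; set c := tnth _ l; have hc : tc_valid t U c := hZ l.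
cbv beta; rewrite -[RHS]mulrDr; congr (_ * _).
have cJ (f : twisted_cube R n m -> 'rV[R]_n.+1 -> CC R) :
    (forall c, tc_valid t U c -> {within cube, continuous (f c)}) ->
    {within cube, continuous (fun tau => f c tau * tc_jacobian c tau)}.
  by move=> cf v; apply: cvgM; [exact: cf|exact: (jacobian_within hc)].
rewrite -(cube_intD (cJ _ cg) (cJ _ ch)).
by apply: eq_cube_int => tau _; rewrite mulrDl.
Qed.

Lemma opM_Kn (I : 'I_n.+2 -> 'I_m) x : U x -> injective (fun a => x 0 (I a)) ->
  opM t s I (Kn s k lX lU Z) x = 0.
Proof.
move=> Ux Ii; rewrite /opM.
under eq_bigr => a _ do rewrite /pd (derive_val (is_derive := Kn_derive (I a) Ux)).
rewrite pairing_sumZ; last first.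
  by move=> i c hc; exact: (jointly_continuous_slice (@integrand_kappa_jcont (I i)) hc Ux).
apply/eqP; rewrite subr_eq0 Kn_pairing -(pairingZ hZ); last first.
  by move=> c hc; exact: (jointly_continuous_slice integrand_jcont hc Ux).
apply/eqP; apply: (eq_pairing hZ) => c tau hc ht.
have xp a j : x 0 (I a) != p j by exact: (coord_neq_pole pi hlX hlU).
have E := etrans (first_order_identity (yvar t s k x (tc_map c tau)) Ii xp)
  (sum_yvar s k (uqsum_neq0 hc Ux ht)).
rewrite -[RHS](congr1 (fun z => z * K c x tau) E) mulr_suml.
by apply: eq_bigr => a _; rewrite mulrCA mulrC.
Qed.

Definition gvar x (q : 'rV[CC R]_n.+1) (j : 'I_n.+2) : CC R :=
  (1 - 2 * k j) * zvar t x q j + (beta - 1) * zvar t x q j ^+ 2.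

Lemma gvar_jcont j :
  jointly_continuous t U (fun c x tau => K c x tau * gvar x (tc_map c tau) j).
Proof.
apply: jointly_continuousP => c W F FF X T x tau hc Ux ht hX hT hTc.
have cz : (fun w => zvar t (X w) (tc_map c (T w)) j) @ F --> zvar t x (tc_map c tau) j.
  exact (cvg_zvar (j := j) hU hlU hc Ux ht hX hT hTc).
have cg : (fun w => gvar (X w) (tc_map c (T w)) j) @ F --> gvar x (tc_map c tau) j.
  exact (cvgD (cvgM (cvg_cst (1 - 2 * k j)) cz) (cvgM (cvg_cst (beta - 1)) (cvgM cz cz))).
exact (cvgM (cvg_integrand hU hlX hlU hc Ux ht hX hT hTc) cg).
Qed.

(** Because y_j = beta z_j - k_j, the coefficient beta z_j - y_j of each double pole is k_j. *)
Lemma kappa2_diag x q a : kappa2 t s k x q a a =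
  (\sum_j yvar t s k x q j / (x 0 a - p j)) ^+ 2 + (\sum_j k j / (x 0 a - p j) ^+ 2)
        - beta * (\sum_j zvar t x q j / (x 0 a - p j)) ^+ 2.
Proof.
rewrite /kappa2 -expr2 -addrA; congr (_ + _).
rewrite expr2 [X in _ = _ - X]mulrA mulr_sumr -sumrB.
apply: eq_bigr => j _; rewrite eqxx /= mul1r /yvar.
by rewrite expr2 invfM; ring.
Qed.

Lemma operator_jcont a : jointly_continuous t U (fun c x tau => K c x tau *
    ((\prod_j (x 0 a - p j)) * (kappa2 t s k x (tc_map c tau) a a
       + (\sum_i (x 0 a - p i)^-1) * (\sum_j yvar t s k x (tc_map c tau) j / (x 0 a - p j)))
     - s * (s + n%:R + 1) * x 0 a ^+ n
     - \sum_j k j ^+ 2 * pole_weight p j / (x 0 a - p j))).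
Proof.
apply: jointly_continuousP => c W F FF X T x tau hc Ux ht hX hT hTc.
pose proof (cvg_integrand (s := s) (k := k) hU hlX hlU hc Ux ht hX hT hTc) as c0.
pose proof (cvg_kappa2 (s := s) (k := k) (a := a) (b := a) pi hU hlX hlU hc Ux ht hX hT hTc)
  as c1.
pose proof (cvg_kappa (s := s) (k := k) (a := a) pi hU hlX hlU hc Ux ht hX hT hTc) as c2.
have r_ : forall j, (fun w => (X w 0 a - p j)^-1) @ F --> (x 0 a - p j)^-1.
  by move=> j; exact (cvg_pole (a := a) (j := j) pi hlX hlU Ux hX).
have x_ : forall j, (fun w => X w 0 a - p j) @ F --> x 0 a - p j.
  by move=> j; exact (cvgB (cvg_coord (j := a) hX) (cvg_cst (p j))).
have c3 : (fun w => \prod_j (X w 0 a - p j)) @ F --> \prod_j (x 0 a - p j).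
  by apply: cvg_bigprod => j _; exact: x_.
have c4 : (fun w => \sum_i (X w 0 a - p i)^-1) @ F --> \sum_i (x 0 a - p i)^-1.
  by apply: cvg_bigsum => j _; exact: r_.
have c5 : (fun w => \sum_j k j ^+ 2 * pole_weight p j / (X w 0 a - p j)) @ F -->
    \sum_j k j ^+ 2 * pole_weight p j / (x 0 a - p j).
  by apply: cvg_bigsum => j _; exact (cvgM (cvg_cst (k j ^+ 2 * pole_weight p j)) (@r_ j)).
have c6 : (fun w => X w 0 a ^+ n) @ F --> x 0 a ^+ n.
  elim: n => [|n' IH]; first by under eq_fun do rewrite expr0; rewrite expr0; exact: cvg_cst.
  under eq_fun do rewrite exprS; rewrite exprS.
  exact (cvgM (cvg_coord (j := a) hX) IH).
exact (cvgM c0 (cvgB (cvgB (cvgM c3 (cvgD c1 (cvgM c4 c2)))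
  (cvgM (cvg_cst (s * (s + n%:R + 1))) c6)) c5)).
Qed.

Lemma opD_Kn a x : U x ->
  opD t s k a (Kn s k lX lU Z) x = pairing Z (fun c tau => K c x tau *
    ((\prod_j (x 0 a - p j)) * (kappa2 t s k x (tc_map c tau) a a
       + (\sum_i (x 0 a - p i)^-1) * (\sum_j yvar t s k x (tc_map c tau) j / (x 0 a - p j)))
     - s * (s + n%:R + 1) * x 0 a ^+ n
     - \sum_j k j ^+ 2 * pole_weight p j / (x 0 a - p j))).
Proof.
move=> Ux; rewrite /opD.
have dP : D (fun h => polyQ t ((x + h *: delta_mx 0 a) 0 a)) (\prod_j (x 0 a - p j))
    ((\prod_j (x 0 a - p j)) * \sum_i (x 0 a - p i)^-1).
  apply: (der_log_prod e0 en0) => j _.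
  refine (der_eq (@der_coord R m x a a (p j)) (erefl _) _).
  by rewrite eqxx divff // subr_eq0 (coord_neq_pole pi hlX hlU).
have pdK : pd a (Kn s k lX lU Z) x =
    pairing Z (fun c tau => K c x tau * kappa t s k x (tc_map c tau) a).
  by have [_] := Kn_derive a Ux.
have d2 := (pd_der _ _ _ _).2 (pd_Kn_derive a a Ux).
pose proof (derM e0 en0 dP d2) as d3.
have [_ dE] := (pd_der (fun y => polyQ t (y 0 a) * pd a (Kn s k lX lU Z) y) a x _).1 d3.
have sK : forall c, tc_valid t U c -> {within cube, continuous (K c x)}.
  by move=> c hc; exact: (jointly_continuous_slice integrand_jcont hc Ux).
have s1 : forall c, tc_valid t U c ->
    {within cube, continuous (fun tau => K c x tau * kappa t s k x (tc_map c tau) a)}.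
  by move=> c hc; exact: (jointly_continuous_slice (@integrand_kappa_jcont a) hc Ux).
have s2 : forall c, tc_valid t U c ->
    {within cube, continuous (fun tau => K c x tau * kappa2 t s k x (tc_map c tau) a a)}.
  by move=> c hc; exact: (jointly_continuous_slice (@integrand_kappa2_jcont a a) hc Ux).
rewrite [pd a _ x]dE pdK Kn_pairing.
set w1 := (\prod_j (x 0 a - p j) * \sum_i (x 0 a - p i)^-1).
set w2 := (\prod_j (x 0 a - p j)).
set A := s * (s + n%:R + 1) * x 0 a ^+ n.
set B := (\sum_(j < n.+2) _).
transitivity (w1 * pairing Z (fun c tau => K c x tau * kappa t s k x (tc_map c tau) a)
  + w2 * pairing Z (fun c tau => K c x tau * kappa2 t s k x (tc_map c tau) a a)
  + (- A - B) * pairing Z (fun c => K c x)); first by ring.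
have z1 := fun c hc => within_cvgZ (c := w1) (s1 c hc).
have z2 := fun c hc => within_cvgZ (c := w2) (s2 c hc).
have z3 := fun c hc => within_cvgZ (c := - A - B) (sK c hc).
rewrite -(pairingZ hZ w1 s1) -(pairingZ hZ w2 s2) -(pairingZ hZ (- A - B) sK).
have z12 : forall c, tc_valid t U c -> {within cube, continuous (fun tau =>
    w1 * (K c x tau * kappa t s k x (tc_map c tau) a)
    + w2 * (K c x tau * kappa2 t s k x (tc_map c tau) a a))}.
  by move=> c hc v; exact (cvgD (z1 c hc v) (z2 c hc v)).
rewrite -(pairingD z1 z2) -(pairingD z12 z3).
apply: (eq_pairing hZ) => c tau hc ht; rewrite /w1 -/w2 /kappa /B /A; ring.
Qed.

Lemma opL_Kn (I : 'I_n.+1 -> 'I_m) x : U x -> injective (fun a => x 0 (I a)) ->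
  opL t s k I (Kn s k lX lU Z) x = - beta * \sum_j residue_weight p (fun a => x 0 (I a)) j *
    pairing Z (fun c tau => K c x tau * gvar x (tc_map c tau) j).
Proof.
move=> Ux Ii; rewrite /opL.
under eq_bigr => a _ do rewrite (opD_Kn (I a) Ux).
rewrite mulr_sumr; under [RHS]eq_bigr do rewrite mulrA.
rewrite pairing_sumZ; last first.
  by move=> a c hc; exact: (jointly_continuous_slice (@operator_jcont (I a)) hc Ux).
rewrite pairing_sumZ; last first.
  by move=> j c hc; exact: (jointly_continuous_slice (@gvar_jcont j) hc Ux).
apply: (eq_pairing hZ) => c tau hc ht.
have B0 := uqsum_neq0 hc Ux ht.
have xp a j : x 0 (I a) != p j by exact: (coord_neq_pole pi hlX hlU).
have E := second_order_identity Ii xp (sum_zvar B0) (sum_yvar s k B0) (fun j => erefl _).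
transitivity (K c x tau * (- beta * \sum_j residue_weight p (fun a => x 0 (I a)) j *
    gvar x (tc_map c tau) j)); last first.
  rewrite mulr_sumr mulr_sumr; apply: eq_bigr => j _.
  by rewrite [RHS]mulrCA; congr (_ * _); exact: mulrA.
rewrite -[in RHS]E mulr_sumr; apply: eq_bigr => a _.
by rewrite kappa2_diag mulrCA.
Qed.

End OperatorsOnIntegral.


(** * Stokes' formula on one twice differentiable cube *)

Section CubeStokes.
Variables (R : realType) (n m : nat) (t : n.-tuple (CC R)).
Variables (U : set 'rV[CC R]_m) (c : twisted_cube R n m).
Hypothesis hc : tc_valid t U c.
Local Notation cube := (@unit_cube R n.+1).
Local Notation D := (der (0 : R)^' (@toC R)).
Local Notation qq := (tc_map c).
Local Notation J := (tc_jmx c).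
Local Notation e_ a := (delta_mx 0 a : 'rV[R]_n.+1).

Lemma toC_dnbhs0 : (@toC R) @ (0 : R)^' --> (0 : CC R).
Proof.
have id0 : (fun r : R => r) @ (0 : R)^' --> (0 : R) by exact: nbhs_dnbhs.
exact: (toC_cvg id0).
Qed.

Lemma toC_neq0_near : \forall r \near (0 : R)^', toC r != 0.
Proof.
by near=> r; rewrite toC_eq0; near: r; exact: nbhs_dnbhs_neq.
Unshelve. all: by end_near. Qed.

Let e0 := toC_dnbhs0.
Let en0 := toC_neq0_near.

Lemma der_ReIm (f : 'rV[R]_n.+1 -> CC R) tau v :
  derivable (fun w => complex.Re (f w)) tau v ->
  derivable (fun w => complex.Im (f w)) tau v ->
  D (fun r => f (tau + r *: v)) (f tau)
    ('D_v (fun w => complex.Re (f w)) tau +i* 'D_v (fun w => complex.Im (f w)) tau)%C.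
Proof.
move=> /derivableP /is_derive_cvgP h1 /derivableP /is_derive_cvgP h2.
apply/cvgCP; split=> /=.
  by under eq_fun do rewrite Re_div_toC ReB.
by under eq_fun do rewrite Im_div_toC ImB.
Qed.

Lemma der_map tau a b : D (fun r => qq (tau + r *: e_ a) 0 b) (qq tau 0 b) (J tau a b).
Proof.
have [hC2 _ _ _] := hc; have [[c1 _] [c2 _]] := hC2 b.
rewrite mxE.
exact: (der_ReIm (f := fun v => qq v 0 b) ((c1 a).1 tau) ((c2 a).1 tau)).
Qed.

Definition hess (tau : 'rV[R]_n.+1) (a b j : 'I_n.+1) : CC R :=
  ('D_(e_ a) ('D_(e_ b) (fun v => complex.Re (qq v 0 j))) tau
   +i* 'D_(e_ a) ('D_(e_ b) (fun v => complex.Im (qq v 0 j))) tau)%C.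

Lemma hess_sym tau a b j : hess tau a b j = hess tau b a j.
Proof.
have [hC2 _ _ _] := hc; have [h1 h2] := hC2 j.
by rewrite /hess (schwarz _ _ _ h1) (schwarz _ _ _ h2).
Qed.

Lemma der_jmx tau a b j : D (fun r => J (tau + r *: e_ a) b j) (J tau b j) (hess tau a b j).
Proof.
have [hC2 _ _ _] := hc; have [[_ c1] [_ c2]] := hC2 j.
have d1 : D (fun r => ('D_(e_ b) (fun v => complex.Re (qq v 0 j)) (tau + r *: e_ a)
   +i* 'D_(e_ b) (fun v => complex.Im (qq v 0 j)) (tau + r *: e_ a))%C : CC R)
   (('D_(e_ b) (fun v => complex.Re (qq v 0 j)) tau
   +i* 'D_(e_ b) (fun v => complex.Im (qq v 0 j)) tau)%C : CC R) (hess tau a b j).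
  exact: (der_ReIm (f := fun v => ('D_(e_ b) (fun v => complex.Re (qq v 0 j)) v
   +i* 'D_(e_ b) (fun v => complex.Im (qq v 0 j)) v)%C : CC R)
   ((c1 b a).1 tau) ((c2 b a).1 tau)).
refine (der_eq (der_ext _ d1) _ (erefl _)); last by rewrite mxE.
by apply: nearW => r; rewrite mxE.
Qed.

Lemma cvg_hess (W : Type) (F : set_system W) {FF : Filter F} (T : W -> 'rV[R]_n.+1) tau
    a b j : T @ F --> tau -> (fun w => hess (T w) a b j) @ F --> hess tau a b j.
Proof.
move=> hT; have [hC2 _ _ _] := hc; have [[_ c1] [_ c2]] := hC2 j.
apply/cvgCP; split.
  exact (cvg_comp _ _ hT ((c1 b a).2 tau)).
exact (cvg_comp _ _ hT ((c2 b a).2 tau)).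
Qed.

(** The cofactor at (a, j) does not involve row a, so only rows b distinct from a are
    differentiated. The expansion over permutations is the one that [piola] sums. *)
Definition dcofactor (tau : 'rV[R]_n.+1) (a j : 'I_n.+1) : CC R :=
  \sum_(s : 'S_n.+1 | s a == j) (-1) ^+ s * (\sum_(b | b != a)
     hess tau a b (s b) * \prod_(l | (l != a) && (l != b)) J tau l (s l)).

Lemma der_cofactor tau a j :
  D (fun r => cofactor (J (tau + r *: e_ a)) a j) (cofactor (J tau) a j)
    (dcofactor tau a j).
Proof.
have E M : cofactor M a j = \sum_(s : 'S_n.+1 | s a == j)
    (-1) ^+ s * \prod_(l | l != a) M l (s l) :> CC R.
  rewrite expand_cofactor; apply: eq_bigr => s _; congr (_ * _).
  by apply: eq_bigl => l; rewrite eq_sym.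
rewrite E; apply: (@der_ext _ _ _ _ _ (fun r => \sum_(s : 'S_n.+1 | s a == j)
    (-1) ^+ s * \prod_(l | l != a) J (tau + r *: e_ a) l (s l))).
  by apply: nearW => r; rewrite E.
apply: der_sum => s _; refine (derZ e0 en0 _).
apply: (der_prod e0 en0 (index_enum_uniq _)) => l _; exact: der_jmx.
Qed.

Lemma cvg_dcofactor (W : Type) (F : set_system W) {FF : Filter F}
    (T : W -> 'rV[R]_n.+1) tau a j : T @ F --> tau ->
  (fun w => dcofactor (T w) a j) @ F --> dcofactor tau a j.
Proof.
move=> hT; apply: cvg_bigsum => s _.
refine (cvgM (cvg_cst _) _); apply: cvg_bigsum => b _.
refine (cvgM (cvg_hess hT) _); apply: cvg_bigprod => l _.
exact: (cvg_jmx hc hT).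
Qed.

Lemma cvg_cofactor (W : Type) (F : set_system W) {FF : Filter F}
    (T : W -> 'rV[R]_n.+1) tau a j : T @ F --> tau ->
  (fun w => cofactor (J (T w)) a j) @ F --> cofactor (J tau) a j.
Proof.
move=> hT; rewrite expand_cofactor; under eq_fun do rewrite expand_cofactor.
apply: cvg_bigsum => s _.
refine (cvgM (cvg_cst _) _); apply: cvg_bigprod => l _.
exact: (cvg_jmx hc hT).
Qed.

Lemma sum_cofactor (M : 'M[CC R]_n.+1) b j :
  \sum_a M a b * cofactor M a j = (b == j)%:R * \det M.
Proof.
have := congr1 (fun A : 'M[CC R]_n.+1 => A j b) (mul_adj_mx M).
rewrite !mxE eq_sym mulr_natl => <-.
by apply: eq_bigr => a _; rewrite mxE mulrC.
Qed.

Lemma insert_coord_line a (e r : R) (v : 'rV[R]_n) :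
  insert_coord a (e + r) v = insert_coord a e v + r *: e_ a.
Proof.
apply/rowP => l; rewrite !mxE eqxx /=; have [i ->|->] := unliftP a l.
  by rewrite eq_sym (negPf (neq_lift a i)) mulr0 addr0.
by rewrite eqxx mulr1.
Qed.

(** This is Stokes for V times the product of the dq_b with b != j, whose pull-back has the
    cofactors at (a, j) as coefficients, up to sign. Summing over a, the derivatives of the
    cofactors cancel by [piola], and expansion along the wrong column kills every [V' b] except b =
    j, which gets the Jacobian. V lives on the cube and not on the q-space, as it carries a branch;
    the [V' b] enter only through the chain rule. *)
Lemma cube_stokes (V : 'rV[R]_n.+1 -> CC R) (V' : 'I_n.+1 -> 'rV[R]_n.+1 -> CC R) j :
  {within cube, continuous V} -> (forall b, {within cube, continuous (V' b)}) ->
  (forall a (e : R) v, 0 < e < 1 -> unit_cube v ->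
     D (fun r => V (insert_coord a e v + r *: e_ a)) (V (insert_coord a e v))
       (\sum_b V' b (insert_coord a e v) * J (insert_coord a e v) a b)) ->
  cube_int (fun tau => V' j tau * tc_jacobian c tau) =
  \sum_a (cube_int (fun v => V (insert_coord a 1 v) * cofactor (J (insert_coord a 1 v)) a j)
        - cube_int (fun v => V (insert_coord a 0 v) * cofactor (J (insert_coord a 0 v)) a j)).
Proof.
move=> cV cV' dV.
pose h a tau := V tau * cofactor (J tau) a j.
pose h' a tau := (\sum_b V' b tau * J tau a b) * cofactor (J tau) a j
   + V tau * dcofactor tau a j.
have ch a : {within cube, continuous (h a)}.
  apply/within_continuousP => tau ht; pose proof (@within_id_cvg _ cube tau) as idc.
  exact (cvgM ((within_continuousP _ _).1 cV tau ht) (cvg_cofactor (a := a) (j := j) idc)).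
have ch' a : {within cube, continuous (h' a)}.
  apply/within_continuousP => tau ht; pose proof (@within_id_cvg _ cube tau) as idc.
  have k1 : (fun w => \sum_b V' b w * J w a b) @ within cube (nbhs tau) -->
      \sum_b V' b tau * J tau a b.
    apply: cvg_bigsum => b _.
    exact (cvgM ((within_continuousP _ _).1 (cV' b) tau ht) (cvg_jmx (a := a) (b := b) hc idc)).
  exact (cvgD (cvgM k1 (cvg_cofactor (a := a) (j := j) idc))
    (cvgM ((within_continuousP _ _).1 cV tau ht) (cvg_dcofactor (a := a) (j := j) idc))).
transitivity (\sum_a cube_int (h' a)); last first.
  apply: eq_bigr => a _; apply: (cube_int_FTC (a := a) (ch a) (ch' a)) => e v he hv.
  pose proof (derM e0 en0 (dV a e v he hv) (@der_cofactor (insert_coord a e v) a j)) as d1.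
  have d2 : D (fun r => h a (insert_coord a (e + r) v)) (h a (insert_coord a e v))
      (h' a (insert_coord a e v)).
    by apply: der_ext d1; apply: nearW => r; rewrite /h insert_coord_line.
  exact: d2.
transitivity (cube_int (fun tau => \sum_a h' a tau)); last first.
  by apply: (cube_int_sum _ (P := xpredT) (f := h')) => a _; exact: ch'.
apply: eq_cube_int => tau ht; rewrite /h' big_split -mulr_sumr.
rewrite [X in _ = _ + V tau * X](_ : _ = 0); last first.
  exact: (piola (J tau) j (hess_sym tau)).
rewrite mulr0 addr0; under eq_bigr do rewrite mulr_suml.
rewrite exchange_big /= (bigD1 j) //= [X in _ + X]big1 => [|b bj].
  transitivity (V' j tau * \sum_a J tau a j * cofactor (J tau) a j).
    by rewrite sum_cofactor eqxx mul1r.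
  by rewrite addr0 mulr_sumr; apply: eq_bigr => a _; rewrite mulrA.
transitivity (V' b tau * \sum_a J tau a b * cofactor (J tau) a j).
  by rewrite mulr_sumr; apply: eq_bigr => a _; rewrite mulrA.
by rewrite sum_cofactor (negPf bj) mul0r mulr0.
Qed.

End CubeStokes.


(** * Derivatives of K, K / B and q_j K / B along a cube *)

Section StokesFields.
Variables (R : realType) (n m : nat) (t : n.-tuple (CC R)).
Variables (s : CC R) (k : 'I_n.+2 -> CC R).
Local Notation alpha := (s - \sum_i k i).
Local Notation beta := (s + \sum_i k i).
Variables (U : set 'rV[CC R]_m) (lX : 'rV[CC R]_m -> CC R).
Variables (lU : 'I_n.+1 -> 'rV[CC R]_m -> CC R) (c : twisted_cube R n m).
Hypothesis hc : tc_valid t U c.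
Variable x : 'rV[CC R]_m.
Hypothesis Ux : U x.
Local Notation cube := (@unit_cube R n.+1).
Local Notation D := (der (0 : R)^' (@toC R)).
Local Notation qq := (tc_map c).
Local Notation J := (tc_jmx c).
Local Notation K := (tc_integrand s k lX lU c x).
Local Notation B := (fun tau => uqsum t x (qq tau)).

(** The logarithmic derivative of K in q_b. *)
Definition dlog_integrand (q : 'rV[CC R]_n.+1) (b : 'I_n.+1) : CC R :=
  (2 * k (lift ord0 b) - 1) / q 0 b + alpha / qsum q
  - beta * uvar t b x / (q 0 b ^+ 2 * uqsum t x q).

Section AlongCube.
Variables (tau : 'rV[R]_n.+1) (a : 'I_n.+1).
Hypotheses (ht : cube tau) (hi : 0 < tau 0 a < 1).
Local Notation T := (fun r : R => tau + r *: delta_mx 0 a).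
Local Notation q := (qq tau).

Let e0 := @toC_dnbhs0 R.
Let en0 := @toC_neq0_near R.

(** Branches are constrained on the cube only, so derivatives in tau_a are taken where tau_a is
    interior, which is all that the fundamental theorem asks for. *)
Lemma near_cube_line : \forall r \near (0 : R)^', cube (T r).
Proof.
have h1 : \forall y \near tau 0 a, y \in `]0, 1[%R by apply: near_in_itvoo; rewrite in_itv.
have [del del0 hdel] := (nbhs_ballP _ _).1 h1.
have hd : \forall r \near (0 : R)^', `|r| < del by apply: dnbhs0_lt.
move: hd; apply: filterS => r hr l; rewrite !mxE eqxx /=.
have [->|la] := eqVneq l a; last by rewrite mulr0 addr0; exact: ht.
rewrite mulr1; have := hdel (tau 0 a + r).
rewrite /ball/= opprD addNKr normrN => /(_ hr); rewrite in_itv /=.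
by case/andP=> ? ?; rewrite !ltW.
Qed.

Lemma real_line_cvg : T @ (0 : R)^' --> tau.
Proof.
apply: cvg_row => l.
have -> : (fun r => T r 0 l) = (fun r => tau 0 l + r * (l == a)%:R).
  by apply/funext => r; rewrite !mxE eqxx.
have id0 : (fun r : R => r) @ (0 : R)^' --> (0 : R) by exact: nbhs_dnbhs.
pose proof (cvgD (cvg_cst (tau 0 l)) (cvgM id0 (cvg_cst ((l == a)%:R : R)))) as h.
by rewrite mul0r addr0 in h; exact h.
Qed.

Lemma der_q b : D (fun r => qq (T r) 0 b) (q 0 b) (J tau a b).
Proof. exact: (der_map hc). Qed.

Lemma der_qsum : D (fun r => qsum (qq (T r))) (qsum q) (\sum_b J tau a b).
Proof.
have d1 : D (fun r => \sum_b qq (T r) 0 b) (\sum_b q 0 b) (\sum_b J tau a b).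
  by apply: der_sum => b _; exact: der_q.
pose proof (derD (der_cst (@toC R) 1) d1) as d2.
by refine (der_eq d2 (erefl _) _); rewrite add0r.
Qed.

Lemma der_uqsum_q : D (fun r => B (T r)) (B tau)
  (- \sum_b uvar t b x / q 0 b ^+ 2 * J tau a b).
Proof.
have d1 : D (fun r => \sum_b uvar t b x / qq (T r) 0 b) (\sum_b uvar t b x / q 0 b)
    (\sum_b uvar t b x * (- J tau a b / q 0 b ^+ 2)).
  apply: der_sum => b _; refine (derZ e0 en0 _).
  exact: (derV e0 en0 (q_neq0 hc b ht) (@der_q b)).
pose proof (derD (der_cst (@toC R) 1) d1) as d2.
refine (der_eq d2 (erefl _) _); rewrite add0r -sumrN.
by apply: eq_bigr => b _; ring.
Qed.

Lemma der_integrand_q :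
  D (fun r => K (T r)) (K tau) (K tau * \sum_b dlog_integrand q b * J tau a b).
Proof.
have [_ hQ [cA _] [cB _]] := hc.
have q0 b := q_neq0 hc b ht.
have A0 := qsum_neq0 hc ht.
have B0 := uqsum_neq0 hc Ux ht.
have dQ b : D (fun r => tc_logq c b (T r)) (tc_logq c b tau) (J tau a b / q 0 b).
  refine (der_log en0 (within_comp_cvg (hQ b).1 ht real_line_cvg near_cube_line) _
    ((hQ b).2 _ ht) (@der_q b)).
  by move: near_cube_line; apply: filterS => r hr; exact: (tc_logq_exp hc).
have dA : D (fun r => tc_logA c (T r)) (tc_logA c tau) ((\sum_b J tau a b) / qsum q).
  refine (der_log en0 (within_comp_cvg cA ht real_line_cvg near_cube_line) _
    (tc_logA_exp hc ht) der_qsum).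
  by move: near_cube_line; apply: filterS => r hr; exact: (tc_logA_exp hc).
have dB : D (fun r => tc_logB c (x, T r)) (tc_logB c (x, tau))
    ((- \sum_b uvar t b x / q 0 b ^+ 2 * J tau a b) / B tau).
  have lc : (fun r => tc_logB c (x, T r)) @ (0 : R)^' --> tc_logB c (x, tau).
    apply: (within_comp_cvg (g := fun r => (x, T r)) (x := (x, tau)) cB) => //.
      exact (cvg_pair (cvg_cst x) real_line_cvg).
    by move: near_cube_line; apply: filterS.
  refine (der_log en0 lc _ (tc_logB_exp hc Ux ht) der_uqsum_q).
  by move: near_cube_line; apply: filterS => r hr; exact: (tc_logB_exp hc).
pose proof (der_Cexp e0 en0 (derD (derD (derD
  (der_cst (@toC R) (s * lX x))
  (der_sum (s := index_enum 'I_n.+1) (P := xpredT) (fun j _ => derD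
     (der_cst (@toC R) (- k (lift ord0 j) * lU j x))
     (derZ (c := 2 * k (lift ord0 j) - 1) e0 en0 (dQ j)))))
  (derZ (c := alpha) e0 en0 dA)) (derZ (c := beta) e0 en0 dB))) as d1.
rewrite /tc_integrand integrandE.
rewrite (_ : (fun r => integrand _ _ _ _ _ _ _) = (fun r => Cexp (log_integrand s k (lX x)
  (fun j => lU j x) (fun j => tc_logq c j (T r)) (tc_logA c (T r))
  (tc_logB c (x, T r))))); last by apply/funext => r; rewrite integrandE.
refine (der_eq d1 (erefl _) _); congr (_ * _).
have E1 : alpha * ((\sum_b J tau a b) / qsum q) = \sum_b alpha * (J tau a b / qsum q).
  by rewrite mulr_suml mulr_sumr.
have E2 : beta * ((- \sum_b uvar t b x / q 0 b ^+ 2 * J tau a b) / B tau) =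
    \sum_b beta * (- (uvar t b x / q 0 b ^+ 2 * J tau a b) / B tau).
  by rewrite -sumrN mulr_suml mulr_sumr.
rewrite add0r E1 E2 -!big_split /=; apply: eq_bigr => b _.
by rewrite /dlog_integrand add0r; field; rewrite q0 A0 B0.
Qed.

End AlongCube.

(** The partial derivative of K / B in q_j; the last term is the contribution of 1 / B. *)
Definition field1 (j : 'I_n.+1) (tau : 'rV[R]_n.+1) : CC R :=
  K tau * (dlog_integrand (qq tau) j / B tau
           + uvar t j x / (qq tau 0 j ^+ 2 * B tau ^+ 2)).

Lemma der_field1 tau a : cube tau -> 0 < tau 0 a < 1 ->
  D (fun r => K (tau + r *: delta_mx 0 a) * (B (tau + r *: delta_mx 0 a))^-1)
    (K tau * (B tau)^-1) (\sum_b field1 b tau * J tau a b).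
Proof.
move=> ht hi; have B0 := uqsum_neq0 hc Ux ht; have q0 b := q_neq0 hc b ht.
pose proof (derM (@toC_dnbhs0 R) (@toC_neq0_near R) (der_integrand_q ht hi)
  (derV (@toC_dnbhs0 R) (@toC_neq0_near R) B0 (der_uqsum_q (a := a) ht))) as d1.
refine (der_eq d1 (erefl _) _).
have E1 : K tau * (\sum_b dlog_integrand (qq tau) b * J tau a b) * (B tau)^-1 =
    \sum_b K tau * (dlog_integrand (qq tau) b * J tau a b) * (B tau)^-1.
  by rewrite mulr_sumr mulr_suml.
have E2 : K tau * (- - (\sum_b uvar t b x / qq tau 0 b ^+ 2 * J tau a b) / B tau ^+ 2) =
    \sum_b K tau * (uvar t b x / qq tau 0 b ^+ 2 * J tau a b / B tau ^+ 2).
  by rewrite opprK mulr_suml mulr_sumr.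
rewrite E1 E2 -big_split /=; apply: eq_bigr => b _.
by rewrite /field1; field; rewrite q0 B0.
Qed.

Lemma der_field2 tau a j : cube tau -> 0 < tau 0 a < 1 ->
  D (fun r => K (tau + r *: delta_mx 0 a) * (B (tau + r *: delta_mx 0 a))^-1
       * qq (tau + r *: delta_mx 0 a) 0 j)
    (K tau * (B tau)^-1 * qq tau 0 j)
    (\sum_b (field1 b tau * qq tau 0 j + (b == j)%:R * (K tau / B tau)) * J tau a b).
Proof.
move=> ht hi.
pose proof (derM (@toC_dnbhs0 R) (@toC_neq0_near R) (der_field1 ht hi)
  (@der_q tau a j)) as d1.
refine (der_eq d1 (erefl _) _).
rewrite mulr_suml (bigD1 j) // [RHS](bigD1 j) //= eqxx mul1r.
rewrite [X in _ = _ + X](eq_bigr (fun b => field1 b tau * J tau a b * qq tau 0 j)).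
  by ring.
by move=> b /negPf ->; rewrite mul0r addr0 mulrAC.
Qed.

End StokesFields.


(** * Cancellation of the boundary terms of a twisted cycle *)

Section Faces.
Variables (R : realType) (n m : nat) (t : n.-tuple (CC R)).
Variables (s : CC R) (k : 'I_n.+2 -> CC R).
Variables (U : set 'rV[CC R]_m) (lX : 'rV[CC R]_m -> CC R).
Variables (lU : 'I_n.+1 -> 'rV[CC R]_m -> CC R).
Variable Z : seq (twisted_cube R n m).
Hypothesis hZ : forall l : 'I_(size Z), tc_valid t U (tnth (in_tuple Z) l).
Hypothesis hclosed : tc_closed s k U lX lU Z.
Local Notation K := (tc_integrand s k lX lU).
Local Notation cube := (@unit_cube R n.+1).

(** Coincidence of two faces is known on the closed cube only, so at a boundary point of it only
    increments of one sign can be compared. G is the right or left filter at 0; a derivative taken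
    along the punctured filter is also the limit along G, and is thus determined by the face. *)
Lemma cube_side (v : 'rV[R]_n) (a : 'I_n) : unit_cube v ->
  exists2 G : set_system R, ProperFilter G /\ (forall P, (0 : R)^' P -> G P) &
    \forall r \near G, unit_cube (v + r *: delta_mx 0 a).
Proof.
move=> hv; have cubeE r : 0 <= v 0 a + r <= 1 -> unit_cube (v + r *: delta_mx 0 a).
  move=> hr l; rewrite !mxE eqxx /=; have [->|la] := eqVneq l a.
    by rewrite mulr1.
  by rewrite mulr0 addr0.
have [va1|va1] := ltP (v 0 a) 1.
  exists ((0 : R)^'+).
    split; first exact: at_right_proper_filter.
    move=> P hP; have hP' : nbhs (0 : R) [set r | r != 0 -> P r] := hP.
    suff : nbhs (0 : R) [set r | 0 < r -> P r] by [].
    by apply: filterS hP' => r hr r0; apply: hr; rewrite gt_eqF.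
  have d0 : 0 < 1 - v 0 a by rewrite subr_gt0.
  near=> r; have r0 : 0 < r by near: r; exact: nbhs_right_gt.
  have r1 : r < 1 - v 0 a by near: r; exact: nbhs_right_lt.
  by apply: cubeE; have /andP[? ?] := hv a; apply/andP; split; lra.
exists ((0 : R)^'-).
  split; first exact: at_left_proper_filter.
  move=> P hP; have hP' : nbhs (0 : R) [set r | r != 0 -> P r] := hP.
  suff : nbhs (0 : R) [set r | r < 0 -> P r] by [].
  by apply: filterS hP' => r hr r0; apply: hr; rewrite lt_eqF.
have d0 : -1 < 0 :> R by rewrite ltrN10.
near=> r; have r0 : r < 0 by near: r; exact: nbhs_left_lt.
have r1 : -1 < r by near: r; exact: nbhs_left_gt.
by apply: cubeE; have /andP[? ?] := hv a; apply/andP; split; lra.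
Unshelve. all: by end_near. Qed.

Lemma insert_coord_lift_line (i : 'I_n.+1) (e r : R) (v : 'rV[R]_n) (a : 'I_n) :
  insert_coord i e v + r *: delta_mx 0 (lift i a) =
  insert_coord i e (v + r *: delta_mx 0 a).
Proof.
apply/rowP => l; rewrite !mxE eqxx /=; have [j ->|->] := unliftP i l.
  by rewrite !mxE eqxx /= (inj_eq lift_inj).
by rewrite (negPf (neq_lift i a)) mulr0 addr0.
Qed.

Section TwoFaces.
Variables (c c' : twisted_cube R n m) (i i' : 'I_n.+1) (e e' : R) (v : 'rV[R]_n).
Hypotheses (hc : tc_valid t U c) (hv : unit_cube v).

Lemma face_derivative_eq (a : 'I_n) b : tc_valid t U c' ->
  (forall w, unit_cube w -> tc_map c (insert_coord i e w) = tc_map c' (insert_coord i' e' w)) ->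
  tc_jmx c (insert_coord i e v) (lift i a) b = tc_jmx c' (insert_coord i' e' v) (lift i' a) b.
Proof.
move=> hc' same; have [G [PG GD] Gc] := cube_side a hv.
have d1 := @der_map _ _ _ _ _ _ hc (insert_coord i e v) (lift i a) b.
have d2 := @der_map _ _ _ _ _ _ hc' (insert_coord i' e' v) (lift i' a) b.
pose Q (c0 : twisted_cube R n m) i0 e0 (r : R) : CC R :=
  (tc_map c0 (insert_coord i0 e0 v + r *: delta_mx 0 (lift i0 a)) 0 b
   - tc_map c0 (insert_coord i0 e0 v) 0 b) / toC r.
have l1 : Q c i e @ G --> tc_jmx c (insert_coord i e v) (lift i a) b.
  by move=> A hA; exact: GD (d1 A hA).
have l2 : Q c' i' e' @ G --> tc_jmx c' (insert_coord i' e' v) (lift i' a) b.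
  by move=> A hA; exact: GD (d2 A hA).
have E : \forall r \near G, Q c i e r = Q c' i' e' r.
  move: Gc; apply: filterS => r hr.
  by rewrite /Q !insert_coord_lift_line (same _ hr) (same _ hv).
exact: (cvg_unique (@norm_hausdorff _ _) (eq_near_cvg E l1) l2).
Qed.

Lemma face_derivative_degenerate (a : 'I_n) b :
  (forall w w', unit_cube w -> unit_cube w' -> (forall l, l != a -> w 0 l = w' 0 l) ->
     tc_map c (insert_coord i e w) = tc_map c (insert_coord i e w')) ->
  tc_jmx c (insert_coord i e v) (lift i a) b = 0.
Proof.
move=> deg; have [G [PG GD] Gc] := cube_side a hv.
have d1 := @der_map _ _ _ _ _ _ hc (insert_coord i e v) (lift i a) b.
pose Q (r : R) : CC R :=
  (tc_map c (insert_coord i e v + r *: delta_mx 0 (lift i a)) 0 b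
   - tc_map c (insert_coord i e v) 0 b) / toC r.
have l1 : Q @ G --> tc_jmx c (insert_coord i e v) (lift i a) b.
  by move=> A hA; exact: GD (d1 A hA).
have l2 : (fun=> 0 : CC R) @ G --> (0 : CC R) by exact: cvg_cst.
have E : \forall r \near G, Q r = 0.
  move: Gc; apply: filterS => r hr.
  rewrite /Q !insert_coord_lift_line (deg _ v hr hv) ?subrr ?mul0r // => l la.
  by rewrite !mxE eqxx (negPf la) mulr0 addr0.
exact: (cvg_unique (@norm_hausdorff _ _) (eq_near_cvg E l1) l2).
Qed.

End TwoFaces.

(** Deleting row i leaves only derivatives tangential to the face. These depend on the face as a
    map, unlike the derivatives normal to it. *)
Definition face_minor (c : twisted_cube R n m) (i j : 'I_n.+1) (e : R) (v : 'rV[R]_n) : CC R :=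
  \det (row' i (col' j (tc_jmx c (insert_coord i e v))) : 'M[CC R]_n).

Local Notation face := ('I_(size Z) * 'I_n.+1 * bool)%type.
Local Notation cl f := (tnth (in_tuple Z) f.1.1).
Definition face_map (f : face) (v : 'rV[R]_n) :=
  tc_map (cl f) (insert_coord f.1.2 (f.2%:R : R) v).

Lemma face_minor_eq (f g : face) j v : unit_cube v ->
  (forall w, unit_cube w -> face_map f w = face_map g w) ->
  face_minor (cl f) f.1.2 j (f.2%:R : R) v = face_minor (cl g) g.1.2 j (g.2%:R : R) v.
Proof.
move=> hv same; congr (\det _); apply/matrixP => a b.
rewrite [LHS]mxE [LHS]mxE [RHS]mxE [RHS]mxE.
exact: (face_derivative_eq (hZ f.1.1) hv a (lift j b) (hZ g.1.1) same).
Qed.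

(** A degenerate face is constant in some direction a on the cube, so the corresponding row of its
    Jacobian vanishes. *)
Lemma face_minor_degenerate (f : face) j v : unit_cube v ->
  degenerate_cube (face_map f) -> face_minor (cl f) f.1.2 j (f.2%:R : R) v = 0.
Proof.
move=> hv [a deg]; rewrite /face_minor (expand_det_row _ a) big1 // => b _.
rewrite [X in X * _]mxE [X in X * _]mxE (face_derivative_degenerate (hZ f.1.1) hv) ?mul0r //.
Qed.

(* The faces carried by a given singular cube share their minors, so that the
   cancellation of their branches cancels the integrands. *)
Lemma faces_cancel_pointwise (phi : 'rV[CC R]_n.+1 -> CC R) j x v : U x -> unit_cube v ->
  \sum_(f : face) (-1) ^+ (f.1.2 + f.2) * tc_coef (cl f)
     * K (cl f) x (insert_coord f.1.2 (f.2%:R : R) v)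
     * (phi (face_map f v) * face_minor (cl f) f.1.2 j (f.2%:R : R) v) = 0.
Proof.
move=> Ux hv; pose same (f g : face) :=
  `[< forall w, unit_cube w -> face_map g w = face_map f w >].
pose cls (f : face) := [set g : face | same f g]%SET.
have clsE f g : (cls g == cls f) = same f g.
  apply/eqP/idP => [E|/asboolP fg].
    suff : g \in cls f by rewrite inE.
    by rewrite -E inE; apply/asboolP.
  apply/setP => h; rewrite !inE; apply/asboolP/asboolP => H w hw.
    by rewrite H // fg.
  by rewrite H // fg.
(* Faces are sorted by the finite set of all faces that carry the same singular cube; these sets
   provide a finite index for the classes. *)
rewrite (partition_big cls predT) //= big1 // => C _.
have [[f0 /eqP <-]|nC] := pselect (exists f0, cls f0 == C); last first.
  rewrite big1 // => f fC; case: nC; by exists f.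
under eq_bigl do rewrite clsE.
have Hh f : same f0 f -> phi (face_map f v) * face_minor (cl f) f.1.2 j (f.2%:R : R) v =
    phi (face_map f0 v) * face_minor (cl f0) f0.1.2 j (f0.2%:R : R) v.
  by move=> /asboolP S; rewrite (face_minor_eq j hv S) S.
rewrite (eq_bigr (fun f : face => ((-1) ^+ (f.1.2 + f.2) * tc_coef (cl f)
     * K (cl f) x (insert_coord f.1.2 (f.2%:R : R) v)) *
   (phi (face_map f0 v) * face_minor (cl f0) f0.1.2 j (f0.2%:R : R) v))); last first.
  by move=> f S; rewrite Hh.
rewrite -mulr_suml.
(* Closedness says nothing about degenerate faces, but their common minor is zero. *)
have [deg|ndeg] := pselect (degenerate_cube (face_map f0)).
  by rewrite (face_minor_degenerate j hv deg) !mulr0.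
have := hclosed ndeg Ux hv; rewrite big_tnth.
rewrite pair_big_dep pair_big_dep /= => H.
rewrite [X in X * _](_ : _ = 0) ?mul0r //.
Qed.

Lemma faces_cancel (phi : 'rV[CC R]_n.+1 -> CC R) j x : U x ->
  (forall c, tc_valid t U c ->
     {within cube, continuous (fun tau => K c x tau * phi (tc_map c tau))}) ->
  \sum_(c <- Z) tc_coef c * (\sum_a
    (cube_int (fun v => K c x (insert_coord a 1 v) * phi (tc_map c (insert_coord a 1 v))
        * cofactor (tc_jmx c (insert_coord a 1 v)) a j)
     - cube_int (fun v => K c x (insert_coord a 0 v) * phi (tc_map c (insert_coord a 0 v))
        * cofactor (tc_jmx c (insert_coord a 0 v)) a j))) = 0.
Proof.
move=> Ux cphi.
pose G (f : face) v : CC R := K (cl f) x (insert_coord f.1.2 (f.2%:R : R) v)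
  * phi (face_map f v) * cofactor (tc_jmx (cl f) (insert_coord f.1.2 (f.2%:R : R) v)) f.1.2 j.
have cG f : {within @unit_cube R n, continuous (G f)}.
  have e01 : 0 <= (f.2%:R : R) <= 1 by case: f.2; rewrite ?lexx ler01.
  have cw : {within cube, continuous (fun tau => K (cl f) x tau * phi (tc_map (cl f) tau)
      * cofactor (tc_jmx (cl f) tau) f.1.2 j)}.
    apply/within_continuousP => tau ht; pose proof (@within_id_cvg _ cube tau) as idc.
    exact (cvgM ((within_continuousP _ _).1 (cphi _ (hZ f.1.1)) tau ht)
      (cvg_cofactor (a := f.1.2) (j := j) (hZ f.1.1) idc)).
  exact: (insert_coord_slice (i := f.1.2) cw e01).
pose r (f : face) : CC R := - (-1) ^+ (f.2 : nat) * tc_coef (cl f).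
transitivity (\sum_(f : face) r f * cube_int (G f)).
  rewrite -(pair_bigA _ (fun (p : 'I_(size Z) * 'I_n.+1) (e : bool) =>
     r (p, e) * cube_int (G (p, e)))).
  rewrite -(pair_bigA _ (fun (l : 'I_(size Z)) (i : 'I_n.+1) =>
     \sum_(e : bool) r (l, i, e) * cube_int (G (l, i, e)))).
  rewrite [LHS]big_tnth; apply: eq_bigr => l _; rewrite mulr_sumr; apply: eq_bigr => i _.
  have r1 : r (l, i, true) = tc_coef (tnth (in_tuple Z) l).
    by rewrite /r [X in (-1) ^+ X](_ : _ = 1%N) // expr1 opprK mul1r.
  have r0 : r (l, i, false) = - tc_coef (tnth (in_tuple Z) l).
    by rewrite /r [X in (-1) ^+ X](_ : _ = 0%N) // expr0 mulN1r.
  rewrite [RHS]big_bool r1 r0 mulrBr -mulNr; congr (_ * _ + _ * _).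
transitivity (cube_int (fun v => \sum_(f : face) r f * G f v)).
  have crG f : {within @unit_cube R n, continuous (fun v => r f * G f v)}.
    apply/within_continuousP => v hv.
    exact (cvgM (cvg_cst _) ((within_continuousP _ _).1 (cG f) v hv)).
  rewrite (cube_int_sum _ (P := xpredT) (f := fun f v => r f * G f v)); last first.
    by move=> f _; exact: crG.
  by apply: eq_bigr => f _; rewrite (cube_intZ _ (cG f)).
transitivity (cube_int (fun v : 'rV[R]_n => 0 : CC R)); last exact: cube_int0.
apply: eq_cube_int => v hv.
(* The cofactor contributes (-1)^(i + j) and the two ends contribute - (-1)^e, which is the boundary
   sign (-1)^(i + e) up to the global factor - (-1)^j. *)
transitivity (- (-1) ^+ j * (\sum_(f : face) (-1) ^+ (f.1.2 + f.2) * tc_coef (cl f)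
     * K (cl f) x (insert_coord f.1.2 (f.2%:R : R) v)
     * (phi (face_map f v) * face_minor (cl f) f.1.2 j (f.2%:R : R) v))); last first.
  by rewrite faces_cancel_pointwise // mulr0.
rewrite mulr_sumr; apply: eq_bigr => f _.
rewrite /r /G /cofactor -/(face_minor _ _ _ _ _) !exprD.
by ring.
Qed.

End Faces.


(** * Exact forms integrate to zero, and L annihilates the integral *)

Section StokesRelation.
Variables (R : realType) (n m : nat) (t : n.-tuple (CC R)).
Variables (s : CC R) (k : 'I_n.+2 -> CC R).
Local Notation p := (poles t).
Local Notation alpha := (s - \sum_i k i).
Local Notation beta := (s + \sum_i k i).
Variables (U : set 'rV[CC R]_m) (lX : 'rV[CC R]_m -> CC R).
Variables (lU : 'I_n.+1 -> 'rV[CC R]_m -> CC R).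
Hypothesis pi : injective p.
Hypothesis hU : open U.
Hypothesis hlX : log_branch U (@coordinates_product R m) lX.
Hypothesis hlU : forall j, log_branch U (uvar t j) (lU j).
Variable Z : seq (twisted_cube R n m).
Hypothesis hZ : forall l : 'I_(size Z), tc_valid t U (tnth (in_tuple Z) l).
Hypothesis hclosed : tc_closed s k U lX lU Z.
Variable x : 'rV[CC R]_m.
Hypothesis Ux : U x.
Local Notation K := (tc_integrand s k lX lU).
Local Notation cube := (@unit_cube R n.+1).
Local Notation D := (der (0 : R)^' (@toC R)).
Local Notation B c tau := (uqsum t x (tc_map c tau)).
Local Notation A c tau := (qsum (tc_map c tau)).

(** phi is a single-valued function of q, so it takes the same values on coinciding faces; the
    multivalued factor K is taken care of by the closedness of the cycle. *)
Lemma pairing_exact (phi : 'rV[CC R]_n.+1 -> CC R)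
    (V' : twisted_cube R n m -> 'I_n.+1 -> 'rV[R]_n.+1 -> CC R) j :
  (forall c, tc_valid t U c ->
     {within cube, continuous (fun tau => K c x tau * phi (tc_map c tau))}) ->
  (forall c b, tc_valid t U c -> {within cube, continuous (V' c b)}) ->
  (forall c a tau, tc_valid t U c -> cube tau -> 0 < tau 0 a < 1 ->
     D (fun r => K c x (tau + r *: delta_mx 0 a) * phi (tc_map c (tau + r *: delta_mx 0 a)))
       (K c x tau * phi (tc_map c tau)) (\sum_b V' c b tau * tc_jmx c tau a b)) ->
  pairing Z (fun c tau => V' c j tau) = 0.
Proof.
move=> cphi cV' dV; rewrite -(faces_cancel hZ hclosed (phi := phi) j Ux cphi).
rewrite /pairing [LHS]big_tnth [RHS]big_tnth; apply: eq_bigr => l _; congr (_ * _).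
apply: (cube_stokes (hZ l) (V := fun tau => K (tnth (in_tuple Z) l) x tau *
  phi (tc_map (tnth (in_tuple Z) l) tau)) (V' := V' (tnth (in_tuple Z) l)) j
  (cphi _ (hZ l)) (fun b => cV' _ b (hZ l))) => a e v he hv.
apply: (dV _ a _ (hZ l)); last by rewrite insert_coordE.
by apply: insert_coord_cube => //; case/andP: he => ? ?; rewrite !ltW.
Qed.

Local Notation field2 c j tau := (field1 t s k lX lU c x j tau * tc_map c tau 0 j
  + K c x tau / B c tau).

Section Cube.
Variable c : twisted_cube R n m.
Hypothesis hc : tc_valid t U c.

Lemma within_integrand : {within cube, continuous (K c x)}.
Proof. exact: (jointly_continuous_slice (integrand_jcont (s := s) (k := k) hU hlX hlU) hc Ux). Qed.

Lemma within_q j : {within cube, continuous (fun tau => tc_map c tau 0 j)}.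
Proof.
apply/within_continuousP => tau ht; pose proof (@within_id_cvg _ cube tau) as idc.
exact (cvg_q (j := j) hc ht idc (withinT _ _)).
Qed.

Lemma within_Aq : {within cube, continuous (fun tau => A c tau)}.
Proof.
apply/within_continuousP => tau ht; pose proof (@within_id_cvg _ cube tau) as idc.
exact (cvg_qsum hc ht idc (withinT _ _)).
Qed.

Lemma within_B : {within cube, continuous (fun tau => B c tau)}.
Proof.
apply/within_continuousP => tau ht; pose proof (@within_id_cvg _ cube tau) as idc.
exact (cvg_uqsum hU hlU hc Ux ht (cvg_cst x) idc (withinT _ _)).
Qed.

Lemma within_KB : {within cube, continuous (fun tau => K c x tau * (B c tau)^-1)}.
Proof.
apply/within_continuousP => tau ht.
exact (cvgM ((within_continuousP _ _).1 within_integrand tau ht)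
  (cvgV (uqsum_neq0 hc Ux ht) ((within_continuousP _ _).1 within_B tau ht))).
Qed.

Lemma within_KAB : {within cube, continuous (fun tau => K c x tau * (B c tau)^-1 * (A c tau)^-1)}.
Proof.
apply/within_continuousP => tau ht.
exact (cvgM ((within_continuousP _ _).1 within_KB tau ht)
  (cvgV (qsum_neq0 hc ht) ((within_continuousP _ _).1 within_Aq tau ht))).
Qed.

Lemma within_Kg j :
  {within cube, continuous (fun tau => K c x tau * gvar t s k x (tc_map c tau) j)}.
Proof.
exact: (jointly_continuous_slice (gvar_jcont (s := s) (k := k) (j := j) hU hlX hlU) hc Ux).
Qed.

(** Since 1 / (q_j B) = z_j / u_j and u_j / (q_j B)^2 = z_j^2 / u_j, the part of the derivative of K
    / B specific to j is - g_j K / u_j. What remains comes from the power of A and is common to all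
    j. *)
Lemma field1_gvar tau j : cube tau ->
  field1 t s k lX lU c x j tau =
  alpha * (K c x tau * (B c tau)^-1 * (A c tau)^-1)
  - (uvar t j x)^-1 * (K c x tau * gvar t s k x (tc_map c tau) (lift ord0 j)).
Proof.
move=> ht; have B0 := uqsum_neq0 hc Ux ht; have A0 := qsum_neq0 hc ht.
have q0 := q_neq0 hc j ht; have := uhom_neq0 hlU (lift ord0 j) Ux.
rewrite uhom_lift => u0.
rewrite /field1 /dlog_integrand /gvar /zvar uhom_lift qhom_lift.
set b := (\sum_i k i); field.
by rewrite B0 A0 q0 u0.
Qed.

Lemma within_field1 j : {within cube, continuous (field1 t s k lX lU c x j)}.
Proof.
apply/within_continuousP => tau ht; rewrite field1_gvar //.
refine (eq_near_cvg (g := field1 t s k lX lU c x j) _ _); last first.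
  exact (cvgB (cvgM (cvg_cst _) ((within_continuousP _ _).1 within_KAB tau ht))
    (cvgM (cvg_cst _) ((within_continuousP _ _).1 (within_Kg (j := lift ord0 j)) tau ht))).
by apply: filterS (withinT _ _) => w hw; rewrite field1_gvar.
Qed.

Lemma within_field2 (i j : 'I_n.+1) : {within cube, continuous (fun tau =>
  field1 t s k lX lU c x i tau * tc_map c tau 0 j + (i == j)%:R * (K c x tau / B c tau))}.
Proof.
apply/within_continuousP => tau ht.
exact (cvgD (cvgM ((within_continuousP _ _).1 (within_field1 (j := i)) tau ht)
    ((within_continuousP _ _).1 (within_q (j := j)) tau ht))
  (cvgM (cvg_cst _) ((within_continuousP _ _).1 within_KB tau ht))).
Qed.

(** The sum of the q_j is A - 1, that of the u_j / q_j is B - 1, and alpha - beta is minus twice the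
    sum of the k's. Together they cancel all parameters but the one of the pole 0, whose z is 1 /
    B. *)
Lemma sum_field2 tau : cube tau ->
  \sum_j (field1 t s k lX lU c x j tau * tc_map c tau 0 j + K c x tau / B c tau) =
  K c x tau * gvar t s k x (tc_map c tau) ord0
  - alpha * (K c x tau * (B c tau)^-1 * (A c tau)^-1).
Proof.
move=> ht; have B0 := uqsum_neq0 hc Ux ht; have A0 := qsum_neq0 hc ht.
have q0 j := q_neq0 hc j ht.
have E j : field1 t s k lX lU c x j tau * tc_map c tau 0 j + K c x tau / B c tau =
  K c x tau / B c tau * (2 * k (lift ord0 j) + alpha / A c tau * tc_map c tau 0 j
    - (beta - 1) / B c tau * (uvar t j x / tc_map c tau 0 j)).
  rewrite /field1 /dlog_integrand; set b := (\sum_i k i); field.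
  by rewrite B0 A0 q0.
rewrite (eq_bigr _ (fun j _ => E j)) -mulr_sumr sumrB big_split /= -!mulr_sumr.
have -> : \sum_j tc_map c tau 0 j = A c tau - 1 by rewrite /qsum addrC addKr.
have -> : \sum_j uvar t j x / tc_map c tau 0 j = B c tau - 1 by rewrite /uqsum addrC addKr.
have Ek : \sum_i k i = k ord0 + \sum_i k (lift ord0 i) by rewrite big_ord_recl.
rewrite /gvar /zvar uhom0 qhom0 Ek; set b := (\sum_i k (lift ord0 i)); field.
by rewrite B0 A0.
Qed.

End Cube.

(** The factor by which the integral of g_j K exceeds u_j; it does not involve j. *)
Definition theta := pairing Z (fun c tau => alpha * (K c x tau * (B c tau)^-1 * (A c tau)^-1)).

Lemma pairing_field1 j : pairing Z (fun c tau => field1 t s k lX lU c x j tau) = 0.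
Proof.
apply: (pairing_exact (phi := fun q => (uqsum t x q)^-1)
  (V' := fun c => field1 t s k lX lU c x) j).
- by move=> c hc; exact: within_KB.
- by move=> c b hc; exact: within_field1.
- by move=> c a tau hc ht hi; exact: (der_field1 hc Ux ht hi).
Qed.

Lemma pairing_field2 j : pairing Z (fun c tau => field2 c j tau) = 0.
Proof.
pose V' c b tau : CC R := field1 t s k lX lU c x b tau * tc_map c tau 0 j
     + (b == j)%:R * (K c x tau / B c tau).
transitivity (pairing Z (fun c tau => V' c j tau)).
  by apply: (eq_pairing hZ) => c tau _ _; rewrite /V' eqxx mul1r.
apply: (pairing_exact (phi := fun q => (uqsum t x q)^-1 * q 0 j) (V' := V') j).
- move=> c hc; apply/within_continuousP => tau ht; rewrite mulrA.
  rewrite (_ : (fun tau0 => K c x tau0 * _) =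
     (fun tau0 => K c x tau0 * (B c tau0)^-1 * tc_map c tau0 0 j)); last first.
    by apply/funext => w; rewrite mulrA.
  exact (cvgM ((within_continuousP _ _).1 (within_KB hc) tau ht)
    ((within_continuousP _ _).1 (within_q hc (j := j)) tau ht)).
- move=> c b hc; exact: (within_field2 hc).
- move=> c a tau hc ht hi.
  refine (der_eq (der_ext _ (der_field2 (j := j) hc Ux ht hi)) _ (erefl _)); last by rewrite mulrA.
  by apply: nearW => r; rewrite mulrA.
Qed.

(* Integrals of exact forms vanish: those of [K / B] and of [q_j K / B]. *)
Lemma pairing_gvar j :
  pairing Z (fun c tau => K c x tau * gvar t s k x (tc_map c tau) j) = uhom t j x * theta.
Proof.
have cKAB c : tc_valid t U c ->
    {within cube, continuous (fun tau => alpha * (K c x tau * (B c tau)^-1 * (A c tau)^-1))}.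
  move=> hc; apply/within_continuousP => tau ht.
  exact (cvgM (cvg_cst _) ((within_continuousP _ _).1 (within_KAB hc) tau ht)).
have cfield2 l c : tc_valid t U c -> {within cube, continuous (fun tau => field2 c l tau)}.
  move=> hc; apply/within_continuousP => tau ht.
  exact (cvgD (cvgM ((within_continuousP _ _).1 (within_field1 hc (j := l)) tau ht)
    ((within_continuousP _ _).1 (within_q hc (j := l)) tau ht))
    ((within_continuousP _ _).1 (within_KB hc) tau ht)).
have [i ->|->] := unliftP ord0 j.
  pose u := uvar t i x.
  have u0 : u != 0 by rewrite /u -uhom_lift (uhom_neq0 hlU).
  rewrite uhom_lift -/u.
  transitivity (pairing Z (fun c tau => u * (alpha * (K c x tau * (B c tau)^-1 * (A c tau)^-1))
      + - u * field1 t s k lX lU c x i tau)).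
    apply: (eq_pairing hZ) => c tau hc ht.
    by rewrite (field1_gvar hc i ht) -/u; field; rewrite u0 (uqsum_neq0 hc Ux ht) (qsum_neq0 hc ht).
  rewrite (pairingD hZ (g := fun c tau => u * (alpha * (K c x tau * (B c tau)^-1 * (A c tau)^-1)))
    (h := fun c tau => - u * field1 t s k lX lU c x i tau)); last 2 first.
  - move=> c hc; apply/within_continuousP => tau ht.
    exact (cvgM (cvg_cst u) ((within_continuousP _ _).1 (cKAB c hc) tau ht)).
  - move=> c hc; apply/within_continuousP => tau ht.
    exact (cvgM (cvg_cst (- u)) ((within_continuousP _ _).1 (within_field1 hc (j := i)) tau ht)).
  rewrite (pairingZ hZ u cKAB) (pairingZ hZ (- u) (g := fun c => field1 t s k lX lU c x i)
     (fun c hc => within_field1 hc (j := i))).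
  rewrite pairing_field1 mulr0 addr0 //.
transitivity (pairing Z (fun c tau => alpha * (K c x tau * (B c tau)^-1 * (A c tau)^-1)
   + \sum_j (field1 t s k lX lU c x j tau * tc_map c tau 0 j + K c x tau / B c tau))).
  apply: (eq_pairing hZ) => c tau hc ht.
  by rewrite (sum_field2 hc ht) addrC subrK.
rewrite uhom0 mul1r.
rewrite (pairingD hZ (g := fun c tau => alpha * (K c x tau * (B c tau)^-1 * (A c tau)^-1))
  (h := fun c tau => \sum_j field2 c j tau) cKAB); last first.
  move=> c hc; apply/within_continuousP => tau ht.
  by apply: cvg_bigsum => l _; exact: ((within_continuousP _ _).1 (cfield2 l c hc) tau ht).
rewrite (pairing_sum hZ (index_enum _) (g := fun j c tau => field2 c j tau) cfield2).
rewrite [X in _ + X]big1 ?addr0 // => l _; exact: pairing_field2.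
Qed.

Lemma opL_Kn_eq0 (I : 'I_n.+1 -> 'I_m) : (m <= n + n.+1)%N ->
  injective (fun a => x 0 (I a)) -> opL t s k I (Kn s k lX lU Z) x = 0.
Proof.
move=> mn Ii; rewrite (opL_Kn s k pi hU hlX hlU hZ Ux Ii).
have I_inj : injective I by move=> a b e; apply: Ii; rewrite e.
have X0 := coordinates_neq0 hlX Ux.
have H := residue_relation pi I_inj (fun l j => coord_neq_pole pi hlX hlU l j Ux) mn.
suff E : \sum_j residue_weight p (fun a => x 0 (I a)) j *
      pairing Z (fun c tau => K c x tau * gvar t s k x (tc_map c tau) j) =
    pole_weight p ord0 ^+ 2 / coordinates_product x * theta *
      \sum_j residue_weight p (fun a => x 0 (I a)) j *
        ((\prod_l (x 0 l - p j)) / pole_weight p j ^+ 2).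
  have {E} E0 := etrans E (congr1 _ H); rewrite mulr0 in E0.
  exact: (etrans (congr1 _ E0) (mulr0 _)).
rewrite mulr_sumr; apply: eq_bigr => j _.
transitivity (residue_weight p (fun a => x 0 (I a)) j * (uhom t j x * theta)).
  by congr (_ * _); exact: pairing_gvar.
by rewrite (uhomE _ pi X0); ring.
Qed.

End StokesRelation.


(** Differentiability is part of the conclusion because [pd] has a value even where no derivative
    exists. The equations are stated where the chosen coordinates are distinct, as a vanishing
    denominator would have inverse 0. *)
Theorem theorem3p4p1 (R : realType) (n : nat) (hn : (1 < n)%N)
    (t : n.-tuple (CC R)) (ht0 : 0 \notin t) (ht1 : 1 \notin t) (ht : uniq t)
    (s : CC R) (k : 'I_n.+2 -> CC R)
    (U : set 'rV[CC R]_(2 * n).+1) (hU : open U)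
    (lX : 'rV[CC R]_(2 * n).+1 -> CC R)
    (hlX : log_branch U (@coordinates_product R (2 * n).+1) lX)
    (lU : 'I_n.+1 -> 'rV[CC R]_(2 * n).+1 -> CC R)
    (hlU : forall j, log_branch U (uvar t j) (lU j))
    (Z : seq (twisted_cube R n (2 * n).+1))
    (hZ : twisted_cycle t s k U lX lU Z) :
  [/\ (forall (i j : 'I_(2 * n).+1) x, U x ->
         derivable (Kn s k lX lU Z) x (delta_mx 0 i) /\
         derivable (pd i (Kn s k lX lU Z)) x (delta_mx 0 j)),
      (forall I : 'I_n.+1 -> 'I_(2 * n).+1, {homo I : a b / (a < b)%N} ->
         forall x, U x -> injective (fun a => x 0 (I a)) ->
         opL t s k I (Kn s k lX lU Z) x = 0)
    & (forall I : 'I_n.+2 -> 'I_(2 * n).+1, {homo I : a b / (a < b)%N} ->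
         forall x, U x -> injective (fun a => x 0 (I a)) ->
         opM t s I (Kn s k lX lU Z) x = 0)].
Proof.
have pi := poles_inj ht0 ht1 ht; have [hZv hZc] := hZ.
split=> [i j x Ux|I _ x Ux Ix|I _ x Ux Ix].
- have [d1 _] := Kn_derive s k pi hU hlX hlU hZv i Ux.
  by have [d2 _] := pd_Kn_derive s k pi hU hlX hlU hZv i j Ux.
- apply: (opL_Kn_eq0 pi hU hlX hlU hZv hZc Ux) Ix.
  (* The number of variables, 2n + 1, attains the bound n + (n + 1) of [residue_relation]. *)
  by rewrite mul2n -addnn addnS.
- exact: (opM_Kn s k pi hU hlX hlU hZv Ux Ix).
Qed.
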